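(* Suppose $n\ge 2$. Let $f$ be a continuous function on $\overline{\mathbb{D}}^n$ such that the Hankel operator $H_f$ is compact on $A^2_\vartheta$. Then there exist a function $h$ which is continuous on $\overline{\mathbb{D}}^n$ and holomorphic on $\mathbb{D}^n$, and a bounded function $g$ on $\mathbb{D}^n$ satisfying $\lim_{z\to\partial\mathbb{D}^n} g(z)=0$, such that $f(z)=h(z)+g(z)$ for $\vartheta$-a.e. $z\in\mathbb{D}^n$.
   Context: $\mathbb{D}^n$ is the open unit polydisc in $\mathbb{C}^n$, $\overline{\mathbb{D}}^n$ its closure, $\partial\mathbb{D}^n$ its topological boundary in $\mathbb{C}^n$, and $\mathbb{T}^n$ the $n$-torus with normalized surface (Haar) measure $\sigma$, $\sigma(\mathbb{T}^n)=1$. For $r\in[0,1)^n$ and $\zeta\in\mathbb{T}^n$, $r\cdot\zeta=(r_1\zeta_1,\ldots,r_n\zeta_n)$. Standing assumptions: $\mu_1,\ldots,\mu_n$ are regular Borel probability measures on $[0,1)$ with $\mu_j([r,1))>0$ for all $0<r<1$ and $1\le j\le n$; $\mu=\mu_1\times\cdots\times\mu_n$ on $[0,1)^n$; and $\vartheta$ is the regular Borel probability measure on $\mathbb{D}^n$ determined by $$\int_{\mathbb{D}^n} f\,\mathrm{d}\vartheta=\int_{[0,1)^n}\Big\{\int_{\mathbb{T}^n} f(r\cdot\zeta)\,\mathrm{d}\sigma(\zeta)\Big\}\mathrm{d}\mu(r)$$ for all continuous compactly supported $f$ on $\mathbb{D}^n$. $L^2_\vartheta=L^2(\mathbb{D}^n,\vartheta)$;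 the Bergman space $A^2_\vartheta$ is the closure in $L^2_\vartheta$ of the holomorphic polynomials; $P$ is the orthogonal projection of $L^2_\vartheta$ onto $A^2_\vartheta$. For $f\in L^2_\vartheta$, the Hankel operator $H_f$ is the densely defined operator from $A^2_\vartheta$ to $L^2_\vartheta\ominus A^2_\vartheta$ given by $H_f\varphi=(1-P)(f\varphi)$ for holomorphic polynomials $\varphi$. For bounded $f$ it extends to a bounded operator; $H_f$ is compact if it extends to a compact operator on $A^2_\vartheta$. $\lim_{z\to\partial\mathbb{D}^n}g(z)=0$ means: for every $\epsilon>0$ there is a compact set $M\subset\mathbb{D}^n$ such that $|g(z)|<\epsilon$ for $\vartheta$-a.e. $z\in\mathbb{D}^n\setminus M$. *)

(* Defs.v *)
From HB Require Import structures.
From mathcomp Require Import all_boot all_order all_algebra.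
From mathcomp Require Import complex.
From mathcomp Require mpoly.
From mathcomp Require Import all_classical all_reals all_analysis.

Set Implicit Arguments.
Unset Strict Implicit.
Unset Printing Implicit Defensive.

Import Order.TTheory GRing.Theory Num.Theory.
Import numFieldNormedType.Exports.

Local Open Scope classical_set_scope.
Local Open Scope complex_scope.
Local Open Scope ring_scope.

(* The topology on R[i] is the one given by the
   modulus, with R[i] a normed module over itself.  In particular
   [differentiable] on 'rV[R[i]]_n is complex differentiability. *)
#[warnings="-redundant-canonical-projection"]
HB.instance Definition _ (R : rcfType) := NormedModule.copy R[i] R[i]^o.

(* Borel sigma-algebra on matrices; C^n is 'rV[R[i]]_n. *)
#[warnings="-redundant-canonical-projection"]
HB.instance Definition _ (T : ptopologicalType) (m n : nat) :=
  Measurable.copy 'M[T]_(m, n) (g_sigma_algebraType (@open 'M[T]_(m, n))).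

Section Polydisc.
Context (R : realType) (n : nat).
Local Notation Cn := 'rV[R[i]]_n.

Definition polydisc : set Cn := [set z | forall j, `|z 0 j| < 1].

Definition torus : set Cn := [set z | forall j, `|z 0 j| = 1].

(* [0,1)^n *)
Definition radii : set (n.-tuple R) := [set r | forall j, 0 <= tnth r j < 1].

Definition dilate (r : n.-tuple R) (z : Cn) : Cn :=
  \row_j ((tnth r j)%:C * z 0 j).

Definition rotate (xi z : Cn) : Cn := \row_j (xi 0 j * z 0 j).

Definition holomorphic_on (D : set Cn) (h : Cn -> R[i]) : Prop :=
  forall z, D z -> differentiable h z.

End Polydisc.
Arguments polydisc {R n}.
Arguments torus {R n}.
Arguments radii {R n}.

Definition Cintegral d (T : measurableType d) (R : realType)
    (nu : {measure set T -> \bar R}) (D : set T) (f : T -> R[i]) : R[i] :=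
  (\int[nu]_(x in D) complex.Re (f x)) +i* (\int[nu]_(x in D) complex.Im (f x)).

Section Measures.
Context (R : realType) (n : nat).
Local Notation Cn := 'rV[R[i]]_n.

(* A probability measure on [0,1), viewed on R, whose support reaches 1. *)
Definition radial_probability (nu : probability R R) : Prop :=
  nu [set` `[0, 1[] = 1%E /\ (forall r : R, 0 < r < 1 -> (0 < nu [set` `[r, 1[%R])%E).

Definition is_product_measure (mu_ : 'I_n -> probability R R)
    (mu : probability (n.-tuple R) R) : Prop :=
  forall A : 'I_n -> set R, (forall j, measurable (A j)) ->
    mu [set r | forall j, A j (tnth r j)] = (\prod_(j < n) mu_ j (A j))%E.

(* Normalized Haar measure of the n-torus, viewed on C^n. *)
Definition is_torus_haar (sigma : probability Cn R) : Prop :=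
  sigma torus = 1%E /\
  (forall (xi : Cn) (A : set Cn), torus xi -> measurable A ->
    sigma (rotate xi @^-1` A) = sigma A).

Definition compactly_supported (f : Cn -> R[i]) : Prop :=
  exists K : set Cn, [/\ compact K, K `<=` polydisc &
    forall z, polydisc z -> ~ K z -> f z = 0].

(* The probability measure on the polydisc, viewed on C^n, with given radial
   and angular parts. *)
Definition is_polar_measure (mu : probability (n.-tuple R) R)
    (sigma theta : probability Cn R) : Prop :=
  theta polydisc = 1%E /\
  (forall f : Cn -> R[i], {within polydisc, continuous f} ->
    compactly_supported f ->
    Cintegral theta polydisc f =
    Cintegral mu radii
      (fun r => Cintegral sigma torus (fun zeta => f (dilate r zeta)))).

End Measures.

(* Elements of L^2 are represented by functions C^n -> C; equality in L^2 is
   [eqL2], and values outside the polydisc are irrelevant. *)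
Section Hankel.
Context (R : realType) (n : nat).
Local Notation Cn := 'rV[R[i]]_n.
Variable theta : probability Cn R.
Implicit Types (u v w f phi : Cn -> R[i]).

Definition sqnormL2 u : \bar R :=
  (\int[theta]_(z in polydisc) ((Normc.normc (u z)) ^+ 2)%:E)%E.

Definition inL2 u : Prop :=
  [/\ measurable_fun polydisc (fun z => complex.Re (u z)),
      measurable_fun polydisc (fun z => complex.Im (u z)) &
      (sqnormL2 u < +oo)%E].

Definition eqL2 u v : Prop := {ae theta, forall z, polydisc z -> u z = v z}.

Definition innerL2 u v : R[i] :=
  Cintegral theta polydisc (fun z => u z * (v z)^*).

Definition cvgL2 (u_ : nat -> Cn -> R[i]) v : Prop :=
  sqnormL2 (u_ k \- v) @[k --> \oo] --> 0%E.

Definition polyfun (p : mpoly.mpoly n R[i]) : Cn -> R[i] :=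
  fun z => mpoly.meval (z 0) p.

Definition bergman u : Prop :=
  inL2 u /\ (forall e : R, 0 < e ->
    exists p, (sqnormL2 (u \- polyfun p)%R < (e ^+ 2)%:E)%E).

Definition bergman_perp u : Prop :=
  inL2 u /\ (forall w, bergman w -> innerL2 u w = 0).

(* P is a version, at the level of functions, of the orthogonal projection of
   L^2 onto the Bergman space; this determines P u up to [eqL2]. *)
Definition is_bergman_projection (P : (Cn -> R[i]) -> Cn -> R[i]) : Prop :=
  forall u, inL2 u -> bergman (P u) /\ bergman_perp (u \- P u).

Definition hankel (P : (Cn -> R[i]) -> Cn -> R[i]) f phi : Cn -> R[i] :=
  (f \* phi) \- P (f \* phi).

Definition strictly_increasing (s : nat -> nat) : Prop :=
  forall k, (s k < s k.+1)%N.

(* Linear operators from the Bergman space to its orthogonal complement in L^2,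
   acting on representatives, which are compact: bounded sequences have
   subsequences with convergent image. *)
Record compact_operator (T : (Cn -> R[i]) -> Cn -> R[i]) : Prop := {
  operator_perp : forall u, bergman u -> bergman_perp (T u);
  operator_eqL2 : forall u v, bergman u -> bergman v ->
    eqL2 u v -> eqL2 (T u) (T v);
  operator_linear : forall (a : R[i]) u v, bergman u -> bergman v ->
    eqL2 (T ((a \*: u) \+ v)) ((a \*: T u) \+ T v);
  operator_compact : forall u_ : nat -> Cn -> R[i],
    (forall k, bergman (u_ k)) ->
    (exists M : R, forall k, (sqnormL2 (u_ k) <= M%:E)%E) ->
    exists s w, [/\ strictly_increasing s, inL2 w &
      cvgL2 (fun k => T (u_ (s k))) w] }.

Definition compact_hankel (P : (Cn -> R[i]) -> Cn -> R[i]) f : Prop :=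
  exists2 T, compact_operator T &
    forall p, eqL2 (T (polyfun p)) (hankel P f (polyfun p)).

Definition vanishing_at_boundary (g : Cn -> R[i]) : Prop :=
  forall e : R, 0 < e -> exists M : set Cn,
    [/\ compact M, M `<=` polydisc &
      {ae theta, forall z, (polydisc `\` M) z -> Normc.normc (g z) < e}].

End Hankel.

(* Main.v *)
(** The measure [theta] is invariant under rotations, so we expand [f] in
    Fourier series on the tori [r . T^n].  For each [j], the functions [z_j^k v]
    with [v] independent of [z_j] and orthogonal to the analytic monomials,
    normalised, are orthogonal to the Bergman space and tend weakly to zero,
    their mass moving to [|z_j| = 1]; the same holds for the [z_j^k].
    Compactness of [H_f] then forces the restriction of [f] to the face
    [z_j = 1] to have only analytic Fourier terms: the [m]th coefficient at
    radius [r], with [r_j = 1], is its value at the corner times [r^m], and it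
    vanishes unless [m_i >= 0] for [i <> j].  As [n >= 2], letting [j] vary shows
    that the Fourier coefficients of [f] on the torus vanish unless [m >= 0].
    Averaging [f] over rotations against normalised powers of the kernel
    [prod_i |1 + xi_i|^2 / 4] yields polynomials that converge uniformly on the
    torus, hence, by the maximum principle, on the closed polydisc; the limit
    [h] agrees with [f] on the part of the boundary which [theta] charges in
    the limit, so that [f - h] vanishes at the boundary. *)

Require Import Defs.
From HB Require Import structures.
From mathcomp Require Import all_boot all_order all_algebra.
From mathcomp Require Import complex.
From mathcomp Require Import all_classical all_reals all_analysis.
From mathcomp Require Import measurable_realfun ring lra.
From mathcomp Require mpoly.

Import Order.TTheory GRing.Theory Num.Theory.
Import numFieldNormedType.Exports.

Local Open Scope classical_set_scope.
Local Open Scope complex_scope.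
Local Open Scope ring_scope.

Set Implicit Arguments.
Unset Strict Implicit.
Unset Printing Implicit Defensive.

(** All integrands are kept continuous on the whole of C^n: [f] is replaced by its composite [F]
    with a retraction onto the closed polydisc, and [theta], [sigma] and the law of the radii,
    carried over to C^n, share the same lemmas. The function [v] is built from [F] itself. Let [A]
    be a Fourier component of [F] restricted to the face [z_j = 1], let [B] be the monomial to which
    it should be proportional, or 0 if there is none, and choose [c] so that [v = A - c B] is
    orthogonal to [B]. Rotation invariance then makes [z_j^k v] orthogonal to every monomial. The
    pairing of the image of [z_j^k] with [z_j^k v] tends to 0, because the first factor converges
    along a subsequence and the second tends weakly to 0; in the limit [A] is orthogonal to [v], so
    [v] has norm 0. The factor [z_j^k] hides the sign of the [j]th frequency, which has to be read
    off another face. Since the laws of the radii may miss parts of [0,1), identities on a face hold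
    only for almost every radius; the corner, however, lies in their support, so they can be
    evaluated there. *)

Local Notation normc := Normc.normc.

(** * The modulus of a complex number *)

Section Modulus.
Context (R : realType).
Implicit Types z w : R[i].

Lemma normcE z : `|z| = (normc z)%:C. Proof. by []. Qed.

Lemma normc_ge0 z : 0 <= normc z.
Proof. by rewrite -lecR -normcE normr_ge0. Qed.

Lemma normc_conj z : normc z^* = normc z.
Proof. by apply: complexI; rewrite -!normcE normcJ. Qed.

Lemma conjcM z w : (z * w)^* = z^* * w^*.
Proof. exact: rmorphM. Qed.

Lemma conjc2 z : z^*^* = z.
Proof. exact: conjcK. Qed.

Lemma conjc_one : (1 : R[i])^* = 1.
Proof. exact: conjc1. Qed.

Lemma conjc_zero : (0 : R[i])^* = 0.
Proof. exact: conjc0. Qed.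

Lemma conjc_realE (x : R) : x%:C^* = x%:C.
Proof. exact: conjc_real. Qed.

Lemma conjcX z k : (z ^+ k)^* = z^* ^+ k.
Proof. exact: rmorphXn. Qed.

Lemma normc_real (x : R) : normc x%:C = `|x|.
Proof. by rewrite /= expr0n addr0 sqrtr_sqr. Qed.

Lemma normcX z k : normc (z ^+ k) = normc z ^+ k.
Proof. by apply: complexI; rewrite -normcE normrX rmorphXn. Qed.

Lemma normc_eq0 z : (normc z == 0) = (z == 0).
Proof. by rewrite -(inj_eq (@complexI R)) -normcE normr_eq0. Qed.

Lemma normc_gt0 z : (0 < normc z) = (z != 0).
Proof. by rewrite lt_neqAle normc_ge0 andbT eq_sym normc_eq0. Qed.

Lemma normc_sub z w : normc (z - w) = normc (w - z).
Proof. by rewrite -normcN opprB. Qed.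

Lemma le_normcB z w : normc (z - w) <= normc z + normc w.
Proof. by rewrite -(normcN w) le_normcD. Qed.

Lemma normc_triangle u z w : normc (z - w) <= normc (z - u) + normc (u - w).
Proof. by rewrite (le_trans _ (le_normcD _ _)) // addrA subrK. Qed.

Lemma normc_dist z w : `|normc z - normc w| <= normc (z - w).
Proof.
rewrite ler_norml; apply/andP; split.
  rewrite lerNl opprB lerBlDr -[X in X <= _](congr1 (@normc R) (subrK z w)).
  by rewrite (le_trans (le_normcD _ _)) // normc_sub.
by rewrite lerBlDr -[X in X <= _](congr1 (@normc R) (subrK w z)) le_normcD.
Qed.

Lemma normc_Re z : `|complex.Re z| <= normc z.
Proof. by rewrite -lecR normc_ge_Re. Qed.

Lemma normc_Im z : `|complex.Im z| <= normc z.
Proof.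
case: z => a b /=; rewrite -sqrtr_sqr ler_wsqrtr // lerDr; exact: sqr_ge0.
Qed.

Lemma normc_le_ReIm z : normc z <= `|complex.Re z| + `|complex.Im z|.
Proof.
case: z => a b /=; rewrite -[leRHS]ger0_norm ?addr_ge0// -sqrtr_sqr.
rewrite ler_wsqrtr// sqrrD !real_normK ?num_real// lerD2r lerDl.
by rewrite mulrn_wge0// mulr_ge0.
Qed.

Lemma mul_conj_normc z : z * z^* = (normc z ^+ 2)%:C.
Proof. by rewrite -sqr_normc normcE rmorphXn. Qed.

Lemma normc_sum (I : Type) (s : seq I) (F : I -> R[i]) :
  normc (\sum_(i <- s) F i) <= \sum_(i <- s) normc (F i).
Proof.
elim: s => [|x s IH]; first by rewrite !big_nil Normc.normc0.
by rewrite !big_cons (le_trans (le_normcD _ _)) // lerD2l.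
Qed.

Lemma normc_prod (I : Type) (s : seq I) (F : I -> R[i]) :
  normc (\prod_(i <- s) F i) = \prod_(i <- s) normc (F i).
Proof.
elim: s => [|x s IH]; first by rewrite !big_nil Normc.normc1.
by rewrite !big_cons Normc.normcM IH.
Qed.

End Modulus.

(** * Continuity and compactness in C^n *)

Section Topology.
Context (R : realType) (n : nat).
Local Notation Cn := 'rV[R[i]]_n.

(** Balls of [R[i]] have their radius in [R[i]]; a positive element is real, so real radii describe
    the same neighbourhoods. *)
Lemma nbhs_complexP (z : R[i]) (A : set R[i]) :
  nbhs z A <-> exists2 d : R, 0 < d & forall w, normc (z - w) < d -> A w.
Proof.
split.
- move=> /nbhs_ballP [d /= d0 dA].
  have de : d = (complex.Re d)%:C.
    by case: d d0 {dA} => a b; rewrite ltcE /= => /andP[/eqP -> _].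
  exists (complex.Re d); first by move: d0; rewrite de ltcR.
  by move=> w zw; apply: dA; rewrite -ball_normE /ball_ /= de ltcR.
- move=> [d d0 dA]; apply/nbhs_ballP; exists d%:C => /=; first by rewrite ltcR.
  by move=> w; rewrite -ball_normE /ball_ /= ltcR; exact: dA.
Qed.

Lemma nbhs_vecP (z : Cn) (A : set Cn) : nbhs z A <->
  exists2 d : R, 0 < d & forall w : Cn, (forall i, normc (z 0 i - w 0 i) < d) -> A w.
Proof.
split.
- move=> /nbhs_ballP [d /= d0 dA].
  have de : d = (complex.Re d)%:C.
    by case: d d0 {dA} => a b; rewrite ltcE /= => /andP[/eqP -> _].
  exists (complex.Re d); first by move: d0; rewrite de ltcR.
  move=> w zw; apply: dA; split=> // i j; rewrite ord1.
  by rewrite -ball_normE /ball_ /= de ltcR.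
- move=> [d d0 dA]; apply/nbhs_ballP; exists d%:C => /=; first by rewrite ltcR.
  move=> w [_ zw]; apply: dA => i; have := zw 0 i.
  by rewrite -ball_normE /ball_ /= ltcR.
Qed.

Lemma continuous_vecP (G : Cn -> R[i]) : continuous G <->
  forall (z : Cn) (e : R), 0 < e -> exists2 d : R, 0 < d &
    forall w : Cn, (forall i, normc (z 0 i - w 0 i) < d) -> normc (G z - G w) < e.
Proof.
split=> cG z.
- move=> e e0; have : nbhs (G z) [set w | normc (G z - w) < e].
    by apply/nbhs_complexP; exists e.
  by move/cG => /nbhs_vecP.
- move=> A /nbhs_complexP [e e0 eA].
  have [d d0 dG] := cG z e e0; apply/nbhs_vecP; exists d => // w /dG; exact: eA.
Qed.

Lemma continuous_vec_realP (G : Cn -> R) : continuous G <->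
  forall (z : Cn) (e : R), 0 < e -> exists2 d : R, 0 < d &
    forall w : Cn, (forall i, normc (z 0 i - w 0 i) < d) -> `|G z - G w| < e.
Proof.
split=> cG z.
- move=> e e0; have : nbhs (G z) [set w | `|G z - w| < e].
    by apply/nbhs_ballP; exists e.
  by move/cG => /nbhs_vecP.
- move=> A /nbhs_ballP [e e0 eA].
  have [d d0 dG] := cG z e e0; apply/nbhs_vecP; exists d => // w /dG; exact: eA.
Qed.

Lemma Re_continuous (G : Cn -> R[i]) :
  continuous G -> continuous (fun z => complex.Re (G z)).
Proof.
move=> /continuous_vecP cG; apply/continuous_vec_realP => z e e0.
have [d d0 dG] := cG z e e0; exists d => // w /dG.
by apply: le_lt_trans; rewrite -raddfB normc_Re.
Qed.

Lemma Im_continuous (G : Cn -> R[i]) :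
  continuous G -> continuous (fun z => complex.Im (G z)).
Proof.
move=> /continuous_vecP cG; apply/continuous_vec_realP => z e e0.
have [d d0 dG] := cG z e e0; exists d => // w /dG.
by apply: le_lt_trans; rewrite -raddfB normc_Im.
Qed.

Lemma normc_continuous (G : Cn -> R[i]) :
  continuous G -> continuous (fun z => normc (G z)).
Proof.
move=> /continuous_vecP cG; apply/continuous_vec_realP => z e e0.
have [d d0 dG] := cG z e e0; exists d => // w /dG.
by apply: le_lt_trans; rewrite normc_dist.
Qed.

Lemma conjc_continuous (G : Cn -> R[i]) :
  continuous G -> continuous (fun z => (G z)^*).
Proof.
move=> /continuous_vecP cG; apply/continuous_vecP => z e e0.
have [d d0 dG] := cG z e e0; exists d => // w /dG.
by rewrite -rmorphB normc_conj.
Qed.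

Lemma real_complex_continuous (G : Cn -> R) :
  continuous G -> continuous (fun z => (G z)%:C).
Proof.
move=> /continuous_vec_realP cG; apply/continuous_vecP => z e e0.
have [d d0 dG] := cG z e e0; exists d => // w /dG.
by rewrite -rmorphB normc_real.
Qed.

Lemma coord_vec_continuous (i : 'I_n) : continuous (fun z : Cn => z 0 i).
Proof. exact: coord_continuous. Qed.

Lemma eq_continuous_vec (T : topologicalType) (F G : Cn -> T) :
  F =1 G -> continuous F -> continuous G.
Proof. by move=> /funext ->. Qed.

Lemma mulc_continuous (F G : Cn -> R[i]) :
  continuous F -> continuous G -> continuous (fun z => F z * G z).
Proof. by move=> cF cG z; exact: (@continuousM R[i] _ F G z (cF z) (cG z)). Qed.

Lemma addc_continuous (F G : Cn -> R[i]) :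
  continuous F -> continuous G -> continuous (fun z => F z + G z).
Proof. by move=> cF cG z; exact: (@continuousD R[i] R[i] _ F G z (cF z) (cG z)). Qed.

Lemma subc_continuous (F G : Cn -> R[i]) :
  continuous F -> continuous G -> continuous (fun z => F z - G z).
Proof. by move=> cF cG z; exact: (@continuousB R[i] R[i] _ F G z (cF z) (cG z)). Qed.

Lemma cstc_continuous (c : R[i]) : continuous (fun _ : Cn => c).
Proof. move=> z A; exact: (@cst_continuous Cn R[i] c z A). Qed.

Lemma expc_continuous (F : Cn -> R[i]) k :
  continuous F -> continuous (fun z => F z ^+ k).
Proof.
move=> cF; elim: k => [|k IH]; first exact: cstc_continuous.
have -> : (fun z => F z ^+ k.+1) = (fun z => F z * F z ^+ k).
  by apply/funext => z; rewrite exprS.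
exact: (mulc_continuous cF IH).
Qed.

Lemma sumc_continuous (I : Type) (s : seq I) (F : I -> Cn -> R[i]) :
  (forall i, continuous (F i)) -> continuous (fun z => \sum_(i <- s) F i z).
Proof.
move=> cF; elim: s => [|x s IH].
  have -> : (fun z => \sum_(i <- [::]) F i z) = (fun=> 0).
    by apply/funext => z; rewrite big_nil.
  exact: cstc_continuous.
have -> : (fun z => \sum_(i <- x :: s) F i z) =
    (fun z => F x z + \sum_(i <- s) F i z).
  by apply/funext => z; rewrite big_cons.
exact: (addc_continuous (cF x) IH).
Qed.

Lemma prodc_continuous (I : Type) (s : seq I) (P : pred I) (F : I -> Cn -> R[i]) :
  (forall i, continuous (F i)) -> continuous (fun z => \prod_(i <- s | P i) F i z).
Proof.
move=> cF; elim: s => [|x s IH].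
  have -> : (fun z => \prod_(i <- [::] | P i) F i z) = (fun=> 1).
    by apply/funext => z; rewrite big_nil.
  exact: cstc_continuous.
have -> : (fun z => \prod_(i <- x :: s | P i) F i z) =
    (fun z => (if P x then F x z else 1) * \prod_(i <- s | P i) F i z).
  by apply/funext => z; rewrite big_cons; case: ifP => // _; rewrite mul1r.
by case: (P x); apply: (mulc_continuous _ IH); [exact: cF|exact: cstc_continuous].
Qed.

Lemma vec_continuous (G : Cn -> Cn) :
  (forall i, continuous (fun z => G z 0 i)) -> continuous G.
Proof.
move=> cG z A /nbhs_vecP [e e0 eA].
have /choice [d dP] : forall i, exists d : R, 0 < d /\
    forall w : Cn, (forall k, normc (z 0 k - w 0 k) < d) ->
      normc (G z 0 i - G w 0 i) < e.
  by move=> i; have /continuous_vecP/(_ z e e0) [d d0 dG] := cG i; exists d.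
apply/nbhs_vecP; exists (\big[Order.min/1]_i d i).
  by elim/big_ind : _ => // [x y x0 y0|i _]; [rewrite lt_min x0|have [] := dP i].
move=> w zw; apply: eA => i; have [_] := dP i; apply => k.
by rewrite (lt_le_trans (zw k))// bigmin_le_cond.
Qed.

Lemma comp_continuous (G : Cn -> R[i]) (p : Cn -> Cn) :
  continuous G -> continuous p -> continuous (fun z => G (p z)).
Proof. by move=> cG cp z; apply: (@continuous_comp _ _ _ p G); [exact: cp|exact: cG]. Qed.

Lemma max0_continuous (G : Cn -> R) :
  continuous G -> continuous (fun z => Order.max 0 (G z)).
Proof.
move=> /continuous_vec_realP cG; apply/continuous_vec_realP => z e e0.
have [d d0 dG] := cG z e e0; exists d => // w /dG; apply: le_lt_trans.
case: (leP 0 (G z)) => Gz; case: (leP 0 (G w)) => Gw //.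
- by rewrite subr0 ger0_norm// (le_trans _ (ler_norm _))//; lra.
- by rewrite sub0r normrN ger0_norm// distrC (le_trans _ (ler_norm _))//; lra.
- by rewrite subrr normr0.
Qed.

Lemma affine_continuous (a b : R) (G : Cn -> R) :
  continuous G -> continuous (fun z => a * G z + b).
Proof.
move=> cG z.
have ca := @cst_continuous Cn R a z; have cb := @cst_continuous Cn R b z.
exact: (@continuousD R R Cn _ _ z (@continuousM R Cn _ _ z ca (cG z)) cb).
Qed.

Definition cpolydisc (rho : R) : set Cn :=
  [set z | forall i, normc (z 0 i) <= rho].

(** The disc is closed and lies in the continuous image of a product of two real segments. *)
Lemma compact_cdisc (rho : R) : compact [set z : R[i] | normc z <= rho].
Proof.
pose A := [set p : R * R | p.1 \in `[- rho, rho] /\ p.2 \in `[- rho, rho]].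
have cA : compact A.
  apply: (@compact_setX R R [set` `[- rho, rho]] [set` `[- rho, rho]]);
    exact: segment_compact.
pose E := fun p : R * R => p.1 +i* p.2.
have cE : continuous E.
  move=> [x y] B /nbhs_complexP [e e0 eB]; apply/nbhs_ballP; exists (e / 2) => /=.
    by rewrite divr_gt0.
  move=> [x' y'] [/= xx yy]; apply: eB; apply: le_lt_trans (normc_le_ReIm _) _.
  by rewrite /= (splitr e) ltrD.
have cEA := continuous_compact (continuous_subspaceT cE) cA.
apply: (subclosed_compact _ cEA).
- rewrite closedE => z; apply: contra_notP => /= /negP; rewrite -ltNge => rz.
  apply/nbhs_complexP; exists (normc z - rho); first by rewrite subr_gt0.
  move=> w zw /=; apply/negP; rewrite -ltNge.
  have := le_trans (ler_norm _) (normc_dist z w).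
  by move/le_lt_trans/(_ zw); rewrite ltrD2l ltrN2.
- move=> [x y] /= zr; exists (x, y) => //; split; rewrite in_itv /= -ler_norml.
    exact: le_trans (normc_Re (x +i* y)) zr.
  exact: le_trans (normc_Im (x +i* y)) zr.
Qed.

Lemma compact_cpolydisc (rho : R) : compact (cpolydisc rho).
Proof. by apply: (@rV_compact _ n (fun=> [set z | normc z <= rho])) => i; exact: compact_cdisc. Qed.

(** Only [z] is confined to [K]: with [G] continuous everywhere, nearby points [w] may leave [K],
    and no membership has to be checked for them. *)
Lemma compact_unif_continuous (K : set Cn) (G : Cn -> R[i]) (e : R) :
  compact K -> continuous G -> 0 < e ->
  exists2 d : R, 0 < d & forall z w : Cn, K z ->
    (forall i, normc (z 0 i - w 0 i) < d) -> normc (G z - G w) < e.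
Proof.
move=> /compact_near_coveringP cK /continuous_vecP cG e0.
have := cK R (0^'+) (fun d (z : Cn) => forall w : Cn, (forall i, normc (z 0 i - w 0 i) < d) ->
  normc (G z - G w) < e).
case => [z Kz|d [/= d0 dP]]; last first.
  exists (d / 2); first by rewrite divr_gt0.
  move=> z w Kz; apply: (dP (d / 2)) => //=; last by rewrite divr_gt0.
  by rewrite sub0r normrN gtr0_norm ?divr_gt0// ltr_pdivrMr// ltr_pMr// ltr1n.
have [d d0 dG] := cG z (e / 2) (divr_gt0 e0 (ltr0Sn R 1)).
exists ([set x : Cn | forall i, normc (z 0 i - x 0 i) < d / 2], [set x | x < d / 2]).
  split; first by apply/nbhs_vecP; exists (d / 2) => //; rewrite divr_gt0.
  by apply: nbhs_right_lt; rewrite divr_gt0.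
move=> [x r] /= [zx rd] w xw.
rewrite (le_lt_trans (normc_triangle (G z) _ _))// (splitr e) ltrD//.
  rewrite normc_sub; apply: dG => i; apply: lt_trans (zx i) _.
  by rewrite ltr_pdivrMr// ltr_pMr// ltr1n.
apply: dG => i; apply: le_lt_trans (normc_triangle (x 0 i) _ _) _.
by rewrite (splitr d) ltrD// (lt_trans (xw i)).
Qed.

Lemma compact_normc_bounded (K : set Cn) (G : Cn -> R[i]) :
  compact K -> continuous G -> exists2 B : R, 0 < B & forall z, K z -> normc (G z) <= B.
Proof.
move=> /compact_near_coveringP cK /continuous_vecP cG.
have := cK R (+oo) (fun B z => normc (G z) <= B).
case => [z Kz|B [_ BP]]; last first.
  (* The bound is made positive because later estimates divide by it. *)
  exists (Order.max 1 (B + 1)); first by rewrite lt_max ltr01.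
  by move=> z; apply: (BP (Order.max 1 (B + 1))); rewrite lt_max ltrDl ltr01 orbT.
have [d d0 dG] := cG z 1 ltr01.
exists ([set x : Cn | forall i, normc (z 0 i - x 0 i) < d],
        [set x | normc (G z) + 1 <= x]).
  split; first by apply/nbhs_vecP; exists d.
  by apply: nbhs_pinfty_ge; rewrite num_real.
move=> [x r] /= [zx]; apply: le_trans.
rewrite -[X in normc X](subrK (G z)) addrC (le_trans (le_normcD _ _))//.
by rewrite lerD2l normc_sub ltW// dG.
Qed.

End Topology.

(** * Complex integrals *)

Section ComplexIntegral.
Context d (T : measurableType d) (R : realType).
Variables (mu : {measure set T -> \bar R}) (D : set T).
Hypothesis mD : measurable D.
Implicit Types f g : T -> R[i].

Definition cintegrable f :=
  mu.-integrable D (fun x => (complex.Re (f x))%:E) /\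
  mu.-integrable D (fun x => (complex.Im (f x))%:E).

Lemma cintegrable_le f (phi : T -> R) :
  measurable_fun D (fun x => complex.Re (f x)) ->
  measurable_fun D (fun x => complex.Im (f x)) ->
  mu.-integrable D (fun x => (phi x)%:E) ->
  (forall x, D x -> normc (f x) <= phi x) -> cintegrable f.
Proof.
move=> mRe mIm iphi fphi; split; apply: le_integrable iphi => //.
- exact/measurable_EFinP.
- move=> x Dx; rewrite /= lee_fin.
  by rewrite (le_trans (normc_Re _))// (le_trans (fphi _ Dx)) ?ler_norm.
- exact/measurable_EFinP.
- move=> x Dx; rewrite /= lee_fin.
  by rewrite (le_trans (normc_Im _))// (le_trans (fphi _ Dx)) ?ler_norm.
Qed.

Lemma cintegrableD f g : cintegrable f -> cintegrable g ->
  cintegrable (fun x => f x + g x).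
Proof.
move=> [fr fi] [gr gi]; split.
  under eq_fun do rewrite raddfD EFinD; exact: integrableD.
under eq_fun do rewrite raddfD EFinD; exact: integrableD.
Qed.

Lemma ReM (z w : R[i]) : complex.Re (z * w) =
  complex.Re z * complex.Re w - complex.Im z * complex.Im w.
Proof. by case: z w => a b [c e]. Qed.

Lemma ImM (z w : R[i]) : complex.Im (z * w) =
  complex.Re z * complex.Im w + complex.Im z * complex.Re w.
Proof. by case: z w => a b [c e]. Qed.

Lemma integrableZl_real (a : R) (F : T -> R) :
  mu.-integrable D (fun x => (F x)%:E) -> mu.-integrable D (fun x => (a * F x)%:E).
Proof. by move=> iF; apply: eq_integrable (integrableZl mD a iF) => // x _; rewrite EFinM. Qed.

Lemma cintegrableZ c f : cintegrable f -> cintegrable (fun x => c * f x).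
Proof.
move=> [fr fi]; split.
  under eq_fun do rewrite ReM EFinB !EFinM.
  by apply: integrableB => //; exact: integrableZl.
under eq_fun do rewrite ImM EFinD !EFinM.
by apply: integrableD => //; exact: integrableZl.
Qed.

Lemma cintegrableB f g : cintegrable f -> cintegrable g ->
  cintegrable (fun x => f x - g x).
Proof.
move=> fi gi; have := cintegrableD fi (cintegrableZ (-1) gi).
by under eq_fun do rewrite mulN1r.
Qed.

Lemma CintegralD f g : cintegrable f -> cintegrable g ->
  Cintegral mu D (fun x => f x + g x) = Cintegral mu D f + Cintegral mu D g.
Proof.
move=> [fr fi] [gr gi]; rewrite /Cintegral.
under eq_Rintegral do rewrite raddfD /=.
rewrite RintegralD//; congr (_ +i* _).
by under eq_Rintegral do rewrite raddfD /=; rewrite RintegralD.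
Qed.

Lemma CintegralZ c f : cintegrable f ->
  Cintegral mu D (fun x => c * f x) = c * Cintegral mu D f.
Proof.
move=> [fr fi]; apply/eqP; rewrite eq_complex ReM ImM /=.
apply/andP; split; apply/eqP.
  under eq_Rintegral do rewrite ReM.
  rewrite RintegralB//; last 2 first.
  - exact: integrableZl_real.
  - exact: integrableZl_real.
  by rewrite !RintegralZl.
under eq_Rintegral do rewrite ImM.
rewrite RintegralD//; last 2 first.
- exact: integrableZl_real.
- exact: integrableZl_real.
by rewrite !RintegralZl.
Qed.

Lemma CintegralB f g : cintegrable f -> cintegrable g ->
  Cintegral mu D (fun x => f x - g x) = Cintegral mu D f - Cintegral mu D g.
Proof.
move=> fi gi; rewrite -[- Cintegral mu D g]mulN1r -CintegralZ//.
rewrite -CintegralD//; last exact: cintegrableZ.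
by congr (Cintegral mu D _); apply/funext => x; rewrite mulN1r.
Qed.

Lemma cintegrable0 : cintegrable (fun=> 0).
Proof. by split; exact: integrable0. Qed.

Lemma Cintegral0 : Cintegral mu D (fun=> 0) = 0.
Proof. by rewrite /Cintegral !Rintegral_cst// !mul0r. Qed.

Lemma cintegrable_sum (I : Type) (s : seq I) (F : I -> T -> R[i]) :
  (forall i, cintegrable (F i)) -> cintegrable (fun x => \sum_(i <- s) F i x).
Proof.
move=> iF; elim: s => [|a s IH].
  by under eq_fun do rewrite big_nil; exact: cintegrable0.
by under eq_fun do rewrite big_cons; exact: cintegrableD.
Qed.

Lemma Cintegral_sum (I : Type) (s : seq I) (F : I -> T -> R[i]) :
  (forall i, cintegrable (F i)) ->
  Cintegral mu D (fun x => \sum_(i <- s) F i x) = \sum_(i <- s) Cintegral mu D (F i).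
Proof.
move=> iF; elim: s => [|a s IH].
  by under eq_fun do rewrite big_nil; rewrite Cintegral0 big_nil.
under eq_fun do rewrite big_cons.
by rewrite CintegralD// ?IH ?big_cons//; exact: cintegrable_sum.
Qed.

Lemma eq_Cintegral f g : {in D, f =1 g} -> Cintegral mu D f = Cintegral mu D g.
Proof.
by move=> fg; congr (_ +i* _); apply: eq_Rintegral => x /fg ->.
Qed.

Lemma Cintegral_conj f : cintegrable f ->
  Cintegral mu D (fun x => (f x)^*) = (Cintegral mu D f)^*.
Proof.
move=> [fr fi]; rewrite /Cintegral /=.
have ReJ z : complex.Re z^* = complex.Re z :> R by case: z.
have ImJ z : complex.Im z^* = - 1 * complex.Im z :> R by case: z => a b; rewrite mulN1r.
under eq_Rintegral do rewrite ReJ.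
congr (_ +i* _).
under eq_Rintegral do rewrite ImJ.
by rewrite RintegralZl// mulN1r.
Qed.

(** A unimodular factor [u] turns the integral into its modulus, which is then the integral of the
    real part of [u * f]; that real part is at most [phi]. *)
Lemma normc_Cintegral_le f (phi : T -> R) : cintegrable f ->
  mu.-integrable D (fun x => (phi x)%:E) ->
  (forall x, D x -> normc (f x) <= phi x) ->
  normc (Cintegral mu D f) <= \int[mu]_(x in D) phi x.
Proof.
move=> fi iphi fphi; set I := Cintegral mu D f.
have [I0|I0] := eqVneq I 0.
  rewrite I0 Normc.normc0 Rintegral_ge0// => x Dx.
  exact: le_trans (normc_ge0 _) (fphi _ Dx).
pose u := I^* / (normc I)%:C.
have nI : (normc I)%:C != 0 by rewrite (inj_eq (@complexI R)) normc_eq0.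
have uI : u * I = (normc I)%:C.
  by rewrite mulrAC [_^* * _]mulrC mul_conj_normc rmorphXn expr2 mulfK.
have nu : normc u = 1.
  rewrite Normc.normcM normc_conj Normc.normcV normc_real ger0_norm ?normc_ge0//.
  by rewrite divff// normc_eq0.
have -> : normc I = complex.Re (Cintegral mu D (fun x => u * f x)).
  by rewrite CintegralZ// -/I uI.
apply: le_Rintegral => //; first by have [] := cintegrableZ u fi.
move=> x Dx; rewrite (le_trans (ler_norm _))// (le_trans (normc_Re _))//.
by rewrite Normc.normcM nu mul1r fphi.
Qed.

Lemma Cintegral_real (f : T -> R) :
  Cintegral mu D (fun x => (f x)%:C) = (\int[mu]_(x in D) f x)%:C.
Proof. by rewrite /Cintegral; congr (_ +i* _); rewrite /Rintegral integral0. Qed.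

End ComplexIntegral.

(** * Integrals of continuous functions, and Laplace's method *)

Section ContinuousIntegral.
Context (R : realType) (n : nat).
Local Notation Cn := 'rV[R[i]]_n.

Lemma open_measurable_vec (A : set Cn) : open A -> measurable A.
Proof. by move=> oA; apply: sub_sigma_algebra. Qed.

Lemma continuous_measurable_vec (G : Cn -> R) (D : set Cn) :
  continuous G -> measurable D -> measurable_fun D G.
Proof.
move=> /continuousP cG mD; apply: measurable_funTS.
apply: (measurability _ (RGenOpens.measurableE R)).
move=> _ [_ [a [b ->] <-]]; rewrite setTI; apply: open_measurable_vec.
exact/cG/interval_open.
Qed.

Lemma measurable_lt_vec (G : Cn -> R) s : continuous G ->
  measurable [set z | s < G z].
Proof.
move=> cG; rewrite (_ : [set z | _] = setT `&` G @^-1` [set` `]s, +oo[%R]).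
  exact: (continuous_measurable_vec cG measurableT).
by rewrite setTI; apply/seteqP; split=> z /=; rewrite in_itv /= andbT.
Qed.

Lemma measurable_gt_vec (G : Cn -> R) s : continuous G ->
  measurable [set z | G z < s].
Proof.
move=> cG; rewrite (_ : [set z | _] = setT `&` G @^-1` [set` `]-oo, s[%R]).
  exact: (continuous_measurable_vec cG measurableT).
by rewrite setTI; apply/seteqP; split=> z /=; rewrite in_itv /=.
Qed.

Lemma measurable_le_vec (G : Cn -> R) s : continuous G ->
  measurable [set z | G z <= s].
Proof.
move=> cG; rewrite (_ : [set z | G z <= s] = ~` [set z | s < G z]).
  by apply: measurableC; exact: measurable_lt_vec.
by apply/seteqP; split=> z /=; rewrite leNgt => /negP.
Qed.

Lemma measurable_forall_vec (A : 'I_n -> set Cn) :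
  (forall i, measurable (A i)) -> measurable [set z | forall i, A i z].
Proof.
move=> mA; rewrite (_ : [set z | _] = \bigcap_(i in [set: 'I_n]) A i).
  by apply: fin_bigcap_measurable => // i _; exact: mA.
by apply/seteqP; split=> z zA i; [move=> _; exact: zA|exact: zA].
Qed.

Lemma measurable_box (z0 : Cn) (d : R) :
  measurable [set z : Cn | forall i, normc (z0 0 i - z 0 i) < d].
Proof.
apply: (@measurable_forall_vec (fun i => [set z | normc (z0 0 i - z 0 i) < d])).
move=> i; apply: measurable_gt_vec.
have cc := subc_continuous (@cstc_continuous R n (z0 0 i)) (@coord_vec_continuous R n i).
exact: (normc_continuous cc).
Qed.

(** The common setting of [theta] on the polydisc, [sigma] on the torus and the law of the radii: a
    continuous function is bounded on [cpolydisc 1], hence integrable. *)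
Definition carried_by (P : probability Cn R) (D : set Cn) :=
  [/\ measurable D, D `<=` cpolydisc 1 & P D = 1%E].

Variables (P : probability Cn R) (D : set Cn).
Hypothesis PD : carried_by P D.

Lemma carried_measurable : measurable D. Proof. by case: PD. Qed.
Let mD := carried_measurable.

Lemma integrable_cst1 (r : R) : P.-integrable D (fun=> r%:E).
Proof.
by apply: finite_measure_integrable_cst.
Qed.

Lemma integrable_bounded (G : Cn -> R) B : measurable_fun D G ->
  (forall z, D z -> `|G z| <= B) -> P.-integrable D (fun z => (G z)%:E).
Proof.
move=> mG GB; apply: le_integrable (integrable_cst1 B) => //.
  exact/measurable_EFinP.
by move=> z Dz; rewrite /= lee_fin (le_trans (GB _ Dz))// ler_norm.
Qed.

Lemma continuous_cintegrable (G : Cn -> R[i]) :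
  continuous G -> cintegrable P D G.
Proof.
move=> cG; have [B B0 GB] := compact_normc_bounded (@compact_cpolydisc R n 1) cG.
have [_ Dc _] := PD.
apply: (cintegrable_le mD _ _ (integrable_cst1 B)).
- exact: continuous_measurable_vec (Re_continuous cG) mD.
- exact: continuous_measurable_vec (Im_continuous cG) mD.
- by move=> z /Dc /GB.
Qed.

Lemma continuous_integrable (G : Cn -> R) :
  continuous G -> P.-integrable D (fun z => (G z)%:E).
Proof. by move=> /real_complex_continuous /continuous_cintegrable []. Qed.

Lemma Rintegral_cst1 (r : R) : \int[P]_(x in D) r = r.
Proof.
rewrite Rintegral_cst// -[RHS]mulr1; congr (_ * _).
by have [_ _ PD1] := PD; transitivity (fine (1%E : \bar R)) => //; congr fine.
Qed.

Lemma Cintegral_cst (c : R[i]) : Cintegral P D (fun=> c) = c.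
Proof. by rewrite /Cintegral !Rintegral_cst1; case: c. Qed.

Lemma exp_continuous_real (q : Cn -> R) k :
  continuous q -> continuous (fun z => q z ^+ k).
Proof.
move=> cq; have := Re_continuous (expc_continuous (k := k) (real_complex_continuous cq)).
by under eq_fun do rewrite -rmorphXn.
Qed.

(* Laplace's method: [q ^+ k] concentrates where [q] is close to 1. *)
Lemma laplace_bound (q : Cn -> R) (G : Cn -> R[i]) (e B s : R) k :
  continuous q -> continuous G -> (forall z, D z -> 0 <= q z <= 1) ->
  0 <= e -> 0 <= B -> 0 <= s ->
  (forall z, D z -> normc (G z) <= B) ->
  (forall z, D z -> s < q z -> normc (G z) <= e) ->
  normc (Cintegral P D (fun z => (q z ^+ k)%:C * G z)) <=
  e * \int[P]_(z in D) q z ^+ k + B * s ^+ k.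
Proof.
move=> cq cG q01 e0 B0 s0 GB Ge.
have cqk := exp_continuous_real (k := k) cq.
have iqk := continuous_integrable cqk.
have ieq : P.-integrable D (fun z => (e * q z ^+ k)%:E) by exact: integrableZl_real.
have iB := integrable_cst1 (B * s ^+ k).
have -> : e * \int[P]_(z in D) q z ^+ k + B * s ^+ k =
    \int[P]_(z in D) (e * q z ^+ k + B * s ^+ k).
  by rewrite RintegralD// Rintegral_cst1 RintegralZl.
apply: normc_Cintegral_le => //.
- apply: continuous_cintegrable; apply: (mulc_continuous _ cG).
  exact: real_complex_continuous.
- by under eq_fun do rewrite EFinD; exact: integrableD.
- move=> z Dz; have /andP[q0 q1] := q01 z Dz.
  rewrite Normc.normcM normc_real ger0_norm ?exprn_ge0//.
  have [sq|qs] := ltP s (q z).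
    rewrite ler_wpDr ?mulr_ge0 ?exprn_ge0// mulrC ler_wpM2r ?exprn_ge0//.
    exact: Ge.
  rewrite ler_wpDl ?mulr_ge0 ?exprn_ge0// mulrC ler_pM ?normc_ge0 ?exprn_ge0//.
    exact: GB.
  by rewrite lerXn2r// nnegrE.
Qed.

(** For [t] strictly between [s] and 1, the integral of [q ^+ k] is at least [t ^+ k] times the
    positive mass of the set where [q] exceeds [t], and [(s / t) ^+ k] tends to 0. *)
Lemma laplace_small (q : Cn -> R) (s eta : R) :
  continuous q -> (forall z, D z -> 0 <= q z <= 1) -> 0 <= s < 1 -> 0 < eta ->
  (forall t, t < 1 -> (0 < P (D `&` [set z | (t < q z)%R]))%E) ->
  exists N, forall k, (N <= k)%N -> s ^+ k <= eta * \int[P]_(z in D) q z ^+ k.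
Proof.
move=> cq q01 /andP[s0 s1] eta0 Pq.
pose t := (s + 1) / 2.
have st : s < t by rewrite /t; lra.
have t1 : t < 1 by rewrite /t; lra.
have t0 : 0 < t by rewrite /t; lra.
clearbody t.
pose A := D `&` [set z | t < q z].
have mA : measurable A by apply: measurableI => //; exact: measurable_lt_vec.
have PA : 0 < fine (P A) by rewrite fine_gt0// Pq// (le_lt_trans (probability_le1 _ _)) ?ltry.
have low k : t ^+ k * fine (P A) <= \int[P]_(z in D) q z ^+ k.
  have iA : P.-integrable D (fun z => (\1_A z : R)%:E).
    apply: (@integrable_bounded _ 1); first exact: measurable_indic.
    by move=> z _; rewrite indicE; case: (_ \in _); rewrite ?normr1 ?normr0.
  have -> : fine (P A) = \int[P]_(z in D) \1_A z.
    rewrite /Rintegral integral_indic//; congr (fine (P _)).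
    by rewrite setIidl// => z [].
  rewrite -RintegralZl//; apply: le_Rintegral => //.
  - exact: integrableZl_real.
  - exact: continuous_integrable (exp_continuous_real (k := k) cq).
  - move=> z Dz; rewrite indicE; have /andP[q0 q1] := q01 z Dz.
    case: (boolP (z \in A)) => [|_]; last by rewrite mulr0 exprn_ge0.
    by rewrite inE => -[_ /= tq]; rewrite mulr1 lerXn2r// ?nnegrE ltW.
have st1 : `|s / t| < 1.
  by rewrite ger0_norm ?divr_ge0 ?(ltW t0)// ltr_pdivrMr// mul1r.
have /cvgr0Pnorm_lt := @cvg_expr R (s / t) st1.
move=> /(_ (eta * fine (P A))) [|N _ NP]; first exact: mulr_gt0.
exists N => k Nk; apply: le_trans (ler_wpM2l (ltW eta0) (low k)).
have := NP k Nk; rewrite ger0_norm ?exprn_ge0 ?divr_ge0 ?(ltW t0)//.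
rewrite expr_div_n ltr_pdivrMr ?exprn_gt0// => /ltW/le_trans; apply.
by rewrite -mulrA [fine _ * _]mulrC.
Qed.

(** As [0 <= q <= 1], a zero integral would force the integrals of all higher powers to vanish,
    against [laplace_small] with [s = 1/2]. *)
Lemma integral_pow_gt0 (q : Cn -> R) k :
  continuous q -> (forall z, D z -> 0 <= q z <= 1) ->
  (forall t, t < 1 -> (0 < P (D `&` [set z | (t < q z)%R]))%E) ->
  0 < \int[P]_(z in D) q z ^+ k.
Proof.
move=> cq q01 Pq.
rewrite lt_neqAle Rintegral_ge0 ?andbT; last first.
  by move=> z /q01 /andP[q0 _]; rewrite exprn_ge0.
apply/negP => /eqP I0.
have [N /(_ (maxn N k) (leq_maxl _ _))] :=
  @laplace_small q (1 / 2) 1 cq q01 ltac:(lra) ltr01 Pq.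
rewrite leNgt => /negP; apply.
apply: (@le_lt_trans _ _ (\int[P]_(z in D) q z ^+ k)); last first.
  by rewrite -I0 exprn_gt0 ?divr_gt0.
rewrite mul1r; apply: le_Rintegral => //.
- exact: continuous_integrable (exp_continuous_real (k := _) cq).
- exact: continuous_integrable (exp_continuous_real (k := _) cq).
- by move=> z /q01 /andP[q0 q1]; apply: ler_wiXn2l => //; rewrite leq_maxr.
Qed.

Lemma Rintegral_eq0_ae (G : Cn -> R) : continuous G ->
  (forall z, D z -> 0 <= G z) -> \int[P]_(z in D) G z = 0 ->
  {ae P, forall z, D z -> G z = 0}.
Proof.
move=> cG G0 IG.
have iG := continuous_integrable cG.
have : (\int[P]_(z in D) `|(G z)%:E|)%E = 0%E.
  under eq_integral => z /set_mem Dz do rewrite gee0_abs ?lee_fin ?G0//.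
  rewrite -(fineK (integrable_fin_num mD iG)).
  by rewrite /Rintegral in IG; rewrite IG.
move=> /(ae_eq_integral_abs P mD (measurable_int _ iG)).
apply: filterS => z /= Gz Dz.
by have := Gz Dz => -[].
Qed.

(** A nonzero value at [z0] would persist on a box of positive mass. The point [z0] is in the
    support of [P] but may lie outside [D], as the corner does, which radii only approach. *)
Lemma ae_eq0_at (G : Cn -> R[i]) (z0 : Cn) : continuous G ->
  (forall d, 0 < d ->
    (0 < P (D `&` [set z | forall i, (normc (z0 0 i - z 0 i) < d)%R]))%E) ->
  {ae P, forall z, D z -> G z = 0} -> G z0 = 0.
Proof.
move=> /continuous_vecP cG Pz0 aeG; apply: contrapT => /eqP Gz0.
have nG : 0 < normc (G z0) by rewrite normc_gt0.
have [d d0 dG] := cG z0 _ nG.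
have := Pz0 d d0; set A := (X in P X) => PA.
have [N [mN N0 sN]] := aeG.
suff PAN : (P A <= P N)%E by have := lt_le_trans PA PAN; rewrite N0 ltxx.
apply: le_measure; rewrite ?inE//; first by apply: measurableI => //; exact: measurable_box.
move=> z [Dz /= zd]; apply: sN => /(_ Dz) Gz.
by have := dG z zd; rewrite Gz subr0 ltxx.
Qed.

End ContinuousIntegral.

(** * Haar measure and polar coordinates *)

Section Rotations.
Context (R : realType) (n : nat).
Local Notation Cn := 'rV[R[i]]_n.

Lemma polydiscP (z : Cn) : polydisc z <-> forall j, normc (z 0 j) < 1.
Proof. by split=> zD j; have := zD j; rewrite normcE ltcR. Qed.

Lemma torusP (z : Cn) : torus z <-> forall j, normc (z 0 j) = 1.
Proof.
split=> zD j; first by apply: (@complexI R); rewrite -normcE zD.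
by rewrite normcE zD.
Qed.

Lemma polydisc_sub : (polydisc : set Cn) `<=` cpolydisc 1.
Proof. by move=> z /polydiscP zD j; exact/ltW. Qed.

Lemma torus_sub : (torus : set Cn) `<=` cpolydisc 1.
Proof. by move=> z /torusP zD j; rewrite zD. Qed.

Lemma normc_coord_continuous (i : 'I_n) : continuous (fun z : Cn => normc (z 0 i)).
Proof. exact: (normc_continuous (@coord_vec_continuous R n i)). Qed.

Lemma measurable_polydisc : measurable (polydisc : set Cn).
Proof.
rewrite (_ : polydisc = [set z | forall i, [set z : Cn | normc (z 0 i) < 1] z]).
  apply: measurable_forall_vec => i; apply: measurable_gt_vec.
  exact: normc_coord_continuous.
by apply/seteqP; split=> z /polydiscP.
Qed.

Lemma measurable_torus : measurable (torus : set Cn).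
Proof.
rewrite (_ : torus = [set z | forall i,
    ([set z : Cn | normc (z 0 i) <= 1] `\` [set z : Cn | normc (z 0 i) < 1]) z]).
  apply: measurable_forall_vec => i; apply: measurableD.
    by apply: measurable_le_vec; exact: normc_coord_continuous.
  by apply: measurable_gt_vec; exact: normc_coord_continuous.
apply/seteqP; split=> z.
  by move=> /torusP zT i; rewrite /= zT ltxx lexx.
move=> zT; apply/torusP => i; have [/= z1 /negP] := zT i; rewrite -leNgt => z2.
by apply/eqP; rewrite eq_le z1.
Qed.

Lemma rotate_cpolydisc rho (xi z : Cn) :
  torus xi -> cpolydisc rho (rotate xi z) <-> cpolydisc rho z.
Proof.
by move=> /torusP xiT; split=> zD i; have := zD i; rewrite mxE Normc.normcM xiT mul1r.
Qed.

Lemma rotate_torus (xi z : Cn) : torus xi -> torus (rotate xi z) <-> torus z.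
Proof.
move=> /torusP xiT; split=> /torusP zD; apply/torusP => i; have := zD i;
  by rewrite mxE Normc.normcM xiT mul1r.
Qed.

Lemma rotateA (xi zeta z : Cn) : rotate xi (rotate zeta z) = rotate (rotate xi zeta) z.
Proof. by apply/rowP => i; rewrite !mxE mulrA. Qed.

Lemma rotateC (xi z : Cn) : rotate xi z = rotate z xi.
Proof. by apply/rowP => i; rewrite !mxE mulrC. Qed.

Lemma rotate_continuous (xi : Cn) : continuous (rotate xi).
Proof.
apply: vec_continuous => i.
have := mulc_continuous (@cstc_continuous R n (xi 0 i)) (@coord_vec_continuous R n i).
by apply: eq_continuous_vec => z; rewrite mxE.
Qed.

Lemma continuous_measurable_map (p : Cn -> Cn) :
  continuous p -> measurable_fun [set: Cn] p.
Proof.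
move=> /continuousP cp; apply: (@measurability _ _ _ _ _ _ (@open Cn)) => //.
move=> _ [A oA <-]; rewrite setTI; apply: open_measurable_vec; exact: cp.
Qed.

End Rotations.

HB.instance Definition _ (R : realType) (n : nat) (xi : 'rV[R[i]]_n) :=
  isMeasurableFun.Build _ _ _ _ (rotate xi)
    (continuous_measurable_map (@rotate_continuous R n xi)).

Lemma Cintegral_distribution d d' (T1 : measurableType d) (T2 : measurableType d')
    (R : realType) (P : probability T1 R) (X : {mfun T1 >-> T2}) (D : set T2)
    (f : T2 -> R[i]) : measurable D ->
  measurable_fun setT (fun x => complex.Re (f x)) ->
  measurable_fun setT (fun x => complex.Im (f x)) ->
  cintegrable P (X @^-1` D) (f \o X) ->
  Cintegral (distribution P X) D f = Cintegral P (X @^-1` D) (f \o X).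
Proof.
move=> mD mRe mIm [iRe iIm]; congr (_ +i* _); congr fine.
  by apply: integral_pushforward => //; exact/measurable_EFinP.
by apply: integral_pushforward => //; exact/measurable_EFinP.
Qed.

Section TorusAverage.
Context (R : realType) (n : nat).
Local Notation Cn := 'rV[R[i]]_n.
Variable sigma : probability Cn R.
Hypothesis sigma_haar : is_torus_haar sigma.

Lemma torus_carried : carried_by sigma torus.
Proof.
by split; [exact: measurable_torus|exact: torus_sub|case: sigma_haar].
Qed.

Lemma Cintegral_torus_rotate (xi : Cn) (G : Cn -> R[i]) :
  torus xi -> continuous G ->
  Cintegral sigma torus (fun zeta => G (rotate xi zeta)) = Cintegral sigma torus G.
Proof.
move=> xiT cG.
have rT : rotate xi @^-1` torus = torus.
  by apply/seteqP; split=> z /=; rewrite rotate_torus.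
have cGr := comp_continuous cG (@rotate_continuous R n xi).
have := @Cintegral_distribution _ _ Cn Cn R sigma (rotate xi) torus G
  (@measurable_torus R n).
rewrite rT => <-.
- congr (_ +i* _); congr fine; apply: eq_measure_integral => A mA _.
    by have [_] := sigma_haar; apply.
  by have [_] := sigma_haar; apply.
- exact: continuous_measurable_vec (Re_continuous cG) measurableT.
- exact: continuous_measurable_vec (Im_continuous cG) measurableT.
- exact: (continuous_cintegrable torus_carried cGr).
Qed.

Definition torus_average (G : Cn -> R[i]) (z : Cn) : R[i] :=
  Cintegral sigma torus (fun zeta => G (rotate zeta z)).

Lemma rotate_continuousl (z : Cn) : continuous (fun zeta => rotate zeta z).
Proof.
by apply: eq_continuous_vec (@rotate_continuous R n z) => zeta; rewrite rotateC.
Qed.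

Lemma torus_average_rotate G (xi z : Cn) : torus xi -> continuous G ->
  torus_average G (rotate xi z) = torus_average G z.
Proof.
move=> xiT cG; rewrite /torus_average.
rewrite -(Cintegral_torus_rotate xiT (comp_continuous cG (@rotate_continuousl z))).
by apply: eq_Cintegral => zeta _; rewrite rotateA [rotate zeta xi]rotateC.
Qed.

Lemma normc_Cintegral_le_cst (P : probability Cn R) (D : set Cn) (G : Cn -> R[i]) B :
  carried_by P D -> cintegrable P D G -> (forall z, D z -> normc (G z) <= B) ->
  normc (Cintegral P D G) <= B.
Proof.
move=> PD iG GB.
rewrite -[leRHS](Rintegral_cst1 PD); have [mD _ _] := PD.
by apply: normc_Cintegral_le => //; exact: integrable_cst1.
Qed.

(** A convolution along the torus action: the weight 1 gives the torus average, the conjugate of a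
    character gives a Fourier component. *)
Definition weighted_average (w G : Cn -> R[i]) (z : Cn) : R[i] :=
  Cintegral sigma torus (fun zeta => w zeta * G (rotate zeta z)).

Lemma cintegrable_weighted (w G : Cn -> R[i]) z : continuous w -> continuous G ->
  cintegrable sigma torus (fun zeta => w zeta * G (rotate zeta z)).
Proof.
move=> cw cG; apply: (continuous_cintegrable torus_carried).
exact: (mulc_continuous cw (comp_continuous cG (@rotate_continuousl z))).
Qed.

Lemma weighted_average_continuous w G :
  continuous w -> continuous G -> continuous (weighted_average w G).
Proof.
move=> cw cG; apply/continuous_vecP => z e e0.
(* Rotations preserve the moduli of the coordinates, so all rotates of [z] stay in the compact
   polydisc of radius [rho], where [G] is uniformly continuous. *)
pose rho := \big[Order.max/0]_i normc (z 0 i).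
have zr : cpolydisc rho z by move=> i; exact: le_bigmax.
have [B B0 wB] := compact_normc_bounded (@compact_cpolydisc R n 1) cw.
have e1 : 0 < e / 2 / B by rewrite !divr_gt0.
have [d d0 dG] := compact_unif_continuous (@compact_cpolydisc R n rho) cG e1.
exists d => // u zu; rewrite /weighted_average.
have mT := @measurable_torus R n.
have c1 := @cintegrable_weighted w G z cw cG.
have c2 := @cintegrable_weighted w G u cw cG.
rewrite -CintegralB//; apply: (@le_lt_trans _ _ (e / 2)); last first.
  by rewrite ltr_pdivrMr// ltr_pMr// ltr1n.
apply: (normc_Cintegral_le_cst torus_carried); first exact: cintegrableB.
move=> zeta zT; rewrite -mulrBr Normc.normcM.
have -> : e / 2 = B * (e / 2 / B) by rewrite [RHS]mulrC divfK// gt_eqF.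
apply: ler_pM; rewrite ?normc_ge0//; first exact/wB/torus_sub.
apply/ltW/dG; first exact/rotate_cpolydisc.
move=> i; rewrite !mxE -mulrBr Normc.normcM.
by move/torusP : zT => ->; rewrite mul1r.
Qed.

Lemma torus_averageE G : torus_average G = weighted_average (fun=> 1) G.
Proof. by apply/funext => z; apply: eq_Cintegral => zeta _; rewrite mul1r. Qed.

Lemma torus_average_continuous G : continuous G -> continuous (torus_average G).
Proof.
move=> cG; rewrite torus_averageE.
exact: (weighted_average_continuous (@cstc_continuous R n 1) cG).
Qed.

End TorusAverage.


Section RadialEmbedding.
Context (R : realType) (n : nat).
Local Notation Cn := 'rV[R[i]]_n.

Definition radial_vec (r : n.-tuple R) : Cn := \row_j (tnth r j)%:C.

Lemma dilateE (r : n.-tuple R) (z : Cn) : dilate r z = rotate z (radial_vec r).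
Proof. by apply/rowP => i; rewrite !mxE mulrC. Qed.

(* An open set is a countable union of boxes with rational vertices. *)
Lemma measurable_radial_vec : measurable_fun [set: n.-tuple R] radial_vec.
Proof.
apply: (@measurability _ _ _ _ _ _ (@open Cn)) => //.
move=> _ [A oA <-]; rewrite setTI.
pose box (b : n.-tuple (rat * rat)) := [set r : n.-tuple R |
  forall i, ratr (tnth b i).1 < tnth r i < ratr (tnth b i).2].
have mbox b : measurable (box b).
  rewrite (_ : box b = \bigcap_(i in [set: 'I_n]) (@tnth n R ^~ i @^-1`
      [set` `]ratr (tnth b i).1, ratr (tnth b i).2[%R])).
    apply: fin_bigcap_measurable => // i _; rewrite -[X in measurable X]setTI.
    exact: measurable_tnth.
  apply/seteqP; split=> r /= rb i; first by move=> _ /=; rewrite in_itv /=.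
  by have := rb i I; rewrite /= in_itv.
pose F k : set (n.-tuple R) := if (unpickle k : option (n.-tuple (rat * rat))) is Some b
  then (if `[< box b `<=` radial_vec @^-1` A >] then box b else set0) else set0.
rewrite (_ : radial_vec @^-1` A = \bigcup_k F k).
  apply: bigcupT_measurable => k; rewrite /F; case: unpickle => // b.
  by case: ifP.
apply/seteqP; split=> r; last first.
  by move=> [k _]; rewrite /F; case: unpickle => // b; case: asboolP => // h /h.
move=> Ar; have /nbhs_vecP [d d0 dA] : nbhs (radial_vec r) A by exact: open_nbhs_nbhs.
have /choice [a aP] : forall i, exists q : rat, ratr q \in `]tnth r i - d, tnth r i[.
  by move=> i; apply: rat_in_itvoo; rewrite ltrBlDr ltrDl.
have /choice [b bP] : forall i, exists q : rat, ratr q \in `]tnth r i, tnth r i + d[.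
  by move=> i; apply: rat_in_itvoo; rewrite ltrDl.
pose t := [tuple (a i, b i) | i < n].
exists (pickle t) => //; rewrite /F pickleK.
have rt : box t r.
  move=> i; rewrite tnth_mktuple /=; have := aP i; have := bP i.
  by rewrite !in_itv /= => /andP[-> _] /andP[_ ->].
rewrite asboolT// => s st; apply: dA => i.
rewrite !mxE -rmorphB normc_real.
have := st i; have := aP i; have := bP i; rewrite tnth_mktuple /= !in_itv /=.
move=> /andP[b1 b2] /andP[a1 a2] /andP[s1 s2].
by rewrite ltr_norml; apply/andP; split; lra.
Qed.

HB.instance Definition _ :=
  isMeasurableFun.Build _ _ _ _ radial_vec measurable_radial_vec.

(** The image of [radii] in C^n. With the radii seen as vectors, their law becomes a probability to
    which the lemmas on continuous functions apply. *)
Definition cradii : set Cn :=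
  [set z | forall j, complex.Im (z 0 j) = 0 /\ 0 <= complex.Re (z 0 j) < 1].

Lemma radial_vec_cradii : radial_vec @^-1` cradii = radii.
Proof.
apply/seteqP; split=> r rD j; first by have [_] := rD j; rewrite mxE.
by rewrite mxE; split=> //; exact: rD.
Qed.

Lemma cradii_polydisc : cradii `<=` polydisc.
Proof.
move=> z zD; apply/polydiscP => j; have [+ /andP[]] := zD j.
case: (z 0 j) => a b /= -> a0 a1; rewrite expr0n addr0 sqrtr_sqr ger0_norm//.
Qed.

Lemma measurable_cradii : measurable cradii.
Proof.
apply: (@measurable_forall_vec R n (fun j => [set z : Cn |
  complex.Im (z 0 j) = 0 /\ 0 <= complex.Re (z 0 j) < 1])) => j.
have cI := Im_continuous (@coord_vec_continuous R n j).
have cR := Re_continuous (@coord_vec_continuous R n j).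
rewrite (_ : mkset _ = ([set z : Cn | complex.Im (z 0 j) <= 0] `\`
    [set z : Cn | complex.Im (z 0 j) < 0]) `&`
    ([set z : Cn | complex.Re (z 0 j) < 1] `\` [set z : Cn | complex.Re (z 0 j) < 0])).
  apply: measurableI; apply: measurableD.
  - exact: measurable_le_vec.
  - exact: measurable_gt_vec.
  - exact: measurable_gt_vec.
  - exact: measurable_gt_vec.
apply/seteqP; split=> z /=.
  by move=> [-> /andP[z0 z1]]; rewrite ltxx lexx z1; do !split => //; apply/negP; rewrite -leNgt.
move=> [[zi /negP zi']] [z1 /negP z0]; rewrite -leNgt in zi'; rewrite -leNgt in z0.
by split; [apply/eqP; rewrite eq_le zi|apply/andP].
Qed.

End RadialEmbedding.

(** * Rotation-invariant truncation away from the boundary *)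

Section Cutoff.
Context (R : realType) (n : nat).
Local Notation Cn := 'rV[R[i]]_n.

(** In terms of [x = k (1 - t)], a ramp equal to 0 for [x <= 1], to [x - 1] for [1 <= x <= 2] and to
    1 for [x >= 2]. It is there because [is_polar_measure] tests [theta] on compactly supported
    functions only. *)
Definition cutoff1 (k : nat) (t : R) : R :=
  Order.max 0 (1 - Order.max 0 (2 - k%:R * (1 - t))).

Definition cutoff (k : nat) (z : Cn) : R := \prod_j cutoff1 k (normc (z 0 j)).

Lemma cutoff1_01 k t : 0 <= cutoff1 k t <= 1.
Proof. by rewrite /cutoff1 le_max lexx ge_max ler01 gerBl le_max lexx. Qed.

Lemma cutoff_01 k z : 0 <= cutoff k z <= 1.
Proof.
apply/andP; split; first by apply: prodr_ge0 => j _; have /andP[] := cutoff1_01 k (normc (z 0 j)).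
by apply: prodr_ile1 => j _; exact: cutoff1_01.
Qed.

Lemma cutoff_rotate k (xi z : Cn) : torus xi -> cutoff k (rotate xi z) = cutoff k z.
Proof.
by move=> /torusP xiT; apply: eq_bigr => j _; rewrite mxE Normc.normcM xiT mul1r.
Qed.

Lemma cutoff_continuous k : continuous (fun z => (cutoff k z)%:C).
Proof.
have -> : (fun z => (cutoff k z)%:C) = (fun z => \prod_j (cutoff1 k (normc (z 0 j)))%:C).
  by apply/funext => z; rewrite rmorph_prod.
apply: prodc_continuous => j; apply: real_complex_continuous.
have cn := @normc_coord_continuous R n j.
have c1 := max0_continuous (affine_continuous (a := k%:R) (b := 2 - k%:R) cn).
have c2 := max0_continuous (affine_continuous (a := -1) (b := 1) c1).
apply: eq_continuous_vec c2 => z; rewrite /cutoff1 mulN1r [- _ + 1]addrC.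
by congr (Order.max 0 (1 - Order.max 0 _)); ring.
Qed.

(** The ramp vanishes as soon as [k (1 - t) <= 1]. With [k.+1] in place of [k] the radius stays
    below 1 even for [k = 0]. *)
Lemma cutoff_support k (z : Cn) :
  cutoff k z != 0 -> cpolydisc (1 - k.+1%:R^-1) z.
Proof.
move=> /prodf_neq0 cz j; rewrite leNgt; apply: contra (cz j isT) => tz.
rewrite /cutoff1 max_l// subr_le0 le_max; apply/orP; right.
have k0 : 0 < k.+1%:R :> R by rewrite ltr0n.
have : k.+1%:R * (1 - normc (z 0 j)) < 1.
  by rewrite -ltr_pdivlMl// mulr1 ltrBlDr -ltrBlDl.
have k1 : 0 <= k%:R :> R by rewrite ler0n.
rewrite -natr1; set t := normc _; have [t1|t1] := leP t 1; nra.
Qed.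

Lemma cutoff_eq1 (z : Cn) : polydisc z -> exists N, forall k, (N <= k)%N -> cutoff k z = 1.
Proof.
move=> /polydiscP zD.
have /choice [N NP] : forall j, exists N : nat, 2 / (1 - normc (z 0 j)) < N%:R.
  move=> j; exists (Num.truncn (2 / (1 - normc (z 0 j)))).+1.
  by rewrite truncnS_gt// divr_ge0// subr_ge0 ltW.
exists (\max_j N j) => k Nk; apply: big1 => j _.
have : 2 < k%:R * (1 - normc (z 0 j)).
  rewrite -ltr_pdivrMr ?subr_gt0//; apply: lt_le_trans (NP j) _.
  by rewrite ler_nat (leq_trans _ Nk)// leq_bigmax.
by move=> h; rewrite /cutoff1 [Order.max 0 (2 - _)]max_l ?subr0 ?max_r ?ler01// subr_le0 ltW.
Qed.

Lemma cutoff_integral (P : probability Cn R) (D : set Cn) (e : R) :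
  carried_by P D -> D `<=` polydisc -> 0 < e ->
  exists N, forall k, (N <= k)%N -> \int[P]_(z in D) (1 - cutoff k z) < e.
Proof.
move=> PD Dp e0; have [mD _ _] := PD.
have mc k : measurable_fun D (fun z => 1 - cutoff k z).
  apply: measurable_funB => //.
  exact: continuous_measurable_vec (Re_continuous (@cutoff_continuous k)) mD.
have [||||| _ _] := @dominated_convergence _ _ R P D mD
    (fun k z => (1 - cutoff k z)%:E) (cst 0%E) (cst 1%E).
- by move=> k; exact/measurable_EFinP.
- exact: measurable_cst.
- apply/aeW => z /Dp /cutoff_eq1 [N NP].
  apply: cvg_near_cst; exists N => // k /= /NP ->.
  by rewrite subrr.
- exact: integrable_cst1.
- apply/aeW => z k _; have /andP[c0 c1] := cutoff_01 k z.
  by rewrite /= lee_fin ger0_norm ?subr_ge0// lerBlDr lerDl.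
rewrite integral_cst// mul0e => /fine_cvgP [_].
move=> /cvgr0Pnorm_lt /(_ e e0) [N _ NP]; exists N => k Nk.
exact: le_lt_trans (ler_norm _) (NP k Nk).
Qed.

End Cutoff.

Section Polar.
Context (R : realType) (n : nat).
Local Notation Cn := 'rV[R[i]]_n.
Variables (mu : probability (n.-tuple R) R) (sigma theta : probability Cn R).
Hypotheses (sigma_haar : is_torus_haar sigma)
  (theta_polar : is_polar_measure mu sigma theta) (mu_radii : mu radii = 1%E).

Definition radial_measure : probability Cn R := distribution mu (@radial_vec R n).

Lemma radial_measureE (A : set Cn) : radial_measure A = mu (@radial_vec R n @^-1` A).
Proof. by []. Qed.

Lemma radial_carried : carried_by radial_measure (@cradii R n).
Proof.
split; [exact: measurable_cradii| |].
  by move=> z /cradii_polydisc /polydisc_sub.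
by rewrite radial_measureE radial_vec_cradii.
Qed.

Lemma polydisc_carried : carried_by theta polydisc.
Proof.
by split; [exact: measurable_polydisc|exact: polydisc_sub|case: theta_polar].
Qed.

Lemma Cintegral_radial (H : Cn -> R[i]) : continuous H ->
  Cintegral radial_measure (@cradii R n) H =
  Cintegral mu radii (fun r => H (radial_vec r)).
Proof.
move=> cH; have mRe := continuous_measurable_vec (Re_continuous cH) measurableT.
have mIm := continuous_measurable_vec (Im_continuous cH) measurableT.
have [B B0 HB] := compact_normc_bounded (@compact_cpolydisc R n 1) cH.
have mrad : measurable (@radial_vec R n @^-1` @cradii R n).
  rewrite -[X in measurable X]setTI.
  by apply: measurable_radial_vec => //; exact: measurable_cradii.
rewrite /radial_measure Cintegral_distribution// ?radial_vec_cradii//.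
  exact: measurable_cradii.
rewrite -radial_vec_cradii.
apply: (@cintegrable_le _ _ _ mu _ mrad _ (cst B)).
- by apply: measurable_funTS; apply: (measurableT_comp mRe); exact: measurable_radial_vec.
- by apply: measurable_funTS; apply: (measurableT_comp mIm); exact: measurable_radial_vec.
- exact: finite_measure_integrable_cst.
- by move=> r rD; apply: HB; exact/polydisc_sub/cradii_polydisc.
Qed.

Lemma Cintegral_cutoff (P : probability Cn R) (D : set Cn) (G : Cn -> R[i]) e :
  carried_by P D -> D `<=` polydisc -> continuous G -> 0 < e ->
  exists N, forall k, (N <= k)%N ->
    normc (Cintegral P D G - Cintegral P D (fun z => (cutoff k z)%:C * G z)) < e.
Proof.
move=> PD Dp cG e0.
have [B B0 GB] := compact_normc_bounded (@compact_cpolydisc R n 1) cG.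
have [N NP] := cutoff_integral PD Dp (divr_gt0 e0 B0).
exists N => k /NP Ik; have [mD Dc _] := PD.
have cc := mulc_continuous (@cutoff_continuous R n k) cG.
have iG := continuous_cintegrable PD cG.
have iC := continuous_cintegrable PD cc.
have i1 : P.-integrable D (fun z => (1 - cutoff k z)%:E).
  apply: (continuous_integrable PD).
  have := affine_continuous (a := -1) (b := 1) (Re_continuous (@cutoff_continuous R n k)).
  by apply: eq_continuous_vec => z /=; rewrite mulN1r addrC.
rewrite -CintegralB//; apply: (@le_lt_trans _ _ (\int[P]_(z in D) (B * (1 - cutoff k z)))).
  apply: normc_Cintegral_le => //; first exact: cintegrableB.
    exact: integrableZl_real.
  move=> z Dz; rewrite -[X in X - _]mul1r -mulrBl -rmorphB Normc.normcM normc_real mulrC.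
  have /andP[_ c1] := cutoff_01 k z.
  by rewrite ger0_norm ?subr_ge0// ler_wpM2r ?subr_ge0// GB//; exact: Dc.
by rewrite RintegralZl// mulrC -ltr_pdivlMr.
Qed.

(** Extends the defining property of [theta] to functions that do not vanish near the boundary. The
    cutoff is invariant under rotations, so it passes through the torus average, and it alters each
    side by an arbitrarily small amount. *)
Lemma Cintegral_polar (G : Cn -> R[i]) : continuous G ->
  Cintegral theta polydisc G =
  Cintegral radial_measure (@cradii R n) (torus_average sigma G).
Proof.
move=> cG; have cA := torus_average_continuous sigma_haar cG.
apply/eqP; rewrite -subr_eq0 -normc_eq0 eq_le normc_ge0 andbT.
apply/ler_addgt0Pr => e e0; rewrite add0r.
have e2 : 0 < e / 2 by rewrite divr_gt0.
have [N1 N1P] := Cintegral_cutoff polydisc_carried (@subset_refl _ _) cG e2.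
have [N2 N2P] := Cintegral_cutoff radial_carried (@cradii_polydisc R n) cA e2.
pose k := maxn N1 N2; pose Gk z := (cutoff k z)%:C * G z.
have cGk : continuous Gk := mulc_continuous (@cutoff_continuous R n k) cG.
have E : Cintegral theta polydisc Gk = Cintegral radial_measure (@cradii R n)
    (fun z => (cutoff k z)%:C * torus_average sigma G z).
  have [_ ->] := theta_polar; last 2 first.
  - exact: continuous_subspaceT.
  - exists (cpolydisc (1 - k.+1%:R^-1)); split; first exact: compact_cpolydisc.
      move=> z zD; apply/polydiscP => j; apply: le_lt_trans (zD j) _.
      by rewrite ltrBlDr ltrDl invr_gt0 ltr0n.
    move=> z _ zK; rewrite /Gk; have [->|/cutoff_support //] := eqVneq (cutoff k z) 0.
    by rewrite mul0r.
  rewrite Cintegral_radial; last exact: mulc_continuous (@cutoff_continuous R n k) cA.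
  apply: eq_Cintegral => r _; rewrite /torus_average.
  rewrite -CintegralZ; last 2 first.
  - exact: measurable_torus.
  - apply: (continuous_cintegrable (torus_carried sigma_haar)).
    exact: comp_continuous cG (@rotate_continuousl R n (radial_vec r)).
  apply: eq_Cintegral => zeta /set_mem zT.
  by rewrite dilateE /Gk cutoff_rotate.
rewrite (le_trans (normc_triangle (Cintegral theta polydisc Gk) _ _))// [leRHS]splitr.
apply: lerD; first by apply/ltW/N1P; rewrite leq_maxl.
by rewrite E normc_sub; apply/ltW/N2P; rewrite leq_maxr.
Qed.

Lemma Cintegral_polydisc_rotate (xi : Cn) (G : Cn -> R[i]) :
  torus xi -> continuous G ->
  Cintegral theta polydisc (fun z => G (rotate xi z)) = Cintegral theta polydisc G.
Proof.
move=> xiT cG; have cGr := comp_continuous cG (@rotate_continuous R n xi).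
rewrite (Cintegral_polar cGr) (Cintegral_polar cG).
apply: eq_Cintegral => z _; rewrite -(torus_average_rotate sigma_haar z xiT cG).
apply: eq_Cintegral => zeta _; congr G.
by rewrite !rotateA [rotate xi zeta]rotateC.
Qed.

End Polar.

(** * Product measures on the radii *)

Section ProductMeasure.
Context (R : realType) (n : nat) (mu_ : 'I_n -> probability R R)
  (mu : probability (n.-tuple R) R).
Hypothesis mu_product : is_product_measure mu_ mu.

(** Overwrites coordinate [j] by an independent sample. Resampling leaves the law [mu] unchanged,
    and this expresses the independence of coordinate [j] from the others as a plain product of two
    measures. *)
Definition set_tnth (j : 'I_n) (p : R * n.-tuple R) : n.-tuple R :=
  [tuple if i == j then p.1 else tnth p.2 i | i < n].

Lemma measurable_set_tnth j : measurable_fun setT (set_tnth j).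
Proof.
apply/measurable_fun_tnthP => i.
have [ij|ij] := eqVneq i j.
  rewrite (_ : _ \o _ = fst); first exact: measurable_fst.
  by apply/funext => p /=; rewrite tnth_mktuple ij eqxx.
rewrite (_ : _ \o _ = (@tnth n R ^~ i) \o snd).
  by apply: measurableT_comp; [exact: measurable_tnth|exact: measurable_snd].
by apply/funext => p /=; rewrite tnth_mktuple (negPf ij).
Qed.

HB.instance Definition _ j :=
  isMeasurableFun.Build _ _ _ _ (set_tnth j) (measurable_set_tnth j).

Lemma measurable_tuple_box (A : 'I_n -> set R) : (forall j, measurable (A j)) ->
  measurable [set r : n.-tuple R | forall j, A j (tnth r j)].
Proof.
move=> mA; rewrite (_ : [set r | _] =
    \bigcap_(i in [set: 'I_n]) (@tnth n R ^~ i @^-1` A i)).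
  apply: fin_bigcap_measurable => // i _; rewrite -[X in measurable X]setTI.
  exact: measurable_tnth.
by apply/seteqP; split=> r rA i; [move=> _; exact: rA|exact: rA].
Qed.

Definition coord_product j := (mu_ j \x mu)%E.

HB.instance Definition _ j := Measure.on (coord_product j).

Lemma coord_product_setT j : coord_product j setT = 1%E.
Proof.
rewrite /coord_product -setXTT; transitivity (mu_ j setT * mu setT)%E.
  exact: product_measure1E.
by rewrite !probability_setT mule1.
Qed.

HB.instance Definition _ j :=
  Measure_isProbability.Build _ _ _ (coord_product j) (coord_product_setT j).

(** The hypothesis on [mu] concerns boxes only; these are stable under intersection and generate the
    sigma-algebra, so agreement on boxes is enough. *)
Lemma distribution_set_tnth j (A : set (n.-tuple R)) : measurable A ->
  mu A = distribution (coord_product j) (set_tnth j) A.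
Proof.
pose G := [set B | exists2 A : 'I_n -> set R, (forall i, measurable (A i)) &
  B = [set r : n.-tuple R | forall i, A i (tnth r i)]].
apply: (measure_unique G (fun=> setT)).
- apply/seteqP; split.
    apply: smallest_sub; first exact: smallest_sigma_algebra.
    rewrite -bigcup_seq => _ [i _ [B mB <-]].
    apply: sub_sigma_algebra; exists (fun k => if k == i then B else setT).
      by move=> k; case: ifP.
    rewrite setTI; apply/seteqP; split=> r /=.
      by move=> Br k; case: eqP => // ->.
    by move=> /(_ i); rewrite eqxx.
  apply: smallest_sub; first exact: sigma_algebra_measurable.
  by move=> _ [B mB ->]; exact: measurable_tuple_box.
- move=> _ _ [B mB ->] [C mC ->]; exists (fun i => B i `&` C i).
    by move=> i; exact: measurableI.
  by apply/seteqP; split=> r /= => [[rB rC] i|rBC]; [|split=> i; have [] := rBC i].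
- by move=> _; exists (fun=> setT) => //; apply/seteqP.
- by rewrite bigcup_const.
- move=> _ [B mB ->]; rewrite /distribution /pushforward /=.
  (* The old value of coordinate [j] is discarded, so it is left unconstrained; the constraint [B j]
     falls on the new sample. *)
  pose B' i := if i == j then setT else B i.
  have mB' i : measurable (B' i) by rewrite /B'; case: ifP.
  rewrite (_ : _ @^-1` _ = B j `*` [set r | forall i, B' i (tnth r i)]); last first.
    apply/seteqP; split=> -[x r] /=.
      move=> rB; split; first by have := rB j; rewrite tnth_mktuple eqxx.
      by move=> i; have := rB i; rewrite tnth_mktuple /B'; case: ifP.
    move=> [xB rB] i; rewrite tnth_mktuple; have := rB i; rewrite /B'.
    by case: eqP => [->|].
  rewrite /coord_product.
  transitivity (mu_ j (B j) * mu [set r | forall i, B' i (tnth r i)])%E; last first.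
    by apply/esym/product_measure1E => //; exact: measurable_tuple_box.
  rewrite !mu_product// (bigD1 j)//=; congr (_ * _)%E.
  have -> : (\prod_i mu_ i (B' i) = mu_ j setT * \prod_(i | i != j) mu_ i (B' i))%E.
    by rewrite (bigD1 j)//= {1}/B' eqxx.
  rewrite -[LHS]mul1e; congr (_ * _)%E; first exact/esym/probability_setT.
  by apply: eq_bigr => i ij; rewrite /B' (negPf ij).
- by move=> _; rewrite /= (@le_lt_trans _ _ 1%E) ?ltry// probability_le1.
Qed.

(** After resampling, [phi] sees only the new value and [h] only the other coordinates, so that
    Fubini's theorem separates them. *)
Lemma Rintegral_set_tnth j (phi : R -> R) (h : n.-tuple R -> R) B :
  measurable_fun setT phi -> measurable_fun setT h ->
  (forall x, `|phi x| <= B) -> (forall r, `|h r| <= B) ->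
  (forall x r, h (set_tnth j (x, r)) = h r) ->
  \int[mu]_r (phi (tnth r j) * h r) = \int[mu_ j]_x phi x * \int[mu]_r h r.
Proof.
move=> mphi mh phiB hB hj.
have ih : mu.-integrable setT (EFin \o h).
  apply: (le_integrable measurableT _ _ (finite_measure_integrable_cst mu B measurableT)).
    exact/measurable_EFinP.
  by move=> r _; rewrite /= lee_fin (le_trans (hB r))// ler_norm.
have iphi : (mu_ j).-integrable setT (EFin \o phi).
  apply: (le_integrable measurableT _ _
    (finite_measure_integrable_cst (mu_ j) B measurableT)).
    exact/measurable_EFinP.
  by move=> r _; rewrite /= lee_fin (le_trans (phiB r))// ler_norm.
pose f r := (phi (tnth r j) * h r)%:E.
have mf : measurable_fun setT f.
  apply/measurable_EFinP; apply: measurable_funM => //.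
  by apply: (measurableT_comp mphi); exact: measurable_tnth.
have iF : (coord_product j).-integrable setT (f \o set_tnth j).
  apply: (le_integrable measurableT _ _
    (finite_measure_integrable_cst (coord_product j) (B * B) measurableT)).
    by apply: (measurableT_comp mf); exact: measurable_set_tnth.
  move=> r _; rewrite /= lee_fin normrM (le_trans _ (ler_norm _))//.
  by rewrite ler_pM.
rewrite {1}/Rintegral.
rewrite (eq_measure_integral (distribution (coord_product j) (set_tnth j))); last first.
  by move=> A mA _; exact: distribution_set_tnth.
rewrite integral_distribution//.
rewrite -integral12_prod_meas1//.
transitivity (fine (\int[mu_ j]_x (phi x * \int[mu]_r h r)%:E)%E).
  congr fine; apply: eq_integral => x _.
  transitivity (\int[mu]_r ((phi x)%:E * (h r)%:E))%E.
    by apply: eq_integral => r _; rewrite /f /= hj tnth_mktuple eqxx EFinM.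
  rewrite integralZl// EFinM; congr (_ * _)%E.
  by rewrite /Rintegral fineK//; exact: integrable_fin_num.
by rewrite -/(Rintegral _ _ _) RintegralZr.
Qed.

Lemma Rintegral_tnth j (phi : R -> R) B : measurable_fun setT phi ->
  (forall x, `|phi x| <= B) -> \int[mu]_r phi (tnth r j) = \int[mu_ j]_x phi x.
Proof.
move=> mphi phiB.
have I1 : \int[mu]_r (cst 1 r) = 1 :> R.
  rewrite Rintegral_cst// mul1r; transitivity (fine (1%E : \bar R)) => //.
  by congr fine; exact: probability_setT.
rewrite -[RHS]mulr1 -I1 -(@Rintegral_set_tnth j phi (cst 1) (Order.max B 1))//.
- by under [RHS]eq_Rintegral do rewrite mulr1.
- by move=> x; rewrite (le_trans (phiB x))// le_max lexx.
- by move=> x; rewrite normr1 le_max lexx orbT.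
Qed.

Hypothesis mu_radial : forall j, radial_probability (mu_ j).

Lemma product_radii : mu radii = 1%E.
Proof.
rewrite (_ : radii = [set r : n.-tuple R | forall j, [set` `[0, 1[%R] (tnth r j)]).
  rewrite (mu_product (A := fun=> [set` `[0, 1[%R]))//; apply: big1 => j _.
  by have [] := mu_radial j.
by apply/seteqP; split=> r rD j; have := rD j; rewrite /= in_itv.
Qed.

Lemma product_near1_gt0 t : 0 < t < 1 ->
  (0 < mu [set r : n.-tuple R | forall j, (t <= tnth r j < 1)%R])%E.
Proof.
move=> t01.
rewrite (_ : [set r | _] = [set r : n.-tuple R | forall j, [set` `[t, 1[%R] (tnth r j)]).
  rewrite (mu_product (A := fun=> [set` `[t, 1[%R]))//; elim/big_ind : _ => //.
    by move=> x y; exact: mule_gt0.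
  by move=> j _; have [_] := mu_radial j; apply.
by apply/seteqP; split=> r rD j; have := rD j; rewrite /= in_itv.
Qed.

End ProductMeasure.

(** * Retraction onto the closed polydisc and projection onto a face *)

Section Clip.
Context (R : realType) (n : nat).
Local Notation Cn := 'rV[R[i]]_n.

(** The coordinatewise radial retraction onto [cpolydisc 1]. Composition with it extends a function
    continuous on the closed polydisc to one continuous, and bounded, on C^n. *)
Definition clip (z : Cn) : Cn :=
  \row_i (((Order.max 1 (normc (z 0 i)))^-1)%:C * z 0 i).

Lemma clip_id z : cpolydisc 1 z -> clip z = z.
Proof.
by move=> zD; apply/rowP => i; rewrite mxE max_l ?zD// invr1 mul1r.
Qed.

Lemma normc_clip z i : normc (clip z 0 i) = Order.min 1 (normc (z 0 i)).
Proof.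
have m0 : 0 < Order.max 1 (normc (z 0 i)) by rewrite lt_max ltr01.
rewrite mxE Normc.normcM normc_real ger0_norm ?invr_ge0 ?ltW//.
case: (leP 1 (normc (z 0 i))) => z1; last by rewrite invr1 mul1r.
by rewrite mulVf// gt_eqF// (lt_le_trans ltr01).
Qed.

Lemma clip_cpolydisc z : cpolydisc 1 (clip z).
Proof. by move=> i; rewrite normc_clip ge_min lexx. Qed.

Lemma clip_continuous : continuous clip.
Proof.
apply: vec_continuous => i.
have cn := @normc_coord_continuous R n i.
have cm : continuous (fun z : Cn => (Order.max 1 (normc (z 0 i)))^-1).
  apply/continuous_vec_realP => z e e0.
  have /continuous_vec_realP /(_ z e e0) [d d0 dP] := cn.
  exists d => // w /dP; apply: le_lt_trans.
  set a := normc _; set b := normc _.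
  have a0 := normc_ge0 (z 0 i); have b0 := normc_ge0 (w 0 i); rewrite -/a -/b in a0 b0.
  have ma : 1 <= Order.max 1 a by rewrite le_max lexx.
  have mb : 1 <= Order.max 1 b by rewrite le_max lexx.
  have ma0 := lt_le_trans ltr01 ma; have mb0 := lt_le_trans ltr01 mb.
  have -> : (Order.max 1 a)^-1 - (Order.max 1 b)^-1 =
      (Order.max 1 b - Order.max 1 a) / (Order.max 1 a * Order.max 1 b).
    by field; rewrite !gt_eqF.
  have mab : 0 < Order.max 1 a * Order.max 1 b by rewrite mulr_gt0.
  rewrite normrM normfV (gtr0_norm mab) ler_pdivrMr//.
  apply: (@le_trans _ _ `|a - b|); last by rewrite ler_peMr// -[leLHS]mulr1 ler_pM.
  rewrite distrC; case: (leP 1 a) => a1; case: (leP 1 b) => b1 //.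
  - by rewrite !ger0_norm; lra.
  - by rewrite distrC [leRHS]distrC !ger0_norm; lra.
  - by rewrite subrr normr0.
have := mulc_continuous (real_complex_continuous cm) (@coord_vec_continuous R n i).
by apply: eq_continuous_vec => z; rewrite mxE.
Qed.

Lemma cpolydisc_sub_closure : cpolydisc 1 `<=` closure (polydisc : set Cn).
Proof.
move=> z zD U /nbhs_vecP [d d0 dU].
(* Shrinking by a factor in [1/2, 1) enters the open polydisc and moves each coordinate by at most
   [d / 2]. *)
pose t := 1 - Order.min 1 d / 2.
have m0 : 0 < Order.min 1 d by rewrite lt_min ltr01.
have m1 : Order.min 1 d <= 1 by rewrite ge_min lexx.
have md : Order.min 1 d <= d by rewrite ge_min lexx orbT.
have t0 : 0 <= t by rewrite /t; lra.
have zt i : normc ((t%:C *: z) 0 i) = t * normc (z 0 i).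
  by rewrite mxE Normc.normcM normc_real ger0_norm.
exists (t%:C *: z); split.
  apply/polydiscP => i; rewrite zt; apply: (@le_lt_trans _ _ t); last by rewrite /t; lra.
  by rewrite ler_piMr.
apply: dU => i; rewrite mxE -[X in X - _]mul1r -mulrBl Normc.normcM.
rewrite -(rmorphB (real_complex R) 1) normc_real /t opprB addrC subrK.
rewrite ger0_norm ?divr_ge0 ?(ltW m0)//.
apply: (@le_lt_trans _ _ (Order.min 1 d / 2)); last by lra.
by rewrite ler_piMr ?divr_ge0 ?(ltW m0).
Qed.

Lemma continuous_clip_extension (f : Cn -> R[i]) :
  {within closure polydisc, continuous f} -> continuous (fun z => f (clip z)).
Proof.
move=> /subspace_continuousP cf z U fU.
have near_fU : nbhs (clip z) [set w | closure (polydisc : set Cn) w -> U (f w)].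
  exact: cf (clip z) (cpolydisc_sub_closure (@clip_cpolydisc z)) U fU.
have /nbhs_vecP [d d0 dU] := near_fU.
have near_clip : nbhs (clip z) [set w : Cn | forall i, normc (clip z 0 i - w 0 i) < d].
  by apply/nbhs_vecP; exists d.
have /nbhs_vecP [d' d'0 dclip] := @clip_continuous z _ near_clip.
apply/nbhs_vecP; exists d' => // w zw; apply: dU; first exact: dclip.
exact/cpolydisc_sub_closure/clip_cpolydisc.
Qed.

Definition set_coord1 (j : 'I_n) (z : Cn) : Cn :=
  \row_i (if i == j then 1 else z 0 i).

Lemma set_coord1_continuous j : continuous (set_coord1 j).
Proof.
apply: vec_continuous => i; have [->|ij] := eqVneq i j.
  by apply: (eq_continuous_vec _ (@cstc_continuous R n 1)) => z;
     rewrite mxE eqxx.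
by apply: (eq_continuous_vec _ (@coord_vec_continuous R n i)) => z;
  rewrite mxE (negPf ij).
Qed.

Lemma set_coord1_cpolydisc j z : cpolydisc 1 z -> cpolydisc 1 (set_coord1 j z).
Proof. by move=> zD i; rewrite mxE; case: ifP => _; rewrite ?Normc.normc1. Qed.

Lemma set_coord1_torus j z : torus z -> torus (set_coord1 j z).
Proof.
move=> /torusP zT; apply/torusP => i; rewrite mxE; case: ifP => // _.
exact: Normc.normc1.
Qed.

Lemma set_coord1_rotate j (xi z : Cn) :
  set_coord1 j (rotate xi z) = rotate (set_coord1 j xi) (set_coord1 j z).
Proof. by apply/rowP => i; rewrite !mxE; case: ifP => // _; rewrite mulr1. Qed.

Lemma set_coord1_id j (z : Cn) : set_coord1 j (set_coord1 j z) = set_coord1 j z.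
Proof. by apply/rowP => i; rewrite !mxE; case: ifP => // ->. Qed.

Lemma set_coord1_one j : set_coord1 j (const_mx 1 : Cn) = const_mx 1.
Proof. by apply/rowP => i; rewrite !mxE; case: ifP => // ->. Qed.

End Clip.

(** * Independence of the radii, for integrals over C^n *)

Section RadialIndependence.
Context (R : realType) (n : nat) (mu_ : 'I_n -> probability R R)
  (mu : probability (n.-tuple R) R).
Hypotheses (mu_product : is_product_measure mu_ mu)
  (mu_radial : forall j, radial_probability (mu_ j)).
Local Notation Cn := 'rV[R[i]]_n.
Local Notation M := (radial_measure mu).

Let mu_radii : mu radii = 1%E := product_radii mu_product mu_radial.

(** The right-hand side runs over all tuples, as in the product lemmas; [clip] keeps the integrand
    bounded there, and tuples outside [radii] form a null set. *)
Lemma Rintegral_radial (F : Cn -> R) : continuous F ->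
  \int[M]_(z in @cradii R n) F z = \int[mu]_r F (clip (radial_vec r)).
Proof.
move=> cF.
have [B B0 FB] := compact_normc_bounded (@compact_cpolydisc R n 1)
  (real_complex_continuous cF).
have mF : measurable_fun setT (fun r => F (clip (@radial_vec R n r))).
  have cFc : continuous (F \o @clip R n).
    move=> z; apply: (@continuous_comp _ _ _ (@clip R n) F); first exact: clip_continuous.
    exact: cF.
  apply: (measurableT_comp (continuous_measurable_vec cFc measurableT)).
  exact: measurable_radial_vec.
have iF : mu.-integrable setT (fun r => (F (clip (@radial_vec R n r)))%:E).
  apply: (le_integrable measurableT _ _
    (finite_measure_integrable_cst mu B measurableT)).
    exact/measurable_EFinP.
  move=> r _; rewrite /= lee_fin -normc_real (le_trans (FB _ _)) ?ler_norm//.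
  exact: clip_cpolydisc.
have := Cintegral_radial mu (real_complex_continuous cF).
rewrite !Cintegral_real => /complexI ->.
have mrad : measurable (@radii R n).
  rewrite -radial_vec_cradii -[X in measurable X]setTI.
  by apply: measurable_radial_vec => //; exact: measurable_cradii.
have N0 : mu (~` @radii R n) = 0%E.
  by rewrite probability_setC// mu_radii subee.
rewrite [in RHS]/Rintegral (negligible_integral (measurableC mrad) measurableT iF N0).
rewrite setDE setCK setTI; congr fine; apply: eq_integral => r /set_mem rD.
rewrite clip_id// => i; apply: polydisc_sub i; apply: cradii_polydisc.
by rewrite -radial_vec_cradii in rD.
Qed.

Lemma Rintegral_radial_indep j k (h : Cn -> R) : continuous h ->
  \int[M]_(z in @cradii R n) (normc (z 0 j) ^+ k * h (set_coord1 j z)) =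
  \int[M]_(z in @cradii R n) (normc (z 0 j) ^+ k) *
  \int[M]_(z in @cradii R n) h (set_coord1 j z).
Proof.
move=> ch.
have ck : continuous (fun z : Cn => normc (z 0 j) ^+ k).
  exact: exp_continuous_real (@normc_coord_continuous R n j).
have chj : continuous (fun z => h (set_coord1 j z)).
  move=> z; apply: (@continuous_comp _ _ _ (set_coord1 j) h).
    exact: set_coord1_continuous.
  exact: ch.
have [B B0 hB] := compact_normc_bounded (@compact_cpolydisc R n 1)
  (real_complex_continuous ch).
(* The modulus of the clipped coordinate, raised to the power [k]: bounded on all of [R] and equal
   to [t ^+ k] on [0,1). *)
pose phi (t : R) := Order.min 1 `|t| ^+ k.
pose hr r := h (set_coord1 j (clip (@radial_vec R n r))).
have phiE r : normc (clip (@radial_vec R n r) 0 j) ^+ k = phi (tnth r j).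
  by rewrite normc_clip mxE normc_real.
have mphi : measurable_fun setT phi.
  by apply: measurable_funX; apply: measurable_minr => //; exact: measurable_normr.
have phi1 t : `|phi t| <= 1.
  have m0 : 0 <= Order.min 1 `|t| by rewrite le_min ler01 normr_ge0.
  by rewrite /phi ger0_norm ?exprn_ge0// exprn_ile1// ge_min lexx.
have mh : measurable_fun setT hr.
  have chc : continuous (fun z => h (set_coord1 j (clip z))).
    move=> z; apply: (@continuous_comp _ _ _ (@clip R n) (fun z => h (set_coord1 j z))).
      exact: clip_continuous.
    exact: chj.
  apply: (measurableT_comp (continuous_measurable_vec chc measurableT)).
  exact: measurable_radial_vec.
have hrB r : `|hr r| <= Order.max 1 B.
  by rewrite -normc_real le_max hB ?orbT//; apply/set_coord1_cpolydisc/clip_cpolydisc.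
have phiB t : `|phi t| <= Order.max 1 B by rewrite le_max phi1.
have hj x r : hr (set_tnth j (x, r)) = hr r.
  congr h; apply/rowP => i; rewrite !mxE; case: eqVneq => // ij.
  by rewrite tnth_mktuple (negPf ij).
have ckh : continuous (fun z : Cn => normc (z 0 j) ^+ k * h (set_coord1 j z)).
  move=> z; exact: (@continuousM R Cn _ _ z (ck z) (chj z)).
rewrite (Rintegral_radial ckh) (Rintegral_radial ck) (Rintegral_radial chj).
under eq_Rintegral do rewrite phiE.
under [X in _ = X * _]eq_Rintegral do rewrite phiE.
rewrite (Rintegral_tnth mu_product j mphi phiB).
by rewrite -(Rintegral_set_tnth mu_product mphi mh phiB hrB hj).
Qed.

Lemma Cintegral_radial_indep j k (H : Cn -> R[i]) : continuous H ->
  Cintegral M (@cradii R n) (fun z => (normc (z 0 j) ^+ k)%:C * H (set_coord1 j z)) =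
  (\int[M]_(z in @cradii R n) (normc (z 0 j) ^+ k))%:C *
  Cintegral M (@cradii R n) (fun z => H (set_coord1 j z)).
Proof.
move=> cH; apply/eqP; rewrite eq_complex ReM ImM /= !mul0r subr0 addr0.
rewrite -(Rintegral_radial_indep j k (Re_continuous cH)).
rewrite -(Rintegral_radial_indep j k (Im_continuous cH)).
apply/andP; split; apply/eqP; apply: eq_Rintegral => z _.
  by rewrite ReM /= mul0r subr0.
by rewrite ImM /= mul0r addr0.
Qed.

Lemma radial_near1_gt0 (A : set Cn) t : measurable A -> 0 < t < 1 ->
  (forall z, cradii z -> (forall j, t <= complex.Re (z 0 j)) -> A z) ->
  (0 < M (@cradii R n `&` A))%E.
Proof.
move=> mA t01 tA; apply: lt_le_trans (product_near1_gt0 mu_product mu_radial t01) _.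
rewrite radial_measureE; apply: le_measure; rewrite ?inE.
- rewrite (_ : [set r | _] = [set r : n.-tuple R | forall j, [set` `[t, 1[%R] (tnth r j)]).
    exact: (@measurable_tuple_box _ _ (fun=> [set` `[t, 1[%R])).
  by apply/seteqP; split=> r rD j; have := rD j; rewrite /= in_itv.
- rewrite -[X in measurable X]setTI; apply: measurable_radial_vec => //.
  by apply: measurableI => //; exact: measurable_cradii.
- move=> r rt; have rc : cradii (radial_vec r).
    suff : (@radial_vec R n @^-1` @cradii R n) r by [].
    rewrite radial_vec_cradii => j.
    have /andP[r1 r2] := rt j; rewrite r2 andbT; apply: le_trans r1; apply/ltW.
    by case/andP: t01.
  split=> //; apply: tA => // j; rewrite mxE /=.
  by have /andP[] := rt j.
Qed.

Lemma radial_box1_gt0 (d : R) : 0 < d ->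
  (0 < M (@cradii R n `&`
     [set z | forall i, (normc ((const_mx 1 : Cn) 0 i - z 0 i) < d)%R]))%E.
Proof.
move=> d0; apply: (@radial_near1_gt0 _ (Order.max (1 / 2) (1 - d / 2))).
- exact: measurable_box.
- by rewrite lt_max gt_max; apply/andP; split; [apply/orP; left|apply/andP; split]; lra.
- move=> z zD tz i; rewrite mxE; have [] := zD i; have := tz i.
  case: (z 0 i) => a b /= + -> /andP[a0 a1]; rewrite ge_max => /andP[_ ad].
  by rewrite subr0 expr0n addr0 sqrtr_sqr ger0_norm; lra.
Qed.

Lemma radial_coord_gt0 j t : t < 1 ->
  (0 < M (@cradii R n `&` [set z : Cn | (t < normc (z 0 j) ^+ 2)%R]))%E.
Proof.
move=> t1; pose u := Order.max 0 t.
have u0 : 0 <= u by rewrite le_max lexx.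
have tu : t <= u by rewrite le_max lexx orbT.
have u1 : u < 1 by rewrite gt_max ltr01.
clearbody u.
(* The square of [(1 + u) / 2] exceeds [u] by the square of [(1 - u) / 2], which is positive. *)
apply: (@radial_near1_gt0 _ ((1 + u) / 2)).
- apply: measurable_lt_vec.
  exact: exp_continuous_real (@normc_coord_continuous R n j).
- by apply/andP; split; lra.
- move=> z zD tz /=; have [] := zD j; have := tz j.
  case: (z 0 j) => a b /= ua -> /andP[a0 a1].
  by rewrite expr0n addr0 sqrtr_sqr ger0_norm//; nra.
Qed.

End RadialIndependence.

(** * Fourier coefficients on the torus *)

Section Monomials.
Context (R : realType) (n : nat).
Local Notation Cn := 'rV[R[i]]_n.
Implicit Types (a b : 'I_n -> nat) (z xi : Cn).

Definition monomial a z : R[i] := \prod_i z 0 i ^+ a i.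

(* The character of the torus with exponent [a - b]. *)
Definition character a b z : R[i] := monomial a z * (monomial b z)^*.

Lemma monomial_continuous a : continuous (monomial a).
Proof.
apply: prodc_continuous => i.
exact: (expc_continuous (k := a i) (@coord_vec_continuous R n i)).
Qed.

Lemma character_continuous a b : continuous (character a b).
Proof.
exact: (mulc_continuous (@monomial_continuous a)
  (conjc_continuous (@monomial_continuous b))).
Qed.

Lemma monomial_rotate a xi z : monomial a (rotate xi z) = monomial a xi * monomial a z.
Proof. by rewrite -big_split; apply: eq_bigr => i _; rewrite mxE exprMn. Qed.

Lemma character_rotate a b xi z :
  character a b (rotate xi z) = character a b xi * character a b z.
Proof. by rewrite /character !monomial_rotate conjcM mulrACA. Qed.

Lemma monomialD a b z : monomial (fun i => a i + b i)%N z = monomial a z * monomial b z.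
Proof. by rewrite -big_split; apply: eq_bigr => i _; rewrite exprD. Qed.

Lemma normc_monomial a xi : torus xi -> normc (monomial a xi) = 1.
Proof.
by move=> /torusP xiT; rewrite normc_prod big1// => i _; rewrite normcX xiT expr1n.
Qed.

Lemma monomial_conj a xi : torus xi -> monomial a xi * (monomial a xi)^* = 1.
Proof. by move=> xiT; rewrite mul_conj_normc normc_monomial// expr1n. Qed.

Lemma character_conj a b xi : torus xi -> character a b xi * (character a b xi)^* = 1.
Proof.
move=> xiT; rewrite /character conjcM conjc2 mulrACA monomial_conj//.
by rewrite [_^* * _]mulrC monomial_conj// mulr1.
Qed.

Lemma monomial_one a : monomial a (const_mx 1) = 1.
Proof. by apply: big1 => i _; rewrite mxE expr1n. Qed.

Lemma character_one a b : character a b (const_mx 1) = 1.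
Proof. by rewrite /character !monomial_one conjc_one mulr1. Qed.

(** On the unit circle conjugation is inversion. The alternative [xi 0 i == 1] serves points of a
    face, where the truncated difference [a i - b i] does no harm. *)
Lemma character_sub a b xi : torus xi ->
  (forall i, (b i <= a i)%N || (xi 0 i == 1)) ->
  character a b xi = monomial (fun i => a i - b i)%N xi.
Proof.
move=> /torusP xiT ba; rewrite /character /monomial rmorph_prod -big_split.
apply: eq_bigr => i _; have /orP[bai|/eqP ->] := ba i; last first.
  by rewrite /= !expr1n mul1r; exact: conjc_one.
rewrite /= -{1}(subnK bai) exprD -mulrA; have := mul_conj_normc (xi 0 i ^+ b i).
by rewrite normcX xiT !expr1n => ->; rewrite mulr1.
Qed.

Definition coord_point (i : 'I_n) (c : R[i]) : Cn := \row_k (if k == i then c else 1).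

Lemma monomial_coord_point a i c : monomial a (coord_point i c) = c ^+ a i.
Proof.
rewrite /monomial (bigD1 i)//= mxE eqxx big1 ?mulr1// => k ki.
by rewrite mxE (negPf ki) expr1n.
Qed.

Lemma torus_coord_point i c : normc c = 1 -> torus (coord_point i c).
Proof. by move=> c1; apply/torusP => k; rewrite mxE; case: ifP; rewrite ?Normc.normc1. Qed.

(** For [p < q], a root [c] of order [q - p] of -1 satisfies [c ^+ q = - c ^+ p]. *)
Lemma unit_separates (p q : nat) : p != q ->
  exists2 c : R[i], normc c = 1 & c ^+ p != c ^+ q.
Proof.
wlog pq : p q / (p < q)%N => [hw|_].
  rewrite neq_ltn => /orP[pq|qp]; first by apply: hw; rewrite // ltn_eqF.
  have [|c c1 cqp] := hw q p qp; first by rewrite ltn_eqF.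
  by exists c => //; rewrite eq_sym.
have d0 : (0 < q - p)%N by rewrite subn_gt0.
exists ((q - p).-root (-1 : R[i])).
  have : normc ((q - p).-root (-1 : R[i])) ^+ (q - p) = 1.
    by rewrite -normcX rootCK// normcN Normc.normc1.
  by move/eqP; rewrite pexpr_eq1// ?normc_ge0// => /eqP.
set c := _.-root _; rewrite -{1}(subnK (ltnW pq)) exprD rootCK// mulN1r.
have cp : c ^+ p != 0.
  rewrite expf_neq0// rootC_eq0// oppr_eq0 oner_neq0 //.
by rewrite -addr_eq0 -mulr2n mulrn_eq0 negb_or.
Qed.

End Monomials.

Section FourierCoefficients.
Context (R : realType) (n : nat) (mu_ : 'I_n -> probability R R)
  (mu : probability (n.-tuple R) R) (sigma theta : probability 'rV[R[i]]_n R).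
Hypotheses (mu_product : is_product_measure mu_ mu)
  (mu_radial : forall j, radial_probability (mu_ j))
  (sigma_haar : is_torus_haar sigma) (theta_polar : is_polar_measure mu sigma theta).
Local Notation Cn := 'rV[R[i]]_n.
Local Notation M := (radial_measure mu).
Local Notation rad := (@cradii R n).

Let mu_radii : mu radii = 1%E := product_radii mu_product mu_radial.
Let Mrad : carried_by M rad := radial_carried mu_radii.
Let mrad : measurable rad := @measurable_cradii R n.

Lemma Cintegral_homogeneous0 (xi : Cn) (l : R[i]) (G : Cn -> R[i]) :
  torus xi -> l != 1 -> continuous G -> (forall z, G (rotate xi z) = l * G z) ->
  Cintegral theta polydisc G = 0.
Proof.
move=> xiT l1 cG Gl; have := Cintegral_polydisc_rotate sigma_haar theta_polar mu_radii xiT cG.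
have iG := continuous_cintegrable (polydisc_carried theta_polar) cG.
have mD := @measurable_polydisc R n.
under [X in X = _ -> _]eq_Cintegral do rewrite Gl.
rewrite CintegralZ// => /eqP; rewrite -subr_eq0 -{2}[Cintegral _ _ _]mul1r -mulrBl.
by rewrite mulf_eq0 subr_eq0 (negPf l1) => /eqP.
Qed.

Lemma Cintegral_invariant (G : Cn -> R[i]) : continuous G ->
  (forall xi z, torus xi -> G (rotate xi z) = G z) ->
  Cintegral theta polydisc G = Cintegral M rad G.
Proof.
move=> cG Ginv; rewrite (Cintegral_polar sigma_haar theta_polar mu_radii cG).
apply: eq_Cintegral => z _; rewrite /torus_average.
rewrite -[RHS](Cintegral_cst (torus_carried sigma_haar)).
by apply: eq_Cintegral => xi /set_mem xiT; rewrite Ginv.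
Qed.

Section Limit.
Variable j : 'I_n.

(** By rotation invariance this is also the squared norm of [z_j^k] in L^2 of [theta]. *)
Definition moment k : R := \int[M]_(z in rad) (normc (z 0 j) ^+ 2) ^+ k.

Let q (z : Cn) : R := normc (z 0 j) ^+ 2.
Let cq : continuous q := exp_continuous_real (k := 2) (@normc_coord_continuous R n j).

Let q01 z : rad z -> 0 <= q z <= 1.
Proof.
move=> /cradii_polydisc /polydiscP /(_ j) zj.
by rewrite exprn_ge0 ?normc_ge0//= exprn_ile1 ?normc_ge0// ltW.
Qed.

Let Mq t : t < 1 -> (0 < M (rad `&` [set z | (t < q z)%R]))%E.
Proof. exact: (@radial_coord_gt0 R n mu_ mu mu_product mu_radial j t). Qed.

Lemma moment_gt0 k : 0 < moment k.
Proof. exact: (integral_pow_gt0 Mrad k cq q01 Mq). Qed.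

Lemma moment_small s eta : 0 <= s < 1 -> 0 < eta ->
  exists N, forall k, (N <= k)%N -> s ^+ k <= eta * moment k.
Proof. by move=> s01 eta0; exact: (laplace_small Mrad cq q01 s01 eta0 Mq). Qed.

Lemma Cintegral_moment k :
  Cintegral theta polydisc (fun z => ((normc (z 0 j) ^+ 2) ^+ k)%:C) = (moment k)%:C.
Proof.
have cqk := real_complex_continuous (exp_continuous_real (k := k) cq).
rewrite Cintegral_invariant// ?Cintegral_real// => xi z /torusP xiT.
by rewrite mxE Normc.normcM xiT mul1r.
Qed.

(** The weight [|z_j|^(2k)] concentrates on [|z_j| = 1], so the torus average of [G] may be replaced
    by its value on the face; by independence of the radii the weight then factors out as
    [moment k]. The error is relative to [moment k], by which the pairing is later divided. *)
Lemma laplace_limit (G : Cn -> R[i]) e : continuous G -> 0 < e ->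
  exists N, forall k, (N <= k)%N ->
    normc (Cintegral theta polydisc (fun z => ((normc (z 0 j) ^+ 2) ^+ k)%:C * G z) -
      (moment k)%:C * Cintegral M rad (fun z => torus_average sigma G (set_coord1 j z)))
    <= e * moment k.
Proof.
move=> cG e0.
have cA := torus_average_continuous sigma_haar cG; set A := torus_average sigma G in cA *.
have cAj := comp_continuous cA (@set_coord1_continuous R n j).
have cD := subc_continuous cA cAj.
have [B B0 DB] := compact_normc_bounded (@compact_cpolydisc R n 1) cD.
have e2 : 0 < e / 2 by rewrite divr_gt0.
have [d d0 dA] := compact_unif_continuous (@compact_cpolydisc R n 1) cA e2.
(* For [0 <= x < 1], [1 - x <= 1 - x ^+ 2]: if [|z_j|^2] exceeds [s], then [|z_j|] is within [d] of
   1. *)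
pose s := 1 - Order.min 1 d.
have m0 : 0 < Order.min 1 d by rewrite lt_min ltr01.
have m1 : Order.min 1 d <= 1 by rewrite ge_min lexx.
have md : Order.min 1 d <= d by rewrite ge_min lexx orbT.
have s01 : 0 <= s < 1 by rewrite /s; apply/andP; split; lra.
have eB : 0 < e / 2 / B by rewrite divr_gt0.
have [N NP] := moment_small s01 eB.
exists N => k /NP sk.
have cqk := real_complex_continuous (exp_continuous_real (k := k) cq).
have -> : Cintegral theta polydisc (fun z => ((normc (z 0 j) ^+ 2) ^+ k)%:C * G z) =
    Cintegral M rad (fun z => (q z ^+ k)%:C * A z).
  rewrite (Cintegral_polar sigma_haar theta_polar mu_radii (mulc_continuous cqk cG)).
  apply: eq_Cintegral => z _; rewrite /A /torus_average -CintegralZ; last 2 first.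
  - exact: measurable_torus.
  - apply: (continuous_cintegrable (torus_carried sigma_haar)).
    exact: comp_continuous cG (@rotate_continuousl R n z).
  apply: eq_Cintegral => zeta /set_mem /torusP zT; rewrite /q.
  have -> : normc (rotate zeta z 0 j) = normc (z 0 j).
    by rewrite mxE Normc.normcM zT mul1r.
  by [].
have -> : (moment k)%:C * Cintegral M rad (fun z => A (set_coord1 j z)) =
    Cintegral M rad (fun z => (q z ^+ k)%:C * A (set_coord1 j z)).
  have := Cintegral_radial_indep mu_product mu_radial j (2 * k) cA.
  rewrite (_ : Rintegral _ _ _ = moment k); last first.
    by apply: eq_Rintegral => z _; rewrite exprM.
  by move=> <-; apply: eq_Cintegral => z _; rewrite /q exprM.
rewrite -CintegralB//; last 2 first.
- exact: (continuous_cintegrable Mrad (mulc_continuous cqk cA)).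
- exact: (continuous_cintegrable Mrad (mulc_continuous cqk cAj)).
under eq_Cintegral do rewrite -mulrBr.
have := laplace_bound Mrad (e := e / 2) (B := B) (s := s) k cq cD q01.
rewrite -/(moment k) => /(_ (ltW e2) (ltW B0)) lb.
apply: le_trans (lb _ _ _) _.
- by have /andP[] := s01.
- by move=> z /cradii_polydisc /polydisc_sub; exact: DB.
- move=> z zD sq; apply/ltW/dA; first exact/polydisc_sub/cradii_polydisc.
  move=> i; rewrite mxE; case: eqVneq => [->|_]; last by rewrite subrr Normc.normc0.
  have [y0 /andP[x0 x1]] := zD j; move: sq; rewrite /q /s.
  have -> : z 0 j = (complex.Re (z 0 j))%:C by case: (z 0 j) y0 => x y /= ->.
  rewrite -(rmorphB (real_complex R) _ 1) !normc_real; set x := complex.Re _ in x0 x1 *.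
  by rewrite (ger0_norm x0) ltr0_norm ?subr_lt0// => sq; nra.
- have := ler_wpM2l (ltW B0) sk.
  have -> : B * (e / 2 / B * moment k) = e / 2 * moment k by field; rewrite gt_eqF.
  by move=> h; lra.
Qed.

End Limit.

End FourierCoefficients.

(** * Fourier components restricted to a face *)

Section FourierProjection.
Context (R : realType) (n : nat) (mu_ : 'I_n -> probability R R)
  (mu : probability (n.-tuple R) R) (sigma theta : probability 'rV[R[i]]_n R).
Hypotheses (mu_product : is_product_measure mu_ mu)
  (mu_radial : forall j, radial_probability (mu_ j))
  (sigma_haar : is_torus_haar sigma) (theta_polar : is_polar_measure mu sigma theta).
Local Notation Cn := 'rV[R[i]]_n.
Local Notation M := (radial_measure mu).
Local Notation rad := (@cradii R n).
Local Notation one := (const_mx 1 : Cn).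
Variable F : Cn -> R[i].
Hypothesis cF : continuous F.
Variables (a b : 'I_n -> nat).

Let mu_radii : mu radii = 1%E := product_radii mu_product mu_radial.
Let Mrad : carried_by M rad := radial_carried mu_radii.
Let mrad : measurable rad := @measurable_cradii R n.

(** The component of [F] of frequency [a - b]. It is kept as a function of [z], transforming by
    [character a b] under rotation, rather than as a number for each radius. *)
Definition fourier : Cn -> R[i] :=
  weighted_average sigma (fun xi => (character a b xi)^*) F.

Let cchar : continuous (fun xi : Cn => (character a b xi)^*) :=
  conjc_continuous (@character_continuous R n a b).

Lemma fourier_continuous : continuous fourier.
Proof. exact: (weighted_average_continuous sigma_haar cchar cF). Qed.

Lemma fourier_rotate xi z : torus xi ->
  fourier (rotate xi z) = character a b xi * fourier z.
Proof.
move=> xiT; rewrite /fourier /weighted_average.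
pose K zeta := (character a b zeta)^* * F (rotate zeta z).
have cK : continuous K.
  exact: (mulc_continuous cchar (comp_continuous cF (@rotate_continuousl R n z))).
rewrite -/(Cintegral sigma torus K) -(Cintegral_torus_rotate sigma_haar xiT cK).
rewrite -CintegralZ; last 2 first.
- exact: measurable_torus.
- apply: (continuous_cintegrable (torus_carried sigma_haar)).
  exact: (comp_continuous cK (@rotate_continuous R n xi)).
apply: eq_Cintegral => zeta _; rewrite /K character_rotate conjcM !mulrA.
by rewrite character_conj// mul1r rotateA [rotate zeta xi]rotateC.
Qed.

Variable j : 'I_n.

(** Frequency [j] is exempt: in the products with [z_j^k] it is shifted by [k], so its sign leaves
    no trace on the face [z_j = 1]. *)
Definition no_negative := [forall i, (i != j) ==> (b i <= a i)%N].

(** The only monomial with the frequencies of [fourier] in the directions other than [j]. At [j] the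
    truncated difference is harmless, because [set_coord1] makes that coordinate 1. *)
Definition analytic_term (z : Cn) : R[i] :=
  if no_negative then monomial (fun i => a i - b i)%N (set_coord1 j z) else 0.

Lemma analytic_term_continuous : continuous analytic_term.
Proof.
rewrite /analytic_term; case: no_negative; last exact: cstc_continuous.
exact: (comp_continuous (@monomial_continuous R n _) (@set_coord1_continuous R n j)).
Qed.

Lemma analytic_term_rotate xi z : torus xi ->
  analytic_term (rotate xi z) = character a b (set_coord1 j xi) * analytic_term z.
Proof.
move=> xiT; rewrite /analytic_term; case: ifP => [/forallP ba|_]; last by rewrite mulr0.
rewrite set_coord1_rotate monomial_rotate character_sub//; first exact: set_coord1_torus.
by move=> i; rewrite mxE; have := ba i; case: eqVneq => //= _; rewrite ?eqxx ?orbT// => ->.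
Qed.

(** The part of the Fourier component on the face that ought to be zero; with the right [c] it is
    orthogonal to [analytic_term]. *)
Definition defect c (z : Cn) : R[i] := fourier (set_coord1 j z) - c * analytic_term z.

Lemma defect_continuous c : continuous (defect c).
Proof.
exact: (subc_continuous
  (comp_continuous fourier_continuous (@set_coord1_continuous R n j))
  (mulc_continuous (@cstc_continuous R n c) analytic_term_continuous)).
Qed.

Lemma defect_rotate c xi z : torus xi ->
  defect c (rotate xi z) = character a b (set_coord1 j xi) * defect c z.
Proof.
move=> xiT; rewrite /defect set_coord1_rotate fourier_rotate; last exact: set_coord1_torus.
by rewrite analytic_term_rotate// mulrBr mulrCA.
Qed.

Lemma defect_set_coord1 c z : defect c (set_coord1 j z) = defect c z.
Proof. by rewrite /defect /analytic_term set_coord1_id. Qed.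

Lemma ae_radial_at_one (G : Cn -> R[i]) : continuous G ->
  {ae M, forall z, rad z -> G z = 0} -> G one = 0.
Proof.
move=> cG; apply: (ae_eq0_at Mrad cG) => d d0.
exact: (radial_box1_gt0 mu_product mu_radial).
Qed.

Let cint (G : Cn -> R[i]) (cG : continuous G) : cintegrable M rad G :=
  continuous_cintegrable Mrad cG.

Lemma ae_radial_normc (G : Cn -> R[i]) : continuous G ->
  Cintegral M rad (fun z => G z * (G z)^*) = 0 -> {ae M, forall z, rad z -> G z = 0}.
Proof.
move=> cG; have cn := exp_continuous_real (k := 2) (normc_continuous cG).
have -> : Cintegral M rad (fun z => G z * (G z)^*) =
    Cintegral M rad (fun z => (normc (G z) ^+ 2)%:C).
  by apply: eq_Cintegral => z _; rewrite mul_conj_normc.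
rewrite Cintegral_real => /complexI /(Rintegral_eq0_ae Mrad cn) [].
  by move=> z _; rewrite exprn_ge0// normc_ge0.
move=> N [mN N0 sN]; exists N; split=> // z zD; apply: sN => /= h; apply: zD => /= rz.
by have /eqP := h rz; rewrite expf_eq0/= normc_eq0 => /eqP.
Qed.

(** [c] is the coefficient of the orthogonal projection onto [analytic_term]. The denominator is
    nonzero because that function takes the value 1 at the corner, a point of the support; if
    [analytic_term] is zero, any [c] will do. *)
Lemma defect_orthogonal : exists c,
  Cintegral M rad (fun z => analytic_term z * (defect c z)^*) = 0.
Proof.
have cB := analytic_term_continuous.
have cBB := mulc_continuous cB (conjc_continuous cB).
pose A z := fourier (set_coord1 j z).
have cA : continuous A.
  exact: (comp_continuous fourier_continuous (@set_coord1_continuous R n j)).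
have cAB := mulc_continuous cA (conjc_continuous cB).
case: (boolP no_negative) => nn; last first.
  exists 0; rewrite (_ : (fun z => _) = fun=> 0) ?Cintegral0//.
  by apply/funext => z; rewrite /analytic_term (negPf nn) mul0r.
pose I := Cintegral M rad (fun z => analytic_term z * (analytic_term z)^*).
have I0 : I != 0.
  apply/eqP => /(ae_radial_normc cB) /(ae_radial_at_one cB).
  rewrite /analytic_term nn set_coord1_one monomial_one => /eqP.
  by rewrite oner_eq0.
pose c := Cintegral M rad (fun z => A z * (analytic_term z)^*) / I.
exists c; have cD := @defect_continuous c.
have cDB := mulc_continuous cD (conjc_continuous cB).
rewrite -[LHS]conjc2 -Cintegral_conj; last 2 first.
- exact: mrad.
- exact: (cint (mulc_continuous cB (conjc_continuous cD))).
rewrite (_ : Cintegral _ _ _ = 0) ?conjc_zero//.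
transitivity (Cintegral M rad (fun z => A z * (analytic_term z)^* -
    c * (analytic_term z * (analytic_term z)^*))).
  apply: eq_Cintegral => z _; rewrite conjcM conjc2 mulrC /defect.
  by rewrite mulrBl mulrA.
rewrite CintegralB//; last 2 first.
- exact: (cint cAB).
- exact: cintegrableZ (cint cBB).
rewrite CintegralZ//; last exact: (cint cBB).
by rewrite -/I /c divfK// subrr.
Qed.

(** Rotating one coordinate kills the integral unless [g] has the frequencies of
    [z_j^(k + a j) * defect c z]. In that single case the integrand is a power of [|z_j|] times a
    function on the face, and independence of the radii leaves the integral [perp], which is 0. *)
Lemma defect_perp_monomial c : 
  Cintegral M rad (fun z => analytic_term z * (defect c z)^*) = 0 ->
  forall (g : 'I_n -> nat) k, Cintegral theta polydisc
    (fun z => monomial g z * (z 0 j ^+ (k + a j) * defect c z)^*) = 0.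
Proof.
move=> perp g k.
have cD := @defect_continuous c.
have cz := expc_continuous (k := k + a j) (@coord_vec_continuous R n j).
have cG := mulc_continuous (@monomial_continuous R n g)
  (conjc_continuous (mulc_continuous cz cD)).
pose G z := monomial g z * (z 0 j ^+ (k + a j) * defect c z)^*.
have GE xi z : torus xi -> G (rotate xi z) =
    monomial g xi * (xi 0 j ^+ (k + a j))^* * (character a b (set_coord1 j xi))^* * G z.
  move=> xiT; rewrite /G monomial_rotate defect_rotate// mxE exprMn !conjcM.
  by ring.
(* Equality of frequencies, written additively so that no subtraction of exponents can truncate. *)
have [[i pi]|] := pselect (exists i, g i + (if i == j then 0 else b i) !=
    (if i == j then k + a j else a i))%N.
  have [x x1 xpq] := unit_separates R pi.
  pose xi : Cn := coord_point i x; have xiT : torus xi by exact: torus_coord_point.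
  apply: (Cintegral_homogeneous0 mu_product mu_radial sigma_haar theta_polar
    xiT _ cG (fun z => GE xi z xiT)).
  rewrite monomial_coord_point.
  have xx : x * x^* = 1 by rewrite mul_conj_normc x1 expr1n.
  have xxe m : x ^+ m * x^* ^+ m = 1 by rewrite -exprMn xx expr1n.
  have x0 : x != 0 by rewrite -normc_eq0 x1 oner_eq0.
  move: xpq; have [ij|ij] := eqVneq i j.
    rewrite addn0 => xpq.
    have -> : set_coord1 j xi = one.
      by apply/rowP => l; rewrite !mxE ij; case: ifP => // ->.
    rewrite character_one conjc_one mulr1 /xi mxE ij eqxx conjcX.
    apply: contra xpq => /eqP h; apply/eqP.
    by rewrite ij -[LHS]mulr1 -(xxe (k + a j)%N) [x ^+ (k + a j) * _]mulrC mulrA h mul1r.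
  move=> xpq.
  have -> : set_coord1 j xi = xi.
    apply/rowP => l; rewrite !mxE; case: eqVneq => // ->.
    by rewrite eq_sym (negPf ij).
  have -> : xi 0 j = 1 by rewrite mxE eq_sym (negPf ij).
  rewrite expr1n conjc_one mulr1.
  rewrite /character !monomial_coord_point conjcM conjc2 conjcX.
  apply: contra xpq => /eqP h; apply/eqP.
  rewrite -[RHS]mul1r -h exprD -!mulrA; congr (_ * _).
  by rewrite mulrCA [x^* ^+ _ * _]mulrC xxe mulr1.
move=> gab.
have gE i : (g i + (if i == j then 0 else b i) = (if i == j then k + a j else a i))%N.
  by apply/eqP; apply: contrapT => /negP h; apply: gab; exists i.
have nn : no_negative.
  apply/forallP => i; apply/implyP => ij; have := gE i; rewrite (negPf ij) => <-.
  by rewrite leq_addl.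
pose H z := analytic_term z * (defect c z)^*.
have cH : continuous H.
  exact: (mulc_continuous analytic_term_continuous (conjc_continuous cD)).
(* All frequencies match, so the monomial is [z_j^(k + a j)] times [analytic_term], and the powers
   of [z_j] combine into a modulus. *)
have HG z : G z = (normc (z 0 j) ^+ (2 * (k + a j)))%:C * H (set_coord1 j z).
  rewrite /G /H defect_set_coord1 conjcM /analytic_term nn set_coord1_id.
  have -> : monomial g z = z 0 j ^+ (k + a j) *
      monomial (fun i => a i - b i)%N (set_coord1 j z).
    rewrite /monomial (bigD1 j)//= [in RHS](bigD1 j)//= mxE eqxx expr1n mul1r.
    have := gE j; rewrite eqxx addn0 => ->; congr (_ * _).
    apply: eq_bigr => i ij; rewrite mxE (negPf ij); have := gE i.
    by rewrite (negPf ij) => <-; rewrite addnK.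
  rewrite mulrACA mul_conj_normc normcX -exprM mulnC; congr (_ * _).
rewrite (_ : (fun z => _) = (fun z : Cn => (normc (z 0 j) ^+ (2 * (k + a j)))%:C *
    H (set_coord1 j z))); last by apply/funext => z; rewrite -HG.
have HR xi z : torus xi -> H (set_coord1 j (rotate xi z)) = H (set_coord1 j z).
  move=> xiT; have sT := set_coord1_torus j xiT.
  rewrite set_coord1_rotate /H (analytic_term_rotate _ sT) (defect_rotate c _ sT) conjcM.
  by rewrite mulrACA set_coord1_id character_conj// mul1r.
pose K (z : Cn) := (normc (z 0 j) ^+ (2 * (k + a j)))%:C * H (set_coord1 j z).
have cK : continuous K := eq_continuous_vec HG cG.
have KR xi z : torus xi -> K (rotate xi z) = K z.
  move=> xiT; rewrite /K HR// mxE Normc.normcM; have /torusP -> := xiT.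
  by rewrite mul1r.
rewrite -/K (Cintegral_invariant mu_product mu_radial sigma_haar theta_polar cK KR).
rewrite (Cintegral_radial_indep mu_product mu_radial j _ cH).
have -> : Cintegral M rad (fun z => H (set_coord1 j z)) = 0; last by rewrite mulr0.
by rewrite -[RHS]perp; apply: eq_Cintegral => z _;
  rewrite /H defect_set_coord1 /analytic_term set_coord1_id.
Qed.

End FourierProjection.

(** * Compactness of the Hankel operator *)

Section SquareIntegrable.
Context (R : realType) (n : nat) (theta : probability 'rV[R[i]]_n R).
Local Notation Cn := 'rV[R[i]]_n.
Hypothesis theta_polydisc : carried_by theta polydisc.
Implicit Types u v w G : Cn -> R[i].

Let mD : measurable (polydisc : set Cn) := @measurable_polydisc R n.

Lemma normc_sqrE (x : R[i]) : normc x ^+ 2 = complex.Re x ^+ 2 + complex.Im x ^+ 2.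
Proof. by case: x => a b /=; rewrite sqr_sqrtr// addr_ge0// sqr_ge0. Qed.

Lemma measurable_normc_sqr u :
  measurable_fun polydisc (fun z => complex.Re (u z)) ->
  measurable_fun polydisc (fun z => complex.Im (u z)) ->
  measurable_fun polydisc (fun z => normc (u z) ^+ 2).
Proof.
move=> mr mi; under eq_fun do rewrite normc_sqrE.
by apply: measurable_funD; exact: measurable_funX.
Qed.

Lemma inL2_integrable u : inL2 theta u ->
  theta.-integrable polydisc (fun z => (normc (u z) ^+ 2)%:E).
Proof.
move=> [mr mi uoo]; apply/integrableP; split.
  by apply/measurable_EFinP; exact: measurable_normc_sqr.
apply: le_lt_trans uoo; rewrite le_eqVlt; apply/orP; left; apply/eqP.
by apply: eq_integral => z _; rewrite gee0_abs// lee_fin exprn_ge0// normc_ge0.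
Qed.

Definition normL2sq u : R := \int[theta]_(z in polydisc) normc (u z) ^+ 2.

Lemma sqnormL2E u : inL2 theta u -> sqnormL2 theta u = (normL2sq u)%:E.
Proof.
move=> /inL2_integrable iu; rewrite /normL2sq /Rintegral fineK//.
exact: integrable_fin_num.
Qed.

Lemma inL2_le u (phi : Cn -> R) :
  measurable_fun polydisc (fun z => complex.Re (u z)) ->
  measurable_fun polydisc (fun z => complex.Im (u z)) ->
  theta.-integrable polydisc (fun z => (phi z)%:E) ->
  (forall z, polydisc z -> normc (u z) ^+ 2 <= phi z) -> inL2 theta u.
Proof.
move=> mr mi iphi uphi; split=> //.
have mphi := measurable_int _ iphi.
have mu2 : measurable_fun polydisc (fun z => (normc (u z) ^+ 2)%:E).
  by apply/measurable_EFinP; exact: measurable_normc_sqr.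
apply: (@le_lt_trans _ _ (\int[theta]_(z in polydisc) `|(phi z)%:E|)%E); last first.
  by have /integrableP[] := iphi.
apply: ge0_le_integral => //.
- by move=> z _; rewrite lee_fin exprn_ge0// normc_ge0.
- exact: measurableT_comp.
- by move=> z zD; rewrite lee_fin (le_trans (uphi _ zD))// ler_norm.
Qed.

Lemma inL2B u v : inL2 theta u -> inL2 theta v -> inL2 theta (u \- v).
Proof.
move=> uL vL; have [ur ui _] := uL; have [vr vi _] := vL.
have iu := inL2_integrable uL; have iv := inL2_integrable vL.
apply: (@inL2_le _ (fun z => 2 * normc (u z) ^+ 2 + 2 * normc (v z) ^+ 2)).
- by under eq_fun do rewrite /= raddfB; exact: measurable_funB.
- by under eq_fun do rewrite /= raddfB; exact: measurable_funB.
- under eq_fun do rewrite EFinD.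
  by apply: integrableD => //; exact: integrableZl_real.
- move=> z _ /=.
  have h : normc (u z - v z) ^+ 2 <= (normc (u z) + normc (v z)) ^+ 2.
    by rewrite lerXn2r ?nnegrE ?addr_ge0 ?normc_ge0// le_normcB.
  apply: le_trans h _; rewrite -subr_ge0.
  rewrite (_ : _ - _ = (normc (u z) - normc (v z)) ^+ 2) ?sqr_ge0//; ring.
Qed.

Lemma continuous_inL2 G : continuous G -> inL2 theta G.
Proof.
move=> cG; apply: (@inL2_le _ (fun z => normc (G z) ^+ 2)) => //.
- exact: continuous_measurable_vec (Re_continuous cG) mD.
- exact: continuous_measurable_vec (Im_continuous cG) mD.
- exact: (continuous_integrable theta_polydisc
    (exp_continuous_real (k := 2) (normc_continuous cG))).
Qed.

Lemma inL2_measurable_pair u w : inL2 theta u -> inL2 theta w ->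
  measurable_fun polydisc (fun z => complex.Re (u z * (w z)^*)) /\
  measurable_fun polydisc (fun z => complex.Im (u z * (w z)^*)).
Proof.
move=> [ur ui _] [wr wi _].
have JE z : (w z)^* = complex.Re (w z) -i* complex.Im (w z) by case: (w z).
split.
  under eq_fun do rewrite ReM JE /= mulrN opprK.
  by apply: measurable_funD; exact: measurable_funM.
under eq_fun do rewrite ImM JE /= mulrN addrC.
by apply: measurable_funB; exact: measurable_funM.
Qed.

Lemma young (x y t : R) : 0 < t -> x * y <= t * x ^+ 2 + y ^+ 2 / t.
Proof.
move=> t0; rewrite -(ler_pM2r t0) mulrDl divfK ?gt_eqF//.
by have := sqr_ge0 (t * x - y); have := sqr_ge0 (t * x); have := sqr_ge0 y; nra.
Qed.

Lemma cintegrable_pair u w : inL2 theta u -> inL2 theta w ->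
  cintegrable theta polydisc (fun z => u z * (w z)^*).
Proof.
move=> uL wL; have [mr mi] := inL2_measurable_pair uL wL.
have iu := inL2_integrable uL; have iw := inL2_integrable wL.
apply: (@cintegrable_le _ _ _ theta _ mD _
  (fun z => normc (u z) ^+ 2 + normc (w z) ^+ 2)) => //.
  by under eq_fun do rewrite EFinD; exact: integrableD.
move=> z _; rewrite Normc.normcM normc_conj.
by have := young (normc (u z)) (normc (w z)) ltr01; rewrite mul1r divr1.
Qed.

(** Young's inequality under the integral, in the role of Cauchy-Schwarz: the free parameter [t]
    shifts the weight to whichever factor is small. *)
Lemma innerL2_le u w t : inL2 theta u -> inL2 theta w -> 0 < t ->
  normc (innerL2 theta u w) <= t * normL2sq u + normL2sq w / t.
Proof.
move=> uL wL t0; have iu := inL2_integrable uL; have iw := inL2_integrable wL.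
have iut : theta.-integrable polydisc (fun z => (t * normc (u z) ^+ 2)%:E).
  exact: integrableZl_real.
have iwt : theta.-integrable polydisc (fun z => (t^-1 * normc (w z) ^+ 2)%:E).
  exact: integrableZl_real.
have -> : t * normL2sq u + normL2sq w / t = \int[theta]_(z in polydisc)
    (t * normc (u z) ^+ 2 + t^-1 * normc (w z) ^+ 2).
  by rewrite RintegralD// !RintegralZl// [_ / t]mulrC.
apply: normc_Cintegral_le => //; first exact: cintegrable_pair.
  by under eq_fun do rewrite EFinD; exact: integrableD.
move=> z _; rewrite Normc.normcM normc_conj.
by have := young (normc (u z)) (normc (w z)) t0; rewrite [_ / t]mulrC.
Qed.

Lemma normL2sq_ge0 u : 0 <= normL2sq u.
Proof. by apply: Rintegral_ge0 => z _; rewrite exprn_ge0// normc_ge0. Qed.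

Lemma innerL2Bl u v w : inL2 theta u -> inL2 theta v -> inL2 theta w ->
  innerL2 theta (u \- v) w = innerL2 theta u w - innerL2 theta v w.
Proof.
move=> uL vL wL; rewrite /innerL2 -CintegralB//; try exact: cintegrable_pair.
by apply: eq_Cintegral => z _; rewrite /= mulrBl.
Qed.

Lemma eqL2_innerL2 u v w : inL2 theta u -> inL2 theta v -> inL2 theta w ->
  eqL2 theta u v -> innerL2 theta u w = innerL2 theta v w.
Proof.
move=> uL vL wL uv.
have [mru miu] := inL2_measurable_pair uL wL.
have [mrv miv] := inL2_measurable_pair vL wL.
congr (_ +i* _); congr fine; apply: ae_eq_integral => //; try exact/measurable_EFinP.
  by apply: filterS uv => z uvz zD; rewrite uvz.
by apply: filterS uv => z uvz zD; rewrite uvz.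
Qed.

Lemma polyfunE p (z : Cn) : polyfun p z =
  \sum_(m <- mpoly.msupp p) mpoly.mcoeff m p * monomial (fun i => mpoly.fun_of_multinom m i) z.
Proof.
exact: mpoly.mevalE.
Qed.

Lemma polyfun_continuous p : continuous (@polyfun R n p).
Proof.
have -> : polyfun p = fun z => \sum_(m <- mpoly.msupp p)
    mpoly.mcoeff m p * monomial (fun i => mpoly.fun_of_multinom m i) z.
  by apply/funext => z; exact: polyfunE.
apply: sumc_continuous => m.
exact: (mulc_continuous (@cstc_continuous R n _) (@monomial_continuous R n _)).
Qed.

Lemma polyfun_bergman p : bergman theta (polyfun p).
Proof.
split; first exact: (continuous_inL2 (@polyfun_continuous p)).
move=> e e0; exists p; rewrite (_ : sqnormL2 _ _ = 0%E) ?lte_fin ?exprn_gt0//.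
rewrite /sqnormL2 (eq_integral (cst 0%E)) ?integral0// => z _.
by rewrite /= subrr Normc.normc0 expr0n.
Qed.

Lemma innerL2_monomials_perp w : continuous w ->
  (forall g : 'I_n -> nat, Cintegral theta polydisc (fun z => monomial g z * (w z)^*) = 0) ->
  forall u, bergman theta u -> innerL2 theta u w = 0.
Proof.
move=> cw wperp; have wL := continuous_inL2 cw.
have wpoly p : innerL2 theta (polyfun p) w = 0.
  rewrite /innerL2; transitivity (Cintegral theta polydisc (fun z =>
      \sum_(m <- mpoly.msupp p) mpoly.mcoeff m p *
        (monomial (fun i => mpoly.fun_of_multinom m i) z * (w z)^*))).
    apply: eq_Cintegral => z _; rewrite polyfunE mulr_suml.
    by apply: eq_bigr => m _; rewrite mulrA.
  have im m : cintegrable theta polydisc (fun z =>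
      monomial (fun i => mpoly.fun_of_multinom m i) z * (w z)^*).
    apply: (continuous_cintegrable theta_polydisc).
    exact: (mulc_continuous (@monomial_continuous R n _) (conjc_continuous cw)).
  rewrite Cintegral_sum//; last by move=> m; exact: cintegrableZ.
  by apply: big1 => m _; rewrite CintegralZ// wperp mulr0.
move=> u [uL uP]; apply/eqP; rewrite -normc_eq0 eq_le normc_ge0 andbT.
apply/ler_addgt0Pr => e e0; rewrite add0r.
pose C := 1 + normL2sq w; have C0 : 0 < C by rewrite ltr_pwDl// normL2sq_ge0.
have eC0 : 0 < e / C by rewrite divr_gt0.
have [p pu] := uP _ eC0.
have pL : inL2 theta (polyfun p) := continuous_inL2 (@polyfun_continuous p).
have upL := inL2B uL pL.
have -> : innerL2 theta u w = innerL2 theta (u \- polyfun p) w.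
  by rewrite innerL2Bl// wpoly subr0.
(* With [t = C / e] the two terms of [innerL2_le] are at most [e / C] and [(C - 1) * e / C], which
   add up to [e]. *)
have t0 : 0 < C / e by rewrite divr_gt0.
apply: (le_trans (innerL2_le upL wL t0)).
move: pu; rewrite sqnormL2E// lte_fin => pu.
have eE : (C / e) * (e / C) ^+ 2 + normL2sq w / (C / e) = e.
  have C1 : normL2sq w = C - 1 by rewrite /C addrC addKr.
  by rewrite C1; field; rewrite !gt_eqF.
by rewrite -[leRHS]eE lerD2r ler_wpM2l ?(ltW t0)// ltW.
Qed.

End SquareIntegrable.

Section CompactHankel.
Context (R : realType) (n : nat) (mu_ : 'I_n -> probability R R)
  (mu : probability (n.-tuple R) R) (sigma theta : probability 'rV[R[i]]_n R).
Hypotheses (mu_product : is_product_measure mu_ mu)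
  (mu_radial : forall j, radial_probability (mu_ j))
  (sigma_haar : is_torus_haar sigma) (theta_polar : is_polar_measure mu sigma theta).
Local Notation Cn := 'rV[R[i]]_n.
Local Notation M := (radial_measure mu).
Local Notation rad := (@cradii R n).
Variables (F f : Cn -> R[i]).
Hypotheses (cF : continuous F) (fF : forall z, polydisc z -> f z = F z).

Let mu_radii : mu radii = 1%E := product_radii mu_product mu_radial.
Let Mrad : carried_by M rad := radial_carried mu_radii.
Let thD : carried_by theta polydisc := polydisc_carried theta_polar.
Let mD : measurable (polydisc : set Cn) := @measurable_polydisc R n.

Section Direction.
Variable j : 'I_n.
Local Notation moment := (moment mu j).
Let moment0 k : 0 < moment k := moment_gt0 mu_product mu_radial j k.

Definition scale k : R := (Num.sqrt (moment k))^-1.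

Lemma scale_sqr k : scale k ^+ 2 = (moment k)^-1.
Proof. by rewrite exprVn sqr_sqrtr// ltW. Qed.

(** The normalisation uses [moment k] whatever the shift [e]: two families with different shifts
    will be paired, and their common factor must be exactly the inverse of [moment k]. Norms stay
    bounded because [|z_j| < 1]. *)
Definition peak e k (v : Cn -> R[i]) (z : Cn) : R[i] :=
  (scale k)%:C * (z 0 j ^+ (k + e) * v z).

Lemma peak_continuous e k v : continuous v -> continuous (peak e k v).
Proof.
move=> cv; have cz := expc_continuous (k := k + e) (@coord_vec_continuous R n j).
exact: (mulc_continuous (@cstc_continuous R n _) (mulc_continuous cz cv)).
Qed.

Lemma normc_peak_le e k v B z : polydisc z -> normc (v z) <= B ->
  normc (peak e k v z) ^+ 2 <= B ^+ 2 * ((normc (z 0 j) ^+ 2) ^+ k / moment k).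
Proof.
move=> /polydiscP /(_ j) zj vB; rewrite !Normc.normcM normc_real normcX.
have v0 := normc_ge0 (v z); have z0 := normc_ge0 (z 0 j).
set x := normc _ in z0 zj *; set y := normc _ in v0 vB *.
have -> : (`|scale k| * (x ^+ (k + e) * y)) ^+ 2 =
    (x ^+ e * y) ^+ 2 * ((x ^+ 2) ^+ k / moment k).
  by rewrite exprMn real_normK ?num_real// scale_sqr exprD [(x ^+ 2) ^+ k]exprAC; ring.
rewrite ler_wpM2r//.
  by rewrite mulr_ge0 ?exprn_ge0// invr_ge0 ltW.
have xy0 : 0 <= x ^+ e * y by rewrite mulr_ge0// exprn_ge0.
rewrite lerXn2r// ?nnegrE//; first exact: le_trans v0 vB.
by apply: le_trans vB; rewrite ler_piMl// exprn_ile1// ltW.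
Qed.

Lemma Rintegral_moment k :
  \int[theta]_(z in polydisc) (normc (z 0 j) ^+ 2) ^+ k = moment k.
Proof.
have := Cintegral_moment mu_product mu_radial sigma_haar theta_polar j k.
by rewrite Cintegral_real => /complexI.
Qed.

Lemma integrable_qk k :
  theta.-integrable polydisc (fun z : Cn => ((normc (z 0 j) ^+ 2) ^+ k)%:E).
Proof.
apply: (continuous_integrable thD).
exact: (exp_continuous_real (exp_continuous_real (@normc_coord_continuous R n j))).
Qed.

Lemma normL2sq_peak e k v B : continuous v ->
  (forall z, cpolydisc 1 z -> normc (v z) <= B) ->
  normL2sq theta (peak e k v) <= B ^+ 2.
Proof.
move=> cv vB; have pL := continuous_inL2 thD (peak_continuous (e := e) (k := k) cv).
have iq : theta.-integrable polydisc (fun z : Cn =>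
    ((B ^+ 2 / moment k) * (normc (z 0 j) ^+ 2) ^+ k)%:E).
  by apply: integrableZl_real => //; exact: integrable_qk.
apply: (@le_trans _ _ (\int[theta]_(z in polydisc)
    ((B ^+ 2 / moment k) * (normc (z 0 j) ^+ 2) ^+ k))).
  apply: le_Rintegral => //; first exact: (inL2_integrable pL).
  move=> z zD; rewrite -mulrA [_^-1 * _]mulrC; apply: normc_peak_le => //.
  exact/vB/polydisc_sub.
by rewrite RintegralZl ?Rintegral_moment ?divfK// ?gt_eqF//; exact: integrable_qk.
Qed.

(** Every point of the open polydisc leaves the sets [s < |z_j|^2] as [s] increases to 1; dominated
    convergence applies. *)
Lemma inL2_tail u eta : inL2 theta u -> 0 < eta -> exists2 s : R, 0 <= s < 1 &
  \int[theta]_(z in polydisc)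
    (normc (u z) ^+ 2 * \1_[set z : Cn | s < normc (z 0 j) ^+ 2] z) < eta.
Proof.
move=> uL eta0; have iu := inL2_integrable uL; have [ur ui _] := uL.
pose s (m : nat) : R := 1 - m.+1%:R^-1.
pose S m := [set z : Cn | s m < normc (z 0 j) ^+ 2].
have cq := exp_continuous_real (k := 2) (@normc_coord_continuous R n j).
have mS m : measurable (S m) by exact: measurable_lt_vec.
have mf m : measurable_fun polydisc (fun z => normc (u z) ^+ 2 * (\1_(S m) z : R)).
  apply: measurable_funM; first exact: measurable_normc_sqr.
  exact: measurable_indic.
have [||||| _ _] := @dominated_convergence _ _ R theta polydisc mD
    (fun m z => (normc (u z) ^+ 2 * \1_(S m) z)%:E) (cst 0%E)
    (fun z => (normc (u z) ^+ 2)%:E).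
- by move=> m; exact/measurable_EFinP.
- exact: measurable_cst.
- apply/aeW => z /polydiscP /(_ j) zj.
  have z1 : 0 < 1 - normc (z 0 j) ^+ 2 by rewrite subr_gt0 exprn_ilt1 ?normc_ge0.
  apply: cvg_near_cst; exists (Num.truncn (1 - normc (z 0 j) ^+ 2)^-1) => // m /= zm.
  rewrite indicE memNset ?mulr0//= => /ltW sm; move: (sm); rewrite leNgt => /negP; apply.
  rewrite /s ltrBrDl -ltrBrDr -[ltRHS]invrK ltf_pV2 ?posrE ?invr_gt0 ?ltr0n//.
  apply: lt_le_trans (truncnS_gt _) _.
  by rewrite ler_nat.
- exact: iu.
- apply/aeW => z m _; rewrite /= lee_fin indicE.
  rewrite ger0_norm ?mulr_ge0 ?exprn_ge0 ?normc_ge0//.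
  by rewrite ler_piMr ?exprn_ge0 ?normc_ge0//; case: (_ \in _).
rewrite integral_cst// mul0e => /fine_cvgP [_].
move=> /cvgr0Pnorm_lt /(_ eta eta0) [m _ mP]; exists (s m).
  by rewrite /s subr_ge0 invf_le1 ?ler1n ?ltr0n//= ltrBlDr ltrDl invr_gt0 ltr0n.
exact: le_lt_trans (ler_norm _) (mP m (leqnn m)).
Qed.

(** Near [|z_j| = 1] the fixed function [u] has little mass while the peaks are bounded in norm;
    where [|z_j|^2 <= s] the peaks are uniformly small, since [s ^+ k] is negligible against
    [moment k]. *)
Lemma peak_weakly_null e v u eta : continuous v -> inL2 theta u -> 0 < eta ->
  exists N, forall k, (N <= k)%N ->
    normc (innerL2 theta u (peak e k v)) <= eta.
Proof.
move=> cv uL eta0; have iu := inL2_integrable uL; have [ur ui _] := uL.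
have [B B0 vB] := compact_normc_bounded (@compact_cpolydisc R n 1) cv.
have e4 : 0 < eta / 4 by rewrite divr_gt0.
have B2 : 0 < B ^+ 2 by rewrite exprn_gt0.
(* Young's inequality is applied with [t] near [|z_j| = 1] and with [t'] elsewhere. The parameter
   [t] brings the peak term down to [eta / 4], after which [s] makes the tail of [u] small relative
   to [t]; [t'] does the same for the full norm of [u], the added 1 keeping the denominator
   positive. *)
pose t := B ^+ 2 / (eta / 4); have t0 : 0 < t by rewrite divr_gt0.
have [s s01 us] := inL2_tail uL (divr_gt0 e4 t0).
have U0 := normL2sq_ge0 theta u.
pose t' := eta / 4 / (1 + normL2sq theta u).
have U1 : 0 < 1 + normL2sq theta u by rewrite ltr_pwDl.
have t'0 : 0 < t' by rewrite divr_gt0.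
have et' : 0 < eta / 4 * t' / B ^+ 2 by rewrite divr_gt0// mulr_gt0.
have [N NP] := moment_small mu_product mu_radial j s01 et'.
exists N => k /NP sk.
have cp := peak_continuous (e := e) (k := k) cv.
have pL := continuous_inL2 thD cp; have ip := inL2_integrable pL.
pose S := [set z : Cn | s < normc (z 0 j) ^+ 2].
have mS : measurable S.
  apply: measurable_lt_vec.
  exact: (exp_continuous_real (@normc_coord_continuous R n j)).
have iS : theta.-integrable polydisc (fun z => (normc (u z) ^+ 2 * \1_S z)%:E).
  apply: (le_integrable mD _ _ iu).
    apply/measurable_EFinP/measurable_funM; first exact: measurable_normc_sqr.
    exact: measurable_indic.
  move=> z _; rewrite /= lee_fin indicE normrM ler_piMr//.
  by case: (_ \in _); rewrite ?normr1 ?normr0.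
have i1 : theta.-integrable polydisc (fun z => (t * (normc (u z) ^+ 2 * \1_S z))%:E).
  exact: integrableZl_real.
have i2 : theta.-integrable polydisc (fun z => (t^-1 * normc (peak e k v z) ^+ 2)%:E).
  exact: integrableZl_real.
have i3 : theta.-integrable polydisc (fun z => (t' * normc (u z) ^+ 2)%:E).
  exact: integrableZl_real.
(* A uniform bound for the squared peak over [t'] where [|z_j|^2 <= s]. *)
pose r := B ^+ 2 * (s ^+ k / moment k) / t'.
have i4 := integrable_cst1 thD r.
have i12 : theta.-integrable polydisc (fun z =>
    (t * (normc (u z) ^+ 2 * \1_S z) + t^-1 * normc (peak e k v z) ^+ 2)%:E).
  by under eq_fun do rewrite EFinD; exact: integrableD.
have i34 : theta.-integrable polydisc (fun z => (t' * normc (u z) ^+ 2 + r)%:E).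
  by under eq_fun do rewrite EFinD; exact: integrableD.
apply: (@le_trans _ _ (\int[theta]_(z in polydisc)
   ((t * (normc (u z) ^+ 2 * \1_S z) + t^-1 * normc (peak e k v z) ^+ 2) +
    (t' * normc (u z) ^+ 2 + r)))).
  apply: normc_Cintegral_le => //; first exact: (cintegrable_pair uL pL).
    by under eq_fun do rewrite EFinD; exact: integrableD.
  move=> z zD; rewrite Normc.normcM normc_conj.
  set x := normc (u z); set y := normc (peak e k v z).
  have [x0 y0] : 0 <= x /\ 0 <= y by split; exact: normc_ge0.
  have r0 : 0 <= r.
    have [s0 _] := andP s01.
    by rewrite divr_ge0 ?(ltW t'0)// mulr_ge0 ?(ltW B2)// divr_ge0 ?exprn_ge0// ltW.
  rewrite indicE; case: (boolP (z \in S)) => zS.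
    have h1 := young x y t0.
    have h2 : 0 <= t' * x ^+ 2 by rewrite mulr_ge0 ?(ltW t'0)// exprn_ge0.
    by rewrite mulr1; lra.
  rewrite mulr0 mulr0 add0r ler_wpDl ?mulr_ge0 ?invr_ge0 ?exprn_ge0 ?(ltW t0)//.
  apply: (le_trans (young x y t'0)); rewrite lerD2l ler_pM2r ?invr_gt0//.
  apply: le_trans (normc_peak_le (B := B) e k zD _) _; first exact/vB/polydisc_sub.
  rewrite ler_pM2l// ler_pM2r ?invr_gt0// lerXn2r ?nnegrE ?exprn_ge0 ?normc_ge0//.
    by case/andP: s01.
  by move/negP: zS; rewrite inE /S /= leNgt => /negP.
rewrite RintegralD// RintegralD// RintegralD// (Rintegral_cst1 thD) !RintegralZl//.
have h1 : t * \int[theta]_(z in polydisc) (normc (u z) ^+ 2 * \1_S z) <= eta / 4.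
  by rewrite mulrC -ler_pdivlMr// ltW.
have h2 : t^-1 * \int[theta]_(z in polydisc) normc (peak e k v z) ^+ 2 <= eta / 4.
  rewrite ler_pdivrMl//; apply: le_trans (normL2sq_peak e k cv vB) _.
  by rewrite /t divfK// gt_eqF.
have h3 : t' * \int[theta]_(z in polydisc) normc (u z) ^+ 2 <= eta / 4.
  rewrite -/(normL2sq theta u) /t' -[leRHS]mulr1 -mulrA ler_pM2l//.
  by rewrite mulrC ler_pdivrMr// mul1r lerDr.
have h4 : r <= eta / 4.
  rewrite /r ler_pdivrMr// mulrA ler_pdivrMr// -ler_pdivlMl//.
  by rewrite mulrC mulrAC.
by lra.
Qed.

End Direction.

End CompactHankel.

(** * The Hankel operator tested on peaks *)

Section CompactHankelFourier.
Context (R : realType) (n : nat) (mu_ : 'I_n -> probability R R)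
  (mu : probability (n.-tuple R) R) (sigma theta : probability 'rV[R[i]]_n R).
Hypotheses (mu_product : is_product_measure mu_ mu)
  (mu_radial : forall j, radial_probability (mu_ j))
  (sigma_haar : is_torus_haar sigma) (theta_polar : is_polar_measure mu sigma theta).
Local Notation Cn := 'rV[R[i]]_n.
Local Notation M := (radial_measure mu).
Local Notation rad := (@cradii R n).
Local Notation one := (const_mx 1 : Cn).
Variables (P : (Cn -> R[i]) -> Cn -> R[i]) (F f : Cn -> R[i]).
Hypotheses (P_projection : is_bergman_projection theta P)
  (cF : continuous F) (fF : forall z, polydisc z -> f z = F z)
  (Hf_compact : compact_hankel theta P f).

Let mu_radii : mu radii = 1%E := product_radii mu_product mu_radial.
Let Mrad : carried_by M rad := radial_carried mu_radii.
Let thD : carried_by theta polydisc := polydisc_carried theta_polar.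
Let mD : measurable (polydisc : set Cn) := @measurable_polydisc R n.

Lemma inL2_ext u v : (forall z, polydisc z -> u z = v z) ->
  inL2 theta u -> inL2 theta v.
Proof.
move=> uv [ur ui uoo]; split.
- by apply: eq_measurable_fun ur => z /set_mem /uv ->.
- by apply: eq_measurable_fun ui => z /set_mem /uv ->.
- rewrite /sqnormL2 (eq_integral (fun z => (normc (u z) ^+ 2)%:E))//.
  by move=> z /set_mem /uv ->.
Qed.

(** Against a function orthogonal to the Bergman space the projection disappears, and the Hankel
    operator acts as multiplication by [F]. *)
Lemma innerL2_hankel T p w : continuous w ->
  (forall u, bergman theta u -> innerL2 theta u w = 0) ->
  compact_operator theta T -> eqL2 theta (T (polyfun p)) (hankel P f (polyfun p)) ->
  innerL2 theta (T (polyfun p)) w =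
  Cintegral theta polydisc (fun z => F z * polyfun p z * (w z)^*).
Proof.
move=> cw wperp cT Tp; have wL := continuous_inL2 thD cw.
have [TL _] := operator_perp cT (polyfun_bergman thD p).
have FpL := continuous_inL2 thD (mulc_continuous cF (@polyfun_continuous R n p)).
have fpL : inL2 theta (f \* polyfun p).
  by apply: inL2_ext FpL => z /fF /= ->.
have [PB PP] := P_projection fpL; have PL := PB.1.
have hL := inL2B fpL PL.
rewrite (eqL2_innerL2 TL hL wL Tp) (innerL2Bl fpL PL wL) (wperp _ PB) subr0.
by apply: eq_Cintegral => z /set_mem /fF /= ->.
Qed.

Section Direction.
Variable j : 'I_n.
Local Notation moment := (moment mu j).
Let moment0 k : 0 < moment k := moment_gt0 mu_product mu_radial j k.

Lemma strictly_increasing_ge s : strictly_increasing s -> forall k, (k <= s k)%N.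
Proof. by move=> si; elim=> [//|k IH]; exact: leq_ltn_trans IH (si k). Qed.

Definition peak_poly b k : mpoly.mpoly n R[i] :=
  mpoly.mpoly_scale (scale mu j k)%:C
    (mpoly.mpolyX R[i] (mpoly.mnm_muln (mpoly.mnm1 j) (k + b))).

Lemma peak_polyE b k : polyfun (peak_poly b k) = peak mu j b k (fun=> 1).
Proof.
apply/funext => z; rewrite /polyfun /peak mulr1.
transitivity ((scale mu j k)%:C * mpoly.meval (z 0)
    (mpoly.mpolyX R[i] (mpoly.mnm_muln (mpoly.mnm1 j) (k + b)))).
  exact: mpoly.mevalZ.
rewrite mpoly.mevalX.
congr (_ * _); rewrite (bigD1 j)//= mpoly.mulmnE mpoly.mnm1E eqxx mul1n.
rewrite big1 ?mulr1// => i ij.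
by rewrite mpoly.mulmnE mpoly.mnm1E eq_sym (negPf ij) mul0n.
Qed.

(** The normalised polynomials [z_j^(k + b)] are bounded, so a subsequence of their images converges
    to some [W]; the peaks [w k] are bounded and weakly null, hence the pairings tend to 0. The same
    pairings, computed by [innerL2_hankel], tend to the integral by [laplace_limit]. *)
Lemma hankel_limit a b v : continuous v ->
  (forall (g : 'I_n -> nat) k, Cintegral theta polydisc
    (fun z => monomial g z * (z 0 j ^+ (k + a) * v z)^*) = 0) ->
  Cintegral M rad (fun z => torus_average sigma
    (fun z => F z * z 0 j ^+ b * (z 0 j ^+ a * v z)^*) (set_coord1 j z)) = 0.
Proof.
move=> cv vperp; set G := fun z => F z * _ * _; set L := Cintegral _ _ _.
have cz e := expc_continuous (k := e) (@coord_vec_continuous R n j).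
have cG : continuous G.
  exact: (mulc_continuous (mulc_continuous cF (@cz b))
    (conjc_continuous (mulc_continuous (@cz a) cv))).
have [T cT Tp] := Hf_compact.
pose w k := peak mu j a k v.
have cw k : continuous (w k) := @peak_continuous R n mu j a k v cv.
have wL k := continuous_inL2 thD (@cw k).
have [B B0 vB] := compact_normc_bounded (@compact_cpolydisc R n 1) cv.
have wB k : normL2sq theta (w k) <= B ^+ 2.
  exact: (normL2sq_peak mu_product mu_radial sigma_haar theta_polar j a k cv vB).
have wperp k u : bergman theta u -> innerL2 theta u (w k) = 0.
  apply: (innerL2_monomials_perp thD (@cw k)) => g.
  have ig : cintegrable theta polydisc
      (fun z => monomial g z * (z 0 j ^+ (k + a) * v z)^*).
    apply: (continuous_cintegrable thD).
    exact: (mulc_continuous (@monomial_continuous R n g)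
      (conjc_continuous (mulc_continuous (@cz (k + a)%N) cv))).
  transitivity (Cintegral theta polydisc (fun z => (scale mu j k)%:C *
      (monomial g z * (z 0 j ^+ (k + a) * v z)^*))).
    by apply: eq_Cintegral => z _; rewrite /w /peak conjcM conjc_realE mulrCA.
  by rewrite CintegralZ// vperp mulr0.
pose u k := polyfun (peak_poly b k).
(* The two normalisations and the powers [z_j^k] give [|z_j|^(2k)] over [moment k]; the shifts [a]
   and [b] remain in [G]. *)
have inner_u k : innerL2 theta (T (u k)) (w k) = (moment k)^-1%:C *
    Cintegral theta polydisc (fun z => ((normc (z 0 j) ^+ 2) ^+ k)%:C * G z).
  rewrite (innerL2_hankel (@cw k) (wperp k) cT (Tp _)) -CintegralZ; last 2 first.
  - exact: mD.
  - apply: (continuous_cintegrable thD); apply: (mulc_continuous _ cG).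
    apply: real_complex_continuous.
    exact: (exp_continuous_real (exp_continuous_real (@normc_coord_continuous R n j))).
  apply: eq_Cintegral => z _.
  have e1 : (moment k)^-1%:C = (scale mu j k)%:C * (scale mu j k)%:C :> R[i].
    by rewrite -rmorphM -expr2 (scale_sqr mu_product mu_radial).
  have e2 : ((normc (z 0 j) ^+ 2) ^+ k)%:C = z 0 j ^+ k * (z 0 j ^+ k)^*.
    by rewrite mul_conj_normc normcX exprAC.
  rewrite peak_polyE /w /peak /G mulr1 !exprD !conjcM conjc_realE e1 e2.
  by ring.
have [s [W [si WL Wcvg]]] : exists s w, [/\ strictly_increasing s, inL2 theta w &
    cvgL2 theta (fun k => T (u (s k))) w].
  apply: (operator_compact cT); first by move=> k; exact: polyfun_bergman.
  exists 1 => k; rewrite (sqnormL2E); last first.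
    exact: (continuous_inL2 thD (@polyfun_continuous R n _)).
  rewrite lee_fin /u peak_polyE -[leRHS](expr1n _ 2).
  apply: (normL2sq_peak mu_product mu_radial sigma_haar theta_polar).
    exact: cstc_continuous.
  by move=> z _; rewrite Normc.normc1.
apply/eqP; rewrite -normc_eq0 eq_le normc_ge0 andbT.
apply/ler_addgt0Pr => e e0; rewrite add0r.
have e3 : 0 < e / 4 by rewrite divr_gt0.
have [N1 N1P] := peak_weakly_null mu_product mu_radial sigma_haar theta_polar j a cv WL e3.
have [N2 N2P] := laplace_limit mu_product mu_radial sigma_haar theta_polar j cG e3.
(* With this [t] the peak side of [innerL2_le] costs [e / 4]; convergence to [W] within [e / 4 / t]
   makes the other side cost [e / 4] as well. *)
pose t := B ^+ 2 / (e / 4); have t0 : 0 < t by rewrite divr_gt0// exprn_gt0.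
have d0 : 0 < e / 4 / t by rewrite divr_gt0.
have [N3 _ N3P] : nbhs \oo [set k |
    (sqnormL2 theta (T (u (s k)) \- W)%R < (e / 4 / t)%:E)%E].
  have H0 : nbhs (0%E : \bar R) [set x | (x < (e / 4 / t)%:E)%E].
    by apply: open_nbhs_nbhs; split; [exact: open_ereal_lt_ereal|rewrite /= lte_fin].
  exact: (Wcvg _ H0).
pose k := maxn N1 (maxn N2 N3).
have sk : (k <= s k)%N by exact: strictly_increasing_ge.
have TL : inL2 theta (T (u (s k))).
  by have [] := operator_perp cT (polyfun_bergman thD (peak_poly b (s k))).
have DL := inL2B TL WL.
have h1 : normc (innerL2 theta W (w (s k))) <= e / 4.
  by apply: N1P; rewrite (leq_trans _ sk)// leq_maxl.
have h2 : normc (innerL2 theta (T (u (s k)) \- W) (w (s k))) <= e / 4 + e / 4.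
  apply: (le_trans (innerL2_le DL (wL _) t0)); apply: lerD.
    rewrite mulrC -ler_pdivlMr// ltW// -lte_fin -(sqnormL2E DL).
    by apply: N3P; rewrite /= /k !leq_max leqnn !orbT.
  rewrite ler_pdivrMr//; apply: le_trans (wB _) _.
  by rewrite /t mulrC divfK// gt_eqF.
have h3 : normc (innerL2 theta (T (u (s k))) (w (s k)) - L) <= e / 4.
  have := N2P (s k) (leq_trans _ sk); rewrite /k !leq_max leqnn orbT => /(_ isT).
  rewrite -/L; set E := Cintegral _ _ _ => hE.
  have m0 := moment0 (s k).
  have mC : (moment (s k))%:C != 0 :> R[i].
    by rewrite (inj_eq (@complexI R)) gt_eqF.
  rewrite inner_u -/E.
  have -> : (moment (s k))^-1%:C * E - L =
      (moment (s k))^-1%:C * (E - (moment (s k))%:C * L).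
    by rewrite mulrBr mulrA -rmorphM mulVf ?gt_eqF// mul1r.
  rewrite Normc.normcM normc_real ger0_norm ?invr_ge0 ?(ltW m0)//.
  by rewrite ler_pdivrMl// [leRHS]mulrC.
have := normc_triangle (innerL2 theta (T (u (s k))) (w (s k))) L 0.
rewrite !subr0 => /le_trans; apply.
rewrite normc_sub.
have : normc (innerL2 theta (T (u (s k))) (w (s k))) <= e / 4 + e / 4 + e / 4.
  have -> : innerL2 theta (T (u (s k))) (w (s k)) =
      innerL2 theta (T (u (s k)) \- W) (w (s k)) + innerL2 theta W (w (s k)).
    by rewrite (innerL2Bl TL WL (wL _)) subrK.
  by apply: (le_trans (le_normcD _ _)); exact: lerD.
by move=> h4; lra.
Qed.

Lemma character_split a b (xi : Cn) : character a b xi =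
  xi 0 j ^+ a j * (xi 0 j ^+ b j)^* * character a b (set_coord1 j xi).
Proof.
have mE c : monomial c xi = xi 0 j ^+ c j * monomial c (set_coord1 j xi).
  rewrite /monomial (bigD1 j)//= [in RHS](bigD1 j)//= mxE eqxx expr1n mul1r.
  by congr (_ * _); apply: eq_bigr => i ij; rewrite mxE (negPf ij).
by rewrite /character !mE conjcM mulrACA.
Qed.

(** The Fourier component on the face is orthogonal to its own defect [v] by [hankel_limit], and so
    is [analytic_term] by the choice of [c]; hence [v] is orthogonal to itself and vanishes almost
    everywhere. *)
Lemma fourier_set_coord1_ae a b : {ae M, forall z, rad z ->
  fourier sigma F a b (set_coord1 j z) =
  fourier sigma F a b one * analytic_term a b j z}.
Proof.
have [c perp] := defect_orthogonal mu_product mu_radial sigma_haar cF a b j.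
have cD := @defect_continuous R n sigma sigma_haar F cF a b j c.
have cB := @analytic_term_continuous R n a b j.
have cA := comp_continuous (@fourier_continuous R n sigma sigma_haar F cF a b)
  (@set_coord1_continuous R n j).
set v := defect sigma F a b j c in cD perp.
have L0 := hankel_limit (b j) cD (defect_perp_monomial mu_product mu_radial
  sigma_haar theta_polar cF perp).
(* The factors [xi_j^(b j)] and the conjugate of [xi_j^(a j)], together with the covariance of [v]
   on the face, make up the conjugate of [character a b xi]: the torus average in [L0] is a Fourier
   component times the conjugate of [v]. *)
have A0 : Cintegral M rad (fun z => fourier sigma F a b (set_coord1 j z) * (v z)^*) = 0.
  rewrite -[RHS]L0; apply: eq_Cintegral => z _.
  rewrite /fourier /weighted_average /torus_average mulrC -CintegralZ; last 2 first.
  - exact: measurable_torus.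
  - exact: (@cintegrable_weighted R n sigma sigma_haar _ F (set_coord1 j z)
      (conjc_continuous (@character_continuous R n a b)) cF).
  apply: eq_Cintegral => xi /set_mem xiT.
  rewrite /v defect_rotate// defect_set_coord1 mxE [set_coord1 j z 0 j]mxE eqxx mulr1.
  by rewrite character_split !conjcM conjc2; ring.
have V0 : Cintegral M rad (fun z => v z * (v z)^*) = 0.
  have i1 := continuous_cintegrable Mrad (mulc_continuous cA (conjc_continuous cD)).
  have i2 := continuous_cintegrable Mrad (mulc_continuous cB (conjc_continuous cD)).
  have i3 := cintegrableZ (@measurable_cradii R n) c i2.
  transitivity (Cintegral M rad (fun z => fourier sigma F a b (set_coord1 j z) * (v z)^* -
      c * (analytic_term a b j z * (v z)^*))).
    by apply: eq_Cintegral => z _; rewrite {1}/v /defect mulrBl mulrA.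
  rewrite (CintegralB (@measurable_cradii R n) i1 i3).
  by rewrite (CintegralZ (@measurable_cradii R n) c i2) perp A0 mulr0 subrr.
have v0 := ae_radial_normc mu_product mu_radial cD V0.
(* Evaluation at the corner, where the monomial is 1, identifies [c] with the Fourier coefficient
   there. *)
have v1 := ae_radial_at_one mu_product mu_radial cD v0.
apply: filterS v0 => z vz zD; have := vz zD; rewrite /v /defect => /eqP.
rewrite subr_eq0 => /eqP ->; move: v1; rewrite /v /defect /analytic_term.
case: ifP => _; last by rewrite !mulr0.
by rewrite set_coord1_one monomial_one mulr1 => /eqP; rewrite subr_eq0 => /eqP ->.
Qed.

End Direction.

Hypothesis n_ge2 : (2 <= n)%N.

Lemma exists_other (i : 'I_n) : exists j : 'I_n, i != j.
Proof.
have n0 : (0 < n)%N by exact: ltnW.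
have [i0|i0] := eqVneq (i : nat) 0%N.
  by exists (Ordinal n_ge2); rewrite -val_eqE /= i0.
by exists (Ordinal n0); rewrite -val_eqE.
Qed.

(** A negative frequency [i] is invisible from the face [z_i = 1] but excluded on any other face;
    all the faces contain the corner. *)
Lemma fourier_one_eq0 a b : (exists i, (a i < b i)%N) -> fourier sigma F a b one = 0.
Proof.
move=> [i abi]; have [j ij] := exists_other i.
have cA := comp_continuous (@fourier_continuous R n sigma sigma_haar F cF a b)
  (@set_coord1_continuous R n j).
rewrite -(set_coord1_one R j); apply: (ae_radial_at_one mu_product mu_radial cA).
apply: filterS (fourier_set_coord1_ae j a b) => z h /h ->.
rewrite /analytic_term ifN ?mulr0//; apply/forallPn; exists i.
by rewrite negb_imply ij -ltnNge.
Qed.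

(* Off the analytic spectrum both sides vanish. *)
Lemma fourier_boundary_ae j a b : {ae M, forall z, rad z ->
  fourier sigma F a b (set_coord1 j z) =
  fourier sigma F a b one * monomial (fun i => a i - b i)%N (set_coord1 j z)}.
Proof.
apply: filterS (fourier_set_coord1_ae j a b) => z h /h ->.
have [|nab] := pselect (exists i, (a i < b i)%N).
  by move=> /fourier_one_eq0 ->; rewrite !mul0r.
rewrite /analytic_term ifT//; apply/forallP => i; apply/implyP => _.
by rewrite leqNgt; apply/negP => abi; apply: nab; exists i.
Qed.

End CompactHankelFourier.

(** * Polynomials on the closed polydisc *)

Section TorusPolynomials.
Context (R : realType) (n : nat) (sigma : probability 'rV[R[i]]_n R).
Local Notation Cn := 'rV[R[i]]_n.
Local Notation one := (const_mx 1 : Cn).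
Hypothesis sigma_haar : is_torus_haar sigma.
Let sT : carried_by sigma torus := torus_carried sigma_haar.
Let mT : measurable (torus : set Cn) := @measurable_torus R n.

(* The conull sets form a filter, which clusters in the compact torus; by
   invariance a null neighbourhood of [one] could be moved to the cluster point. *)
Lemma torus_open_gt0 (V : set Cn) : open V -> V one ->
  (0 < sigma (torus `&` V))%E.
Proof.
move=> oV V1; rewrite lt_neqAle measure_ge0 andbT; apply/eqP => V0.
have pF : ProperFilter (almost_everywhere sigma).
  have s0 : (0 < sigma setT)%E by rewrite probability_setT lte01.
  exact: (ae_properfilter_algebraOfSetsType s0).
have torusC0 : sigma (~` torus) = 0%E.
  have [_ _ sT1] := sT.
  rewrite probability_setC//; transitivity (1 - 1%E : \bar R)%E; last exact: subee.
  by congr (_ - _)%E.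
have FT : almost_everywhere sigma (cpolydisc 1).
  exists (~` torus); split; first exact: measurableC.
    exact: torusC0.
  by apply: subsetC => z /torus_sub.
have FT' : almost_everywhere sigma torus.
  exists (~` torus); split; [exact: measurableC|exact: torusC0|by []].
have [eta [_ cl]] := @compact_cpolydisc R n 1 _ pF FT.
(* The cluster point is found in the closed polydisc. A coordinate of modulus other than 1 would
   give it a neighbourhood disjoint from the torus. *)
have etaT : torus eta.
  apply/torusP => j; have [//|ej] := eqVneq (normc (eta 0 j)) 1.
  have d0 : 0 < `|normc (eta 0 j) - 1| by rewrite normr_gt0 subr_eq0.
  have nbe : nbhs eta [set w : Cn | normc (eta 0 j - w 0 j) < `|normc (eta 0 j) - 1|].
    by apply/nbhs_vecP; exists `|normc (eta 0 j) - 1| => // w /(_ j).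
  have [w [/torusP wT /= wj]] := cl _ _ FT' nbe.
  have := normc_dist (eta 0 j) (w 0 j); rewrite wT => /le_lt_trans /(_ wj).
  by rewrite ltxx.
pose c : Cn := \row_i (eta 0 i)^*.
have cT : torus c by apply/torusP => i; rewrite mxE normc_conj; move/torusP: etaT.
have ceta : rotate c eta = one.
  apply/rowP => i; rewrite !mxE mulrC mul_conj_normc.
  by move/torusP: etaT => ->; rewrite expr1n.
have nV : nbhs eta (rotate c @^-1` V).
  by apply: (@rotate_continuous R n c); rewrite ceta; exact: open_nbhs_nbhs.
have sV : sigma (rotate c @^-1` (torus `&` V)) = 0%E.
  have [_ ->//] := sigma_haar.
  by apply: measurableI => //; exact: open_measurable_vec.
have FV : almost_everywhere sigma (~` (rotate c @^-1` (torus `&` V))).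
  exists (rotate c @^-1` (torus `&` V)); split => //; last by rewrite setCK.
  rewrite -[X in measurable X]setTI.
  apply: (continuous_measurable_map (@rotate_continuous R n c)) => //.
  by apply: measurableI => //; exact: open_measurable_vec.
have [w [[nw wT] wV]] := cl _ _ (filterI FV FT') nV.
by apply: nw; split; [apply/rotate_torus|].
Qed.

Section Univariate.
Variable i0 : 'I_n.

Lemma Cintegral_coord_power (p q : nat) :
  Cintegral sigma torus (fun xi => xi 0 i0 ^+ p * (xi 0 i0 ^+ q)^*) = (p == q)%:R.
Proof.
have cz k := expc_continuous (k := k) (@coord_vec_continuous R n i0).
have cG := mulc_continuous (@cz p) (conjc_continuous (@cz q)).
have [->|pq] := eqVneq p q.
  rewrite -[RHS](Cintegral_cst sT); apply: eq_Cintegral => xi /set_mem /torusP xiT.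
  by rewrite mul_conj_normc normcX xiT !expr1n.
have [c c1 cpq] := unit_separates R pq.
have := Cintegral_torus_rotate sigma_haar (torus_coord_point i0 c1) cG.
have cE (xi : Cn) : rotate (coord_point i0 c) xi 0 i0 = c * xi 0 i0.
  by rewrite !mxE eqxx.
under [X in X = _ -> _]eq_Cintegral do rewrite cE !exprMn conjcM mulrACA.
rewrite CintegralZ//; last exact: (continuous_cintegrable sT cG).
move=> /eqP; rewrite -subr_eq0 -[X in _ - X]mul1r -mulrBl mulf_eq0 subr_eq0.
case/orP => [h|/eqP ->//]; case/negP: cpq; apply/eqP.
have cq : c ^+ q * (c ^+ q)^* = 1 by rewrite mul_conj_normc normcX c1 !expr1n.
by rewrite -[LHS]mulr1 -cq [c ^+ q * _]mulrC mulrA (eqP h) mul1r.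
Qed.

(** Cauchy's estimate. The circle of integration is the [i0]th coordinate of the torus, whose powers
    are orthonormal. *)
Lemma coef_le (q : {poly R[i]}) B : (forall w, normc w = 1 -> normc q.[w] <= B) ->
  forall k, normc q`_k <= B.
Proof.
move=> qB k.
have cz m := expc_continuous (k := m) (@coord_vec_continuous R n i0).
have im m : cintegrable sigma torus (fun xi : Cn => xi 0 i0 ^+ m * (xi 0 i0 ^+ k)^*).
  exact: (continuous_cintegrable sT
    (mulc_continuous (@cz m) (conjc_continuous (@cz k)))).
have -> : q`_k = Cintegral sigma torus (fun xi => q.[xi 0 i0] * (xi 0 i0 ^+ k)^*).
  transitivity (Cintegral sigma torus (fun xi =>
      \sum_(m < size q) q`_m * (xi 0 i0 ^+ m * (xi 0 i0 ^+ k)^*))); last first.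
    apply: eq_Cintegral => xi _; rewrite horner_coef mulr_suml.
    by apply: eq_bigr => m _; rewrite mulrA.
  rewrite Cintegral_sum//; last by move=> m; exact: cintegrableZ.
  under eq_bigr do rewrite CintegralZ// Cintegral_coord_power.
  case: (ltnP k (size q)) => kq.
    rewrite (bigD1 (Ordinal kq))//= eqxx mulr1 big1 ?addr0// => m mk.
    rewrite (_ : (m == k :> nat) = false) ?mulr0//.
    by apply/negbTE; apply: contra mk => /eqP mk; apply/eqP/val_inj.
  rewrite nth_default// big1// => m _.
  by rewrite (_ : (m == k :> nat) = false) ?mulr0// ltn_eqF// (leq_trans (ltn_ord m)).
apply: (normc_Cintegral_le_cst sT).
  have -> : (fun xi : Cn => q.[xi 0 i0] * (xi 0 i0 ^+ k)^*) = (fun xi =>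
      \sum_(m < size q) q`_m * (xi 0 i0 ^+ m * (xi 0 i0 ^+ k)^*)).
    apply/funext => xi; rewrite horner_coef mulr_suml.
    by apply: eq_bigr => m _; rewrite mulrA.
  by apply: cintegrable_sum => // m; exact: cintegrableZ.
move=> xi /torusP xiT; rewrite Normc.normcM normc_conj normcX xiT expr1n mulr1.
exact: qB.
Qed.

Lemma horner_le_size (q : {poly R[i]}) B w : 0 <= B ->
  (forall w, normc w = 1 -> normc q.[w] <= B) -> normc w <= 1 ->
  normc q.[w] <= (size q)%:R * B.
Proof.
move=> B0 qB w1; rewrite horner_coef.
apply: (@le_trans _ _ (\sum_(m < size q) B)); last first.
  by rewrite sumr_const card_ord mulr_natl.
apply: (le_trans (normc_sum _ _)); apply: ler_sum => m _.
rewrite Normc.normcM normcX -[leRHS]mulr1 ler_pM ?normc_ge0 ?exprn_ge0 ?normc_ge0//.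
  exact: coef_le.
by rewrite exprn_ile1 ?normc_ge0.
Qed.

(** If [y > 1], the square of Bernoulli's inequality makes [y ^+ (m * 2)] grow quadratically in
    [m]. *)
Lemma le1_of_linear_growth (y d : R) : 0 <= y -> 0 <= d ->
  (forall k : nat, y ^+ k <= d * k%:R + 1) -> y <= 1.
Proof.
move=> y0 d0 yd; rewrite leNgt; apply/negP => y1; pose e := y - 1.
have e0 : 0 < e by rewrite subr_gt0.
have bern m : 1 + m%:R * e <= y ^+ m.
  elim: m => [|m IH]; first by rewrite mul0r addr0 expr0.
  have me : 0 <= m%:R * e by rewrite mulr_ge0// ltW.
  rewrite exprS -natr1; apply: (@le_trans _ _ (y * (1 + m%:R * e))).
    by rewrite /e in me *; have := ler0n R m; nra.
  by rewrite ler_pM2l// (lt_trans ltr01).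
(* Comparing [(1 + m e)^2] with [2 d m + 1] gives [m e^2 + 2 e <= 2 d], which this [m] violates. *)
pose m := (Num.truncn (2 * d / e ^+ 2)).+1.
have md : 2 * d < m%:R * e ^+ 2.
  by rewrite -ltr_pdivrMr ?exprn_gt0// truncnS_gt.
have m0 : 0 < m%:R :> R by rewrite ltr0n.
have h : (1 + m%:R * e) ^+ 2 <= d * (m * 2)%:R + 1.
  apply: le_trans (yd _); rewrite exprM lerXn2r// nnegrE ?exprn_ge0//.
  by rewrite addr_ge0// mulr_ge0// ltW.
move: h; rewrite natrM; clearbody m e; nra.
Qed.

(* Apply [horner_le_size] to the powers of [q] and take roots. *)
Lemma univariate_max_principle (q : {poly R[i]}) B w :
  (forall w, normc w = 1 -> normc q.[w] <= B) -> normc w <= 1 ->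
  normc q.[w] <= B.
Proof.
move=> qB w1.
have B0 : 0 <= B by apply: le_trans (normc_ge0 _) (qB 1 _); rewrite Normc.normc1.
have qk k : normc q.[w] ^+ k <= ((size q).-1 * k).+1%:R * B ^+ k.
  rewrite -normcX -horner_exp.
  apply: (@le_trans _ _ ((size (q ^+ k))%:R * B ^+ k)).
    apply: horner_le_size => //; first exact: exprn_ge0.
    by move=> x x1; rewrite horner_exp normcX lerXn2r ?nnegrE ?normc_ge0// qB.
  by rewrite ler_wpM2r ?exprn_ge0// ler_nat size_poly_exp_leq.
have [Bpos|Bneg] := ltP 0 B; last first.
  have Be : B = 0 by apply/le_anti; rewrite Bneg.
  by have := qk 1%N; rewrite Be !expr1 mulr0.
rewrite -[leRHS]mul1r -ler_pdivrMr//.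
apply: (@le1_of_linear_growth _ (size q).-1%:R) => [||k]; rewrite ?divr_ge0 ?normc_ge0//.
by rewrite expr_div_n ler_pdivrMr ?exprn_gt0// -natrM natr1 qk.
Qed.

End Univariate.

(** Polynomials as lists of coefficients and exponents, repetitions allowed, so that subtraction is
    concatenation. *)
Definition mono_sum (s : seq (R[i] * ('I_n -> nat))) (z : Cn) : R[i] :=
  \sum_(t <- s) t.1 * monomial t.2 z.

Definition slice (s : seq (R[i] * ('I_n -> nat))) (z v : Cn) : {poly R[i]} :=
  \sum_(t <- s) t.1 *: \prod_i ((z 0 i)%:P + v 0 i *: 'X) ^+ t.2 i.

Lemma horner_slice s z v x : (slice s z v).[x] = mono_sum s (z + x *: v).
Proof.
rewrite /slice horner_sum; apply: eq_bigr => t _.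
rewrite hornerZ horner_prod; congr (_ * _); apply: eq_bigr => i _.
by rewrite horner_exp hornerD hornerC hornerZ hornerX !mxE mulrC.
Qed.

(** Induction on the number [k] of coordinates released from the circle into the disc: one more is
    released by applying the one-variable principle to the slice along its axis. *)
Lemma polydisc_max_principle s B :
  (forall z, torus z -> normc (mono_sum s z) <= B) ->
  forall z, cpolydisc 1 z -> normc (mono_sum s z) <= B.
Proof.
move=> TB.
suff H (k : nat) : (k <= n)%N -> forall z, cpolydisc 1 z ->
    (forall i : 'I_n, (k <= i)%N -> normc (z 0 i) = 1) -> normc (mono_sum s z) <= B.
  by move=> z zD; apply: (H n) => // i; rewrite leqNgt ltn_ord.
elim: k => [_ z _ zT|k IH kn z zD zk].
  by apply: TB; apply/torusP => i; exact: zT.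
pose i0 := Ordinal kn.
pose z' : Cn := \row_i (if i == i0 then 0 else z 0 i).
pose v : Cn := \row_i (i == i0)%:R.
have zE : z = z' + z 0 i0 *: v.
  apply/rowP => i; rewrite !mxE; case: eqVneq => [->|_]; first by rewrite add0r mulr1.
  by rewrite mulr0 addr0.
rewrite zE -horner_slice; apply: (univariate_max_principle i0) => // w w1.
rewrite horner_slice; apply: IH; first exact: ltnW.
  move=> i; rewrite !mxE; case: eqVneq => _; first by rewrite add0r mulr1 w1.
  by rewrite mulr0 addr0.
move=> i ki; rewrite !mxE; case: eqVneq => [_|ii0]; first by rewrite add0r mulr1.
rewrite mulr0 addr0 zk// ltn_neqAle ki andbT.
by apply: contra ii0 => /eqP h; apply/eqP/val_inj.
Qed.

End TorusPolynomials.

(** * Uniform limits of polynomials, and their differentiability *)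

Section ComplexLimits.
Context (R : realType).

(** The intervals around [u k] of radius [e k] meet pairwise, so the supremum of their left ends
    lies in all of them. *)
Lemma real_limit (u e : nat -> R) :
  (forall k m, `|u k - u m| <= e k + e m) -> exists l, forall k, `|u k - l| <= e k.
Proof.
move=> ue; pose A := [set x | exists k, x = u k - e k].
have Aub m : ubound A (u m + e m).
  by move=> _ [k ->]; have := le_trans (ler_norm _) (ue k m); lra.
have A0 : A !=set0 by exists (u 0%N - e 0%N); exists 0%N.
exists (sup A) => k; rewrite ler_norml; apply/andP; split.
  by rewrite lerBrDl -lerBrDr opprK; apply: ge_sup => //; exact: Aub.
rewrite lerBlDl -lerBlDr; apply: ub_le_sup; last by exists k.
by exists (u 0%N + e 0%N); exact: Aub.
Qed.

(** The factor 2 comes from bounding the real and imaginary parts separately. *)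
Lemma complex_limit (u : nat -> R[i]) (e : nat -> R) :
  (forall k m, normc (u k - u m) <= e k + e m) ->
  exists l, forall k, normc (u k - l) <= 2 * e k.
Proof.
move=> ue.
have [x xP] := @real_limit (fun k => complex.Re (u k)) e
  (fun k m => le_trans (eq_ind _ (fun y => `|y| <= _) (normc_Re _) _ (raddfB _ _ _)) (ue k m)).
have [y yP] := @real_limit (fun k => complex.Im (u k)) e
  (fun k m => le_trans (eq_ind _ (fun y => `|y| <= _) (normc_Im _) _ (raddfB _ _ _)) (ue k m)).
exists (x +i* y) => k; apply: (le_trans (normc_le_ReIm _)).
rewrite !raddfB /=; have := xP k; have := yP k; lra.
Qed.

End ComplexLimits.

Section FirstOrder.
Context (R : realType) (n : nat).
Local Notation Cn := 'rV[R[i]]_n.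

Definition linear_form (d : 'I_n -> R[i]) (h : Cn) : R[i] := \sum_i d i * h 0 i.

(** Differentiability in algebraic form: along the line of direction [u], the constant term does not
    depend on [u] and the linear coefficient is linear in [u]. Sums and products inherit this, hence
    so do slices. *)
Definition first_order (Q : Cn -> {poly R[i]}) :=
  (exists c, forall u, (Q u)`_0 = c) /\ exists d, forall u, (Q u)`_1 = linear_form d u.

Lemma first_order_cst c : first_order (fun=> c%:P).
Proof.
split; first by exists c => u; rewrite coefC.
exists (fun=> 0) => u; rewrite coefC /=.
by rewrite /linear_form big1// => i _; rewrite mul0r.
Qed.

Lemma first_orderM Q1 Q2 : first_order Q1 -> first_order Q2 ->
  first_order (fun u => Q1 u * Q2 u).
Proof.
move=> [[c1 Qc1] [d1 Qd1]] [[c2 Qc2] [d2 Qd2]]; split.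
  by exists (c1 * c2) => u; rewrite coefM big_ord1 Qc1 Qc2.
exists (fun i => c1 * d2 i + c2 * d1 i) => u.
rewrite coefM !big_ord_recl big_ord0 /= addr0 Qc1 Qc2 Qd1 Qd2 /linear_form.
rewrite mulr_sumr mulr_suml -big_split; apply: eq_bigr => i _ /=; ring.
Qed.

Lemma first_orderD Q1 Q2 : first_order Q1 -> first_order Q2 ->
  first_order (fun u => Q1 u + Q2 u).
Proof.
move=> [[c1 Qc1] [d1 Qd1]] [[c2 Qc2] [d2 Qd2]]; split.
  by exists (c1 + c2) => u; rewrite coefD Qc1 Qc2.
exists (fun i => d1 i + d2 i) => u.
by rewrite coefD Qd1 Qd2 /linear_form -big_split; apply: eq_bigr => i _; rewrite mulrDl.
Qed.

Lemma first_order_coord (z : Cn) i : first_order (fun u => (z 0 i)%:P + u 0 i *: 'X).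
Proof.
split; first by exists (z 0 i) => u; rewrite coefD coefC coefZ coefX mulr0 addr0.
exists (fun k => (k == i)%:R) => u; rewrite coefD coefC coefZ coefX mulr1 add0r.
rewrite /linear_form (bigD1 i)//= eqxx mul1r big1 ?addr0// => k /negPf ->.
by rewrite mul0r.
Qed.

Lemma first_orderX Q k : first_order Q -> first_order (fun u => Q u ^+ k).
Proof.
move=> fQ; elim: k => [|k IH]; first exact: (first_order_cst 1).
have -> : (fun u => Q u ^+ k.+1) = (fun u => Q u * Q u ^+ k).
  by apply/funext => u; rewrite exprS.
exact: first_orderM.
Qed.

Lemma first_order_prod (I : Type) (r : seq I) (Q : I -> Cn -> {poly R[i]}) :
  (forall i, first_order (Q i)) -> first_order (fun u => \prod_(i <- r) Q i u).
Proof.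
move=> fQ; elim: r => [|a r IH].
  have -> : (fun u => \prod_(i <- [::]) Q i u) = (fun=> 1%:P).
    by apply/funext => u; rewrite big_nil.
  exact: first_order_cst.
have -> : (fun u => \prod_(i <- a :: r) Q i u) = (fun u => Q a u * \prod_(i <- r) Q i u).
  by apply/funext => u; rewrite big_cons.
exact: first_orderM.
Qed.

Lemma slice_first_order s (z : Cn) : first_order (slice s z).
Proof.
rewrite /slice; elim: s => [|t s IH].
  have -> : (fun u : Cn => \sum_(t <- [::]) t.1 *: \prod_i ((z 0 i)%:P + u 0 i *: 'X) ^+ t.2 i)
      = (fun _ : Cn => 0%:P) by apply/funext => u; rewrite big_nil.
  exact: first_order_cst.
have -> : (fun u : Cn => \sum_(t0 <- t :: s) t0.1 *:
      \prod_i ((z 0 i)%:P + u 0 i *: 'X) ^+ t0.2 i)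
    = (fun u : Cn => t.1%:P * (\prod_i ((z 0 i)%:P + u 0 i *: 'X) ^+ t.2 i) +
       \sum_(t0 <- s) t0.1 *: \prod_i ((z 0 i)%:P + u 0 i *: 'X) ^+ t0.2 i).
  by apply/funext => u; rewrite big_cons mul_polyC.
apply: first_orderD => //; apply: first_orderM; first exact: first_order_cst.
by apply: first_order_prod => i; apply: first_orderX; exact: first_order_coord.
Qed.

Variable sigma : probability Cn R.
Hypothesis sigma_haar : is_torus_haar sigma.
Variable i0 : 'I_n.

Lemma geometric_half_le (m : nat) : \sum_(k < m) (2^-1 : R) ^+ k <= 2.
Proof.
have -> : \sum_(k < m) (2^-1 : R) ^+ k = 2 - 2 * 2^-1 ^+ m.
  elim: m => [|m IH]; first by rewrite big_ord0 expr0; ring.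
  by rewrite big_ord_recr /= IH exprS; field.
by rewrite gerBl mulr_ge0// exprn_ge0// invr_ge0.
Qed.

(** The coefficients beyond the second are at most [B] by Cauchy's estimate, and for [t <= 1/2] the
    geometric series contributes at most 2. *)
Lemma univariate_remainder (q : {poly R[i]}) B (t : R) :
  (forall w, normc w = 1 -> normc q.[w] <= B) -> 0 <= t <= 2^-1 ->
  normc (q.[t%:C] - q`_0 - q`_1 * t%:C) <= 2 * B * t ^+ 2.
Proof.
move=> qB /andP[t0 t2]; have cB := coef_le sigma_haar i0 qB.
have B0 : 0 <= B := le_trans (normc_ge0 _) (cB 0%N).
pose q2 := drop_poly 2 q.
have qE : q.[t%:C] - q`_0 - q`_1 * t%:C = q2.[t%:C] * t%:C ^+ 2.
  rewrite -{1}(poly_take_drop 2 q) hornerD hornerM hornerXn -/q2.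
  rewrite /take_poly horner_poly !big_ord_recl big_ord0 /= expr0 expr1; ring.
rewrite qE Normc.normcM normcX normc_real ger0_norm// ler_wpM2r ?exprn_ge0//.
rewrite horner_coef; apply: (le_trans (normc_sum _ _)).
apply: (@le_trans _ _ (\sum_(k < size q2) B * 2^-1 ^+ k)).
  apply: ler_sum => k _; rewrite Normc.normcM normcX normc_real ger0_norm//.
  rewrite ler_pM ?normc_ge0 ?exprn_ge0//; first by rewrite coef_drop_poly cB.
  by rewrite lerXn2r// nnegrE invr_ge0.
by rewrite -mulr_sumr mulrC ler_wpM2r// geometric_half_le.
Qed.

Lemma linear_formZ d a (u : Cn) : linear_form d (a *: u) = a * linear_form d u.
Proof. by rewrite mulr_sumr; apply: eq_bigr => i _; rewrite mxE mulrCA. Qed.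

(* Cauchy's estimates on the slice through [z0] in direction [h]. *)
Lemma mono_sum_taylor s (z0 h : Cn) B r rho :
  (forall z, cpolydisc 1 z -> normc (mono_sum s z) <= B) ->
  (forall u, cpolydisc r u -> cpolydisc 1 (z0 + u)) ->
  0 < rho <= r / 2 -> cpolydisc rho h ->
  normc (mono_sum s (z0 + h) - mono_sum s z0 - (slice s z0 h)`_1)
    <= 2 * B * (rho / r) ^+ 2 /\
  normc (slice s z0 h)`_1 <= B * (rho / r).
Proof.
move=> sB z0r /andP[rho0 rhor] hrho.
have r0 : 0 < r by have := lt_le_trans rho0 rhor; lra.
(* The direction is stretched until it fills the polydisc of radius [r]: the slice along [u] is then
   bounded by [B] on the whole unit circle, and [h] sits at the parameter [t <= 1/2]. *)
pose u := (r / rho)%:C *: h; pose t := rho / r.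
have t0 : 0 <= t by rewrite divr_ge0// ltW.
have t2 : t <= 2^-1 by rewrite ler_pdivrMr// mulrC.
have hE : h = t%:C *: u.
  by rewrite scalerA -rmorphM /t mulf_div [r * rho]mulrC divff ?scale1r// mulf_neq0 ?gt_eqF.
have ur x : normc x <= 1 -> cpolydisc r (x *: u).
  move=> x1 i; have rr : 0 <= r / rho by rewrite divr_ge0// ltW.
  have hi : r / rho * normc (h 0 i) <= r.
    by rewrite mulrAC ler_pdivrMr// ler_pM2l.
  rewrite !mxE !Normc.normcM normc_real (ger0_norm rr) -[leRHS]mul1r.
  by apply: ler_pM (normc_ge0 _) (mulr_ge0 rr (normc_ge0 _)) x1 hi.
pose q := slice s z0 u.
have qB w : normc w = 1 -> normc q.[w] <= B.
  by move=> w1; rewrite horner_slice; apply/sB/z0r/ur; rewrite w1.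
have [_ [d dP]] := slice_first_order s z0.
have c1 : (slice s z0 h)`_1 = q`_1 * t%:C.
  by rewrite !dP hE linear_formZ mulrC.
have q0 : q`_0 = mono_sum s z0 by rewrite -horner_coef0 horner_slice scale0r addr0.
rewrite c1 -q0 {1}hE -horner_slice; split.
  by apply: univariate_remainder => //; rewrite t0.
rewrite Normc.normcM normc_real ger0_norm// ler_wpM2r//.
exact: (coef_le sigma_haar i0 qB).
Qed.

Lemma mono_sumB s1 s2 (z : Cn) :
  mono_sum (s1 ++ [seq (- t.1, t.2) | t <- s2]) z = mono_sum s1 z - mono_sum s2 z.
Proof.
rewrite /mono_sum big_cat big_map; congr (_ + _); rewrite -sumrN.
by apply: eq_bigr => t _; rewrite mulNr.
Qed.

Lemma sliceB s1 s2 (z u : Cn) :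
  slice (s1 ++ [seq (- t.1, t.2) | t <- s2]) z u = slice s1 z u - slice s2 z u.
Proof.
rewrite /slice big_cat big_map; congr (_ + _); rewrite -sumrN.
by apply: eq_bigr => t _; rewrite scaleNr.
Qed.

End FirstOrder.

Section HolomorphicLimit.
Context (R : realType) (n : nat).
Local Notation Cn := 'rV[R[i]]_n.

Lemma linear_form_is_linear (d : 'I_n -> R[i]) : linear (linear_form d).
Proof.
move=> a u v; rewrite /linear_form scaler_sumr -big_split; apply: eq_bigr => i _.
by rewrite !mxE mulrDr mulrCA.
Qed.

HB.instance Definition _ (d : 'I_n -> R[i]) :=
  GRing.isLinear.Build R[i] Cn R[i] *:%R (linear_form d) (linear_form_is_linear d).

Lemma linear_form_continuous (d : 'I_n -> R[i]) : continuous (linear_form d).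
Proof.
apply: sumc_continuous => i.
exact: (mulc_continuous (@cstc_continuous R n (d i)) (@coord_vec_continuous R n i)).
Qed.

Lemma normc_coord_le (h : Cn) i : (normc (h 0 i))%:C <= `|h|.
Proof.
rewrite -normcE [leRHS]mx_normE -[leLHS]nngE num_le.
exact: (le_bigmax _ _ (0, i)).
Qed.

Lemma norm_vecE (h : Cn) : `|h| = (complex.Re `|h|)%:C.
Proof. by have := normr_ge0 h; case: `|h| => a b; rewrite lecE /= => /andP[/eqP ->]. Qed.

(** The norm of C^n is the largest modulus of a coordinate, so [rho] can be taken to be the norm of
    [h], and the error is quadratic in it. *)
Lemma differentiable_of_quadratic (H : Cn -> R[i]) (z0 : Cn) d C (r : R) :
  0 < r -> 0 <= C -> (forall rho h, 0 < rho <= r -> cpolydisc rho h ->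
    normc (H (z0 + h) - H z0 - linear_form d h) <= C * rho ^+ 2) ->
  differentiable H z0.
Proof.
move=> r0 C0 Hq.
have lc : continuous (linear_form d) := @linear_form_continuous d.
have Ho : H \o shift z0 = cst (H z0) + linear_form d +o_ (0 : Cn) id.
  apply/eqaddoP => e e0.
  have eE : e = (complex.Re e)%:C.
    by case: e e0 => a b; rewrite ltcE /= => /andP[/eqP ->].
  have e1 : 0 < complex.Re e by move: e0; rewrite {1}eE ltcR.
  pose s := Order.min r (complex.Re e / (C + 1)).
  have C1 : 0 < C + 1 by rewrite ltr_wpDl.
  have s0 : 0 < s by rewrite lt_min r0 divr_gt0.
  have s0C : 0 < s%:C :> R[i] by rewrite ltcR.
  apply: filterS (nbhs0_lt s0C) => h hs.
  suff : `|H (z0 + h) - H z0 - linear_form d h| <= e * `|h|.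
    by rewrite [z0 + h]addrC -addrA -opprD.
  have [h0|h0] := eqVneq h 0.
    by rewrite h0 addr0 subrr raddf0 subrr !normr0 mulr0.
  pose rho := complex.Re `|h|.
  have hE := norm_vecE h.
  have rho0 : 0 < rho by rewrite -ltcR -hE normr_gt0.
  have hrho : cpolydisc rho h.
    by move=> i; rewrite -lecR /rho -hE; exact: normc_coord_le.
  have rhos : rho < s.
    by rewrite -ltcR /rho -hE.
  have rhor : 0 < rho <= r.
    by rewrite rho0 ltW// (lt_le_trans rhos)// ge_min lexx.
  have rhoe : rho * (C + 1) <= complex.Re e.
    rewrite -ler_pdivlMr//; apply: ltW; apply: (lt_le_trans rhos).
    by rewrite ge_min lexx orbT.
  rewrite hE -/rho eE -rmorphM normcE lecR.
  apply: (le_trans (Hq rho h rhor hrho)).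
  by rewrite expr2 mulrA ler_wpM2r ?(ltW rho0)//; nra.
have dE := diff_unique lc Ho.
by apply/diff_locallyP; rewrite dE.
Qed.

Variable sigma : probability Cn R.
Hypothesis sigma_haar : is_torus_haar sigma.
Variable i0 : 'I_n.

Lemma polydisc_margin (z0 : Cn) : polydisc z0 ->
  exists2 r : R, 0 < r & forall u, cpolydisc r u -> cpolydisc 1 (z0 + u).
Proof.
move=> /polydiscP z0D; exists (\big[Order.min/1]_i (1 - normc (z0 0 i))).
  by elim/big_ind : _ => // [x y x0 y0|i _]; rewrite ?lt_min ?x0// subr_gt0.
move=> u ur i; rewrite mxE; apply: (le_trans (le_normcD _ _)).
have := ur i; have : \big[Order.min/1]_i (1 - normc (z0 0 i)) <= 1 - normc (z0 0 i).
  by exact: bigmin_le_cond.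
lra.
Qed.

(** Weierstrass's theorem. The linear coefficients at [z0] are Cauchy, by Cauchy's estimate for
    differences of approximants; the second-order remainder bound depends only on the supremum and
    so passes to the limit. *)
Lemma uniform_limit_differentiable (s : nat -> seq (R[i] * ('I_n -> nat)))
    (e : nat -> R) (H : Cn -> R[i]) B (z0 : Cn) :
  (forall eta, 0 < eta -> exists N, e N <= eta) ->
  (forall N z, cpolydisc 1 z -> normc (mono_sum (s N) z - H z) <= e N) ->
  (forall z, cpolydisc 1 z -> normc (H z) <= B) ->
  polydisc z0 -> differentiable H z0.
Proof.
move=> e_small sH HB z0D.
have [r r0 rD] := polydisc_margin z0D.
have z0c : cpolydisc 1 z0 := polydisc_sub z0D.
have eN N : 0 <= e N := le_trans (normc_ge0 _) (sH N z0 z0c).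
have B0 : 0 <= B := le_trans (normc_ge0 _) (HB z0 z0c).
have /choice [D DP] : forall N, exists d, forall u, (slice (s N) z0 u)`_1 = linear_form d u.
  by move=> N; have [_] := slice_first_order (s N) z0.
have DE N i : D N i = (slice (s N) z0 (\row_k (k == i)%:R))`_1.
  rewrite DP /linear_form (bigD1 i)//= mxE eqxx mulr1 big1 ?addr0// => k ki.
  by rewrite mxE (negPf ki) mulr0.
have r2 : 0 < r / 2 <= r / 2 by rewrite lexx divr_gt0.
have Dcauchy i N M : normc (D N i - D M i) <= e N / r + e M / r.
  have diffB z : cpolydisc 1 z ->
      normc (mono_sum (s N ++ [seq (- t.1, t.2) | t <- s M]) z) <= e N + e M.
    move=> zD; rewrite mono_sumB; apply: (le_trans (normc_triangle (H z) _ _)).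
    by apply: lerD; [exact: sH|rewrite normc_sub; exact: sH].
  have hr : cpolydisc (r / 2) ((r / 2)%:C *: (\row_k (k == i)%:R : Cn)).
    move=> k; rewrite !mxE Normc.normcM normc_real ger0_norm ?divr_ge0 ?(ltW r0)//.
    by case: (k == i); rewrite ?Normc.normc1 ?Normc.normc0 ?mulr1 ?mulr0// divr_ge0 ?(ltW r0).
  have [_] := mono_sum_taylor sigma_haar i0 diffB rD r2 hr.
  rewrite sliceB coefB !DP !linear_formZ -mulrBr -!DP -!DE Normc.normcM normc_real.
  rewrite ger0_norm ?divr_ge0 ?(ltW r0)// => h.
  have rN : r != 0 by rewrite gt_eqF.
  rewrite -(ler_pM2l (divr_gt0 r0 (ltr0Sn R 1))); apply: (le_trans h).
  by rewrite le_eqVlt; apply/orP; left; apply/eqP; field.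
have /choice [d dP] : forall i, exists l, forall N, normc (D N i - l) <= 2 * (e N / r).
  by move=> i; exact: complex_limit (Dcauchy i).
apply: (@differentiable_of_quadratic H z0 d (2 * B / r ^+ 2) (r / 2)).
- by rewrite divr_gt0.
- by rewrite divr_ge0 ?exprn_ge0 ?(ltW r0)// mulr_ge0.
move=> rho h rhor hrho; have [rho0 rho2] := andP rhor.
have -> : 2 * B / r ^+ 2 * rho ^+ 2 = 2 * B * (rho / r) ^+ 2.
  by field; rewrite gt_eqF.
apply/ler_addgt0Pr => eta eta0.
have rr0 : 0 <= rho / r by rewrite divr_ge0// ltW.
(* The total coefficient of [e N]: from the bound [B + e N] in the remainder, from replacing [H] at
   two points, and from the [n] linear coefficients. *)
pose C := 2 * (rho / r) ^+ 2 + 2 + 2 * (rho / r) * n%:R.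
have C0 : 0 < C.
  have := mulr_ge0 rr0 (ler0n R n); have := sqr_ge0 (rho / r).
  by rewrite /C; move: (rho / r) => x; lra.
have [N NP] := e_small (eta / C) (divr_gt0 eta0 C0).
have sB z : cpolydisc 1 z -> normc (mono_sum (s N) z) <= B + e N.
  move=> zD; rewrite -(subrK (H z) (mono_sum (s N) z)) addrC.
  by apply: (le_trans (le_normcD _ _)); rewrite lerD ?HB ?sH.
have [h1 _] := mono_sum_taylor sigma_haar i0 sB rD rhor hrho.
rewrite DP in h1.
have hz : cpolydisc 1 (z0 + h).
  by apply: rD => i; apply: (le_trans (hrho i)); lra.
have lform : normc (linear_form (D N) h - linear_form d h) <= n%:R * (2 * (e N / r) * rho).
  rewrite /linear_form -sumrB.
  apply: (le_trans (normc_sum _ _)).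
  apply: (@le_trans _ _ (\sum_(i < n) (2 * (e N / r) * rho))); last first.
    by rewrite sumr_const card_ord -[leLHS]mulr_natl.
  apply: ler_sum => i _; rewrite -mulrBl Normc.normcM.
  exact: (ler_pM (normc_ge0 _) (normc_ge0 _) (dP i N) (hrho i)).
have -> : H (z0 + h) - H z0 - linear_form d h =
    (mono_sum (s N) (z0 + h) - mono_sum (s N) z0 - linear_form (D N) h) +
    (linear_form (D N) h - linear_form d h) +
    (H (z0 + h) - mono_sum (s N) (z0 + h)) + (mono_sum (s N) z0 - H z0) by ring.
apply: (@le_trans _ _ (2 * (B + e N) * (rho / r) ^+ 2 + n%:R * (2 * (e N / r) * rho) + e N + e N)).
  apply: (le_trans (le_normcD _ _)); apply: lerD; last exact: sH.
  apply: (le_trans (le_normcD _ _)); apply: lerD; last by rewrite normc_sub; exact: sH.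
  apply: (le_trans (le_normcD _ _)); exact: lerD.
have -> : 2 * (B + e N) * (rho / r) ^+ 2 + n%:R * (2 * (e N / r) * rho) + e N + e N =
   2 * B * (rho / r) ^+ 2 + e N * C.
  by rewrite /C; ring.
by rewrite lerD2l -ler_pdivlMr.
Qed.

End HolomorphicLimit.

(** * The holomorphic extension of the boundary values *)

Section Kernel.
Context (R : realType) (n : nat) (sigma : probability 'rV[R[i]]_n R).
Local Notation Cn := 'rV[R[i]]_n.
Local Notation one := (const_mx 1 : Cn).
Hypothesis sigma_haar : is_torus_haar sigma.
Let sT : carried_by sigma torus := torus_carried sigma_haar.

(** On the unit circle each factor is the squared cosine of half the argument: a trigonometric
    polynomial that reaches its maximum 1 only at 1. Its normalised powers thus form an approximate
    identity. *)
Definition kernel (z : Cn) : R := \prod_i (normc (1 + z 0 i) ^+ 2 / 4).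

Definition trig_sum (ts : seq (R[i] * (('I_n -> nat) * ('I_n -> nat)))) (z : Cn) : R[i] :=
  \sum_(t <- ts) t.1 * character t.2.1 t.2.2 z.

Lemma character_mul a b a' b' (z : Cn) : character a b z * character a' b' z =
  character (fun i => a i + a' i)%N (fun i => b i + b' i)%N z.
Proof. by rewrite /character !monomialD conjcM mulrACA. Qed.

Lemma trig_sumM ts1 ts2 : exists ts, forall z, trig_sum ts z = trig_sum ts1 z * trig_sum ts2 z.
Proof.
exists [seq (t.1 * u.1, ((fun i => t.2.1 i + u.2.1 i)%N, (fun i => t.2.2 i + u.2.2 i)%N))
  | t <- ts1, u <- ts2] => z.
rewrite /trig_sum big_allpairs_dep big_distrl; apply: eq_bigr => t _ /=.
by rewrite big_distrr; apply: eq_bigr => u _ /=; rewrite -character_mul mulrACA.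
Qed.

Lemma character0 (z : Cn) : character (fun=> 0)%N (fun=> 0)%N z = 1.
Proof.
have m0 : monomial (fun=> 0)%N z = 1 by apply: big1 => i _; rewrite expr0.
by rewrite /character m0 conjc_one mulr1.
Qed.

Lemma character_coord p q i (z : Cn) :
  character (fun k => if k == i then p else 0)%N (fun k => if k == i then q else 0)%N z =
  z 0 i ^+ p * (z 0 i ^+ q)^*.
Proof.
have mE m : monomial (fun k => if k == i then m else 0)%N z = z 0 i ^+ m.
  rewrite /monomial (bigD1 i)//= eqxx big1 ?mulr1// => k /negPf ->.
  by rewrite expr0.
by rewrite /character !mE.
Qed.

Lemma kernel_trig : exists ts, forall z, trig_sum ts z = (kernel z)%:C.
Proof.
have factor i : exists ts, forall z : Cn, trig_sum ts z = (normc (1 + z 0 i) ^+ 2 / 4)%:C.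
  pose e p q : R[i] * (('I_n -> nat) * ('I_n -> nat)) := (4^-1,
    ((fun k => if k == i then p else 0)%N, (fun k => if k == i then q else 0)%N)).
  exists [:: e 0%N 0%N; e 1%N 0%N; e 0%N 1%N; e 1%N 1%N] => z.
  have -> : (normc (1 + z 0 i) ^+ 2 / 4)%:C = (1 + z 0 i) * (1 + z 0 i)^* * 4^-1.
    by rewrite mul_conj_normc rmorphM fmorphV rmorph_nat.
  rewrite /trig_sum !big_cons big_nil /= !character_coord !expr0 !expr1 conjc_one.
  have -> : (1 + z 0 i)^* = 1 + (z 0 i)^*.
    by rewrite -{2}conjc_one; exact: rmorphD.
  by ring.
have prod (r : seq 'I_n) : exists ts, forall z : Cn, trig_sum ts z =
    (\prod_(i <- r) (normc (1 + z 0 i) ^+ 2 / 4))%:C.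
  elim: r => [|i r [ts tsE]].
    exists [:: (1, ((fun=> 0)%N, (fun=> 0)%N))] => z.
    by rewrite /trig_sum big_seq1 big_nil /= character0 mulr1.
  have [us usE] := factor i; have [vs vsE] := trig_sumM us ts.
  by exists vs => z; rewrite vsE usE tsE big_cons -rmorphM.
exact: prod.
Qed.

Lemma kernel_pow_trig k : exists ts, forall z, trig_sum ts z = (kernel z ^+ k)%:C.
Proof.
have [us usE] := kernel_trig; elim: k => [|k [ts tsE]].
  exists [:: (1, ((fun=> 0)%N, (fun=> 0)%N))] => z.
  by rewrite /trig_sum big_seq1 /= character0 mulr1 expr0.
have [vs vsE] := trig_sumM us ts.
by exists vs => z; rewrite vsE usE tsE exprS -rmorphM.
Qed.

Lemma kernel_continuous : continuous kernel.
Proof.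
have [ts tsE] := kernel_trig.
have ct : continuous (trig_sum ts).
  apply: sumc_continuous => t.
  exact: (mulc_continuous (@cstc_continuous R n _) (@character_continuous R n _ _)).
by apply: (eq_continuous_vec _ (Re_continuous ct)) => z; rewrite tsE.
Qed.

(* [|1 + w|^2 / 4 + |1 - w|^2 / 4 = 1] on the unit circle. *)
Lemma parallelogram (w : R[i]) : normc w = 1 ->
  normc (1 + w) ^+ 2 / 4 = 1 - normc (w - 1) ^+ 2 / 4.
Proof.
move=> w1; have h : 1 = complex.Re w ^+ 2 + complex.Im w ^+ 2.
  by rewrite -normc_sqrE w1 expr1n.
by rewrite !normc_sqrE; case: w {w1} h => a b /= h; lra.
Qed.

Lemma kernel_factor_01 (w : R[i]) : normc w = 1 -> 0 <= normc (1 + w) ^+ 2 / 4 <= 1.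
Proof.
move=> w1; rewrite divr_ge0 ?exprn_ge0 ?normc_ge0//= parallelogram//.
by rewrite gerBl divr_ge0 ?exprn_ge0 ?normc_ge0.
Qed.

Lemma kernel_01 (z : Cn) : torus z -> 0 <= kernel z <= 1.
Proof.
move=> /torusP zT; apply/andP; split.
  by apply: prodr_ge0 => i _; have /andP[] := kernel_factor_01 (zT i).
by apply: prodr_ile1 => i _; exact: kernel_factor_01.
Qed.

(** The other factors being at most 1, each factor dominates the kernel, and [parallelogram]
    converts its closeness to 1 into the distance of [z 0 i] from 1. *)
Lemma kernel_near_one (d : R) : 0 < d -> exists2 s : R, 0 <= s < 1 &
  forall z : Cn, torus z -> s < kernel z -> forall i, normc (z 0 i - 1) < d.
Proof.
move=> d0; pose e := Order.min 1 d.
have e0 : 0 < e by rewrite lt_min ltr01.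
have e1 : e <= 1 by rewrite ge_min lexx.
have ed : e <= d by rewrite ge_min lexx orbT.
exists (1 - e ^+ 2 / 4).
  by clearbody e; apply/andP; split; nra.
move=> z /torusP zT sz i; apply: lt_le_trans ed.
have hi : kernel z <= normc (1 + z 0 i) ^+ 2 / 4.
  rewrite /kernel (bigD1 i)//= ler_piMr//; first by have /andP[] := kernel_factor_01 (zT i).
  by apply: prodr_ile1 => k _; exact: kernel_factor_01.
have := lt_le_trans sz hi; rewrite parallelogram// => h.
rewrite -(@ltr_pXn2r _ 2) ?nnegrE ?normc_ge0 ?(ltW e0)//.
by lra.
Qed.

Lemma kernel_gt0 t : t < 1 -> (0 < sigma (torus `&` [set z | (t < kernel z)%R]))%E.
Proof.
move=> t1; apply: torus_open_gt0 => //.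
  have /continuousP := kernel_continuous; move=> /(_ [set x | t < x]); apply.
  exact: open_gt.
rewrite /= (_ : kernel one = 1)//; apply: big1 => i _; rewrite mxE.
by rewrite -mulr2n normcMn Normc.normc1; field.
Qed.

Variable F : Cn -> R[i].
Hypothesis cF : continuous F.

(** Convolution with a normalised power of the kernel is a finite sum of Fourier components, by
    expansion into characters, and is close to [F], by Laplace's method. The average follows the
    torus action, so the estimate is uniform on the closed polydisc. *)
Lemma fourier_approximation eta : 0 < eta ->
  exists ts : seq (R[i] * (('I_n -> nat) * ('I_n -> nat))), forall z, cpolydisc 1 z ->
    normc (\sum_(t <- ts) t.1 * fourier sigma F t.2.1 t.2.2 z - F z) <= eta.
Proof.
move=> eta0; have e2 : 0 < eta / 2 by rewrite divr_gt0.
have [B B0 FB] := compact_normc_bounded (@compact_cpolydisc R n 1) cF.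
have [d d0 dF] := compact_unif_continuous (@compact_cpolydisc R n 1) cF e2.
have [s s01 sd] := kernel_near_one d0.
(* Away from the identity rotation the difference of two values of [F] is only known to be at most
   [2 * B]. *)
have eB : 0 < eta / 2 / (2 * B) by rewrite divr_gt0// mulr_gt0.
have [N /(_ N (leqnn N)) NP] := laplace_small sT kernel_continuous kernel_01 s01 eB kernel_gt0.
pose c := \int[sigma]_(z in torus) kernel z ^+ N.
have c0 : 0 < c := integral_pow_gt0 sT N kernel_continuous kernel_01 kernel_gt0.
have [us usE] := kernel_pow_trig N.
(* [fourier] integrates against conjugate characters; the kernel is real, so conjugating its whole
   expansion leaves it unchanged. *)
exists [seq ((c^-1)%:C * t.1^*, t.2) | t <- us] => z zD.
have ck := real_complex_continuous (exp_continuous_real (k := N) kernel_continuous).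
have cFz : continuous (fun xi => F (rotate xi z)) := comp_continuous cF (@rotate_continuousl R n z).
have mT := @measurable_torus R n.
have E : \sum_(t <- [seq ((c^-1)%:C * t.1^*, t.2) | t <- us])
      t.1 * fourier sigma F t.2.1 t.2.2 z =
    (c^-1)%:C * Cintegral sigma torus (fun xi => (kernel xi ^+ N)%:C * F (rotate xi z)).
  rewrite big_map /=.
  have it t : cintegrable sigma torus
      (fun xi => (character t.2.1 t.2.2 xi)^* * F (rotate xi z)).
    exact: (continuous_cintegrable sT (mulc_continuous
      (conjc_continuous (@character_continuous R n t.2.1 t.2.2)) cFz)).
  transitivity ((c^-1)%:C * \sum_(t <- us) t.1^* * fourier sigma F t.2.1 t.2.2 z).
    by rewrite mulr_sumr; apply: eq_bigr => t _; rewrite mulrA.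
  congr (_ * _); transitivity (Cintegral sigma torus (fun xi =>
      \sum_(t <- us) t.1^* * ((character t.2.1 t.2.2 xi)^* * F (rotate xi z)))).
    rewrite Cintegral_sum//; last by move=> t; exact: cintegrableZ.
    by apply: eq_bigr => t _; rewrite CintegralZ.
  apply: eq_Cintegral => xi _.
  rewrite -[(kernel xi ^+ N)%:C]conjc_realE -usE /trig_sum.
  rewrite (rmorph_sum (@conjc R)) mulr_suml; apply: eq_bigr => t _ /=.
  by rewrite mulrA; congr (_ * _); exact/esym/conjcM.
have cC : c%:C != 0 :> R[i] by rewrite (inj_eq (@complexI R)) gt_eqF.
have E2 : Cintegral sigma torus (fun xi => (kernel xi ^+ N)%:C * F z) = c%:C * F z.
  transitivity (Cintegral sigma torus (fun xi => F z * (kernel xi ^+ N)%:C)).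
    by apply: eq_Cintegral => xi _; rewrite mulrC.
  rewrite CintegralZ//; last exact: (continuous_cintegrable sT ck).
  by rewrite Cintegral_real mulrC.
have -> : \sum_(t <- [seq ((c^-1)%:C * t.1^*, t.2) | t <- us])
      t.1 * fourier sigma F t.2.1 t.2.2 z - F z = (c^-1)%:C *
    Cintegral sigma torus (fun xi => (kernel xi ^+ N)%:C * (F (rotate xi z) - F z)).
  transitivity ((c^-1)%:C * (Cintegral sigma torus
      (fun xi => (kernel xi ^+ N)%:C * F (rotate xi z)) -
    Cintegral sigma torus (fun xi => (kernel xi ^+ N)%:C * F z))).
    by rewrite E E2 mulrBr mulrA -rmorphM mulVf ?gt_eqF// mul1r.
  rewrite -CintegralB//; last 2 first.
  - exact: (continuous_cintegrable sT (mulc_continuous ck cFz)).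
  - exact: (continuous_cintegrable sT (mulc_continuous ck (@cstc_continuous R n _))).
  by congr (_ * _); apply: eq_Cintegral => xi _; rewrite mulrBr.
rewrite Normc.normcM normc_real ger0_norm ?invr_ge0 ?(ltW c0)// ler_pdivrMl//.
have B20 : 0 <= 2 * B by rewrite mulr_ge0// ltW.
have cFF := subc_continuous cFz (@cstc_continuous R n (F z)).
have [s0 _] := andP s01.
apply: (le_trans (laplace_bound (e := eta / 2) (B := 2 * B) (s := s) sT N
  kernel_continuous cFF kernel_01 (ltW e2) B20 s0 _ _)).
- move=> xi xiT; apply: (le_trans (le_normcB _ _)); rewrite mulr2n mulrDl mul1r.
  by apply: lerD; apply: FB => //; exact/rotate_cpolydisc.
- move=> xi xiT sxi; rewrite normc_sub; apply/ltW/dF => // i.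
  rewrite mxE -[X in X - _]mul1r -mulrBl Normc.normcM normc_sub.
  apply: le_lt_trans (sd xi xiT sxi i).
  by rewrite ler_piMr ?normc_ge0.
- rewrite -/c; have := ler_wpM2l B20 NP; rewrite -/c.
  have -> : 2 * B * (eta / 2 / (2 * B) * c) = eta / 2 * c by field; rewrite gt_eqF.
  by move=> h; lra.
Qed.

End Kernel.

(** * Boundary values of the analytic part *)

Section BoundaryValues.
Context (R : realType) (n : nat) (n_ge2 : (2 <= n)%N) (mu_ : 'I_n -> probability R R)
  (mu : probability (n.-tuple R) R) (sigma theta : probability 'rV[R[i]]_n R).
Hypotheses (mu_product : is_product_measure mu_ mu)
  (mu_radial : forall j, radial_probability (mu_ j))
  (sigma_haar : is_torus_haar sigma) (theta_polar : is_polar_measure mu sigma theta).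
Local Notation Cn := 'rV[R[i]]_n.
Local Notation M := (radial_measure mu).
Local Notation rad := (@cradii R n).
Local Notation one := (const_mx 1 : Cn).
Variables (P : (Cn -> R[i]) -> Cn -> R[i]) (F f : Cn -> R[i]).
Hypotheses (P_projection : is_bergman_projection theta P)
  (cF : continuous F) (fF : forall z, polydisc z -> f z = F z)
  (Hf_compact : compact_hankel theta P f).

Let mu_radii : mu radii = 1%E := product_radii mu_product mu_radial.
Let Mrad : carried_by M rad := radial_carried mu_radii.
Let thD : carried_by theta polydisc := polydisc_carried theta_polar.

Lemma rotate_set_coord1_cpolydisc j (zeta z : Cn) :
  torus zeta -> rad z -> cpolydisc 1 (rotate zeta (set_coord1 j z)).
Proof.
move=> zT zD; apply/rotate_cpolydisc => //; apply: set_coord1_cpolydisc.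
exact/polydisc_sub/cradii_polydisc.
Qed.

(** One polynomial serves on the torus, where convergence is proved, and on all the faces, where [F]
    is to be recognised. It comes from [fourier_approximation] by replacing each component by its
    value at the corner times a monomial. *)
Lemma polynomial_approximation eta : 0 < eta -> exists s : seq (R[i] * ('I_n -> nat)),
  (forall zeta, torus zeta -> normc (mono_sum s zeta - F zeta) <= eta) /\
  (forall j, {ae M, forall z, rad z -> forall zeta, torus zeta ->
     normc (mono_sum s (rotate zeta (set_coord1 j z)) -
            F (rotate zeta (set_coord1 j z))) <= eta}).
Proof.
move=> eta0; have [ts tsP] := fourier_approximation sigma_haar cF eta0.
pose A a b := fourier sigma F a b one.
(* A character with a negative frequency is not a monomial, but its coefficient is then zero. *)
have char_mono a b zeta : torus zeta ->
    character a b zeta * A a b = monomial (fun i => a i - b i)%N zeta * A a b.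
  move=> zT; have [ab|nab] := pselect (exists i, (a i < b i)%N).
    by rewrite /A (fourier_one_eq0 mu_product mu_radial sigma_haar theta_polar
      P_projection cF fF Hf_compact n_ge2 ab) !mulr0.
  rewrite character_sub// => i; apply/orP; left; rewrite leqNgt; apply/negP => abi.
  by apply: nab; exists i.
exists [seq (t.1 * A t.2.1 t.2.2, (fun i => t.2.1 i - t.2.2 i)%N) | t <- ts]; split.
  move=> zeta zT; apply: le_trans (tsP _ (torus_sub zT)).
  rewrite /mono_sum big_map le_eqVlt; apply/orP; left; apply/eqP.
  congr (normc (_ - _)); apply: eq_bigr => t _ /=.
  have -> : fourier sigma F t.2.1 t.2.2 zeta = character t.2.1 t.2.2 zeta * A t.2.1 t.2.2.
    rewrite -(fourier_rotate sigma_haar cF)//; congr fourier.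
    by apply/rowP => i; rewrite !mxE mulr1.
  by rewrite char_mono// [monomial _ _ * _]mulrC mulrA.
move=> j.
have ae_sum : {ae M, forall z, rad z -> forall zeta, torus zeta ->
    mono_sum [seq (t.1 * A t.2.1 t.2.2, (fun i => t.2.1 i - t.2.2 i)%N) | t <- ts]
      (rotate zeta (set_coord1 j z)) =
    \sum_(t <- ts) t.1 * fourier sigma F t.2.1 t.2.2 (rotate zeta (set_coord1 j z))}.
  rewrite /mono_sum; elim: ts {tsP} => [|t ts IH].
    by apply: aeW => z _ zeta _; rewrite !big_nil.
  have tj := fourier_boundary_ae mu_product mu_radial sigma_haar theta_polar
      P_projection cF fF Hf_compact n_ge2 j t.2.1 t.2.2.
  apply: filterS2 IH tj => z IHz tz zD zeta zT.
  rewrite /= !big_cons IHz//; congr (_ + _) => /=.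
  rewrite (fourier_rotate sigma_haar cF)// tz// monomial_rotate -/(A _ _).
  by rewrite [RHS]mulrA -mulrA [A _ _ * (_ * _)]mulrA [A _ _ * monomial _ _]mulrC
    -char_mono// !mulrA.
apply: filterS ae_sum => z h zD zeta zT; rewrite h//; apply: tsP.
exact: rotate_set_coord1_cpolydisc.
Qed.

(** [F] is no polynomial, so the maximum principle is applied to differences of approximants: being
    uniformly Cauchy on the torus, they are so on the closed polydisc, and their limit is [h]. *)
Lemma boundary_extension : exists h : Cn -> R[i],
  [/\ continuous h, holomorphic_on polydisc h &
   forall j, {ae M, forall z, rad z -> forall zeta, torus zeta ->
     F (rotate zeta (set_coord1 j z)) = h (rotate zeta (set_coord1 j z))}].
Proof.
pose e (k : nat) : R := k.+1%:R^-1.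
have e0 k : 0 < e k by rewrite invr_gt0 ltr0n.
have e_small eta : 0 < eta -> exists N, forall k, (N <= k)%N -> e k <= eta.
  move=> eta0; exists (Num.truncn eta^-1) => k Nk.
  rewrite /e -[leRHS]invrK lef_pV2 ?posrE ?ltr0n ?invr_gt0//.
  by apply/ltW; apply: lt_le_trans (truncnS_gt _) _; rewrite ler_nat.
have /choice [s sP] := fun k => polynomial_approximation (e0 k).
have n0 : (0 < n)%N by exact: ltnW.
pose i0 : 'I_n := Ordinal n0.
have Cauchy k m z : cpolydisc 1 z -> normc (mono_sum (s k) z - mono_sum (s m) z) <= e k + e m.
  move=> zD; rewrite -mono_sumB; apply: (polydisc_max_principle sigma_haar) => // zeta zT.
  rewrite mono_sumB; apply: (le_trans (normc_triangle (F zeta) _ _)).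
  have [sk _] := sP k; have [sm _] := sP m.
  by apply: lerD; [exact: sk|rewrite normc_sub; exact: sm].
have /choice [h0 h0P] : forall z : Cn, exists l, cpolydisc 1 z ->
    forall k, normc (mono_sum (s k) z - l) <= 2 * e k.
  move=> z; have [zD|nz] := pselect (cpolydisc 1 z); last by exists 0 => /nz.
  by have [l lP] := complex_limit (fun k m => Cauchy k m z zD); exists l.
(* The values of [h0] outside the closed polydisc are arbitrary; [clip] discards them and makes [h]
   continuous on C^n. *)
pose h z := h0 (clip z).
have hE z : cpolydisc 1 z -> h z = h0 z by move=> zD; rewrite /h clip_id.
have hP k z : cpolydisc 1 z -> normc (mono_sum (s k) z - h z) <= 2 * e k.
  by move=> zD; rewrite hE//; exact: h0P.
have cs k : continuous (mono_sum (s k)).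
  apply: sumc_continuous => t.
  exact: (mulc_continuous (@cstc_continuous R n _) (@monomial_continuous R n _)).
have ch : continuous h.
  apply/continuous_vecP => z eta eta0.
  have eta8 : 0 < eta / 8 by rewrite divr_gt0.
  have [k /(_ k (leqnn k)) ek] := e_small _ eta8.
  have csk := comp_continuous (cs k) (@clip_continuous R n).
  have /continuous_vecP /(_ z _ eta8) [d d0 dP] := csk.
  exists d => // w /dP zw.
  have a1 := h0P (clip z) (@clip_cpolydisc R n z) k.
  have a2 := h0P (clip w) (@clip_cpolydisc R n w) k.
  rewrite -/(h z) in a1; rewrite -/(h w) in a2.
  apply: (le_lt_trans (normc_triangle (mono_sum (s k) (clip z)) _ _)).
  have := normc_triangle (mono_sum (s k) (clip w)) (mono_sum (s k) (clip z)) (h w).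
  rewrite [normc (h z - _)]normc_sub; lra.
have [B B0 hB] := compact_normc_bounded (@compact_cpolydisc R n 1) ch.
exists h; split; first exact: ch.
- move=> z zD.
  have e2_small eta : 0 < eta -> exists N, 2 * e N <= eta.
    move=> eta0; have [N /(_ N (leqnn N)) NP] := e_small _ (divr_gt0 eta0 (ltr0Sn R 1)).
    by exists N; lra.
  exact: (uniform_limit_differentiable sigma_haar i0 e2_small hP hB zD).
- move=> j.
  (* Each approximant has its own exceptional set of radii; the union of countably many null sets is
     null. *)
  have aes := ae_foralln (fun k => (sP k).2 j).
  apply: filterS aes => z hz zD zeta zT.
  apply/eqP; rewrite -subr_eq0 -normc_eq0 eq_le normc_ge0 andbT.
  apply/ler_addgt0Pr => eta eta0; rewrite add0r.
  have [k /(_ k (leqnn k)) ek] := e_small _ (divr_gt0 eta0 (ltr0Sn R 2)).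
  set w := rotate _ _.
  have wD : cpolydisc 1 w by exact: rotate_set_coord1_cpolydisc.
  apply: (le_trans (normc_triangle (mono_sum (s k) w) _ _)).
  have a1 := hz k zD zeta zT; have a2 := hP k w wD; rewrite -/w in a1.
  by rewrite normc_sub; lra.
Qed.

(** What is known concerns radii on faces, what is wanted concerns [theta]. The polar formula links
    them through integrals of continuous functions, so the set where [G] is large near a face is
    detected by a continuous function [Phi j] of integral 0. *)
Lemma vanishing_of_boundary (g G : Cn -> R[i]) : continuous G ->
  (forall z, polydisc z -> g z = G z) ->
  (forall j, {ae M, forall z, rad z -> forall zeta, torus zeta ->
     G (rotate zeta (set_coord1 j z)) = 0}) ->
  vanishing_at_boundary theta g.
Proof.
move=> cG gG G0 e e0; have e2 : 0 < e / 2 by rewrite divr_gt0.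
have [d d0 dG] := compact_unif_continuous (@compact_cpolydisc R n 1) cG e2.
pose d' := Order.min 1 d.
have d'0 : 0 < d' by rewrite lt_min ltr01.
have d'd : d' <= d by rewrite ge_min lexx orbT.
have d'1 : d' <= 1 by rewrite ge_min lexx.
exists (cpolydisc (1 - d')); split; first exact: compact_cpolydisc.
  by move=> z zK; apply/polydiscP => j; apply: le_lt_trans (zK j) _; rewrite ltrBlDr ltrDl.
have cn := normc_continuous cG.
(* Positive exactly where both [|G| > e / 2] and [|z_j| > 1 - d'], and zero elsewhere. *)
pose Phi j (z : Cn) : R := Order.max 0 (1 * normc (G z) + - (e / 2)) *
  Order.max 0 (1 * normc (z 0 j) + - (1 - d')).
have cPhi j : continuous (Phi j).
  have c1 := max0_continuous (affine_continuous (a := 1) (b := - (e / 2)) cn).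
  have c2 := max0_continuous (affine_continuous (a := 1) (b := - (1 - d'))
    (@normc_coord_continuous R n j)).
  by move=> z; exact: (@continuousM R Cn _ _ z (c1 z) (c2 z)).
have Phi0 j z : 0 <= Phi j z by rewrite mulr_ge0// le_max lexx.
have PhiE j : \int[theta]_(z in polydisc) Phi j z = 0.
  apply: (@complexI R); rewrite -Cintegral_real.
  have cP := real_complex_continuous (cPhi j).
  rewrite (Cintegral_polar sigma_haar theta_polar mu_radii cP).
  have cA := torus_average_continuous sigma_haar cP.
  have mrad := @measurable_cradii R n.
  transitivity (Cintegral M rad (fun=> 0)); last exact: Cintegral0.
  (* Either [|z_j| <= 1 - d'] and the second factor vanishes, or [z] is within [d] of its projection
     on the face, where [G] is 0, and the first factor vanishes. *)
  have A0 : {ae M, forall z, rad z -> torus_average sigma (fun z => (Phi j z)%:C) z = 0}.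
    apply: filterS (G0 j) => z Gz zD; rewrite /torus_average.
    rewrite -[RHS](Cintegral_cst (torus_carried sigma_haar)).
    apply: eq_Cintegral => zeta /set_mem zT; rewrite /Phi !mul1r.
    have [zj|zj] := leP (normc (rotate zeta z 0 j)) (1 - d').
      by rewrite [Order.max 0 (normc (rotate zeta z 0 j) + _)]max_l ?mulr0// subr_le0.
    rewrite [Order.max 0 (normc (G _) + _)]max_l ?mul0r// subr_le0.
    have h : normc (G (rotate zeta (set_coord1 j z)) - G (rotate zeta z)) < e / 2.
      apply: dG; first exact: rotate_set_coord1_cpolydisc.
      move=> i; rewrite !mxE; case: eqVneq => [->|_]; last by rewrite subrr Normc.normc0.
      rewrite -mulrBr Normc.normcM; have /torusP -> := zT; rewrite mul1r.
      apply: lt_le_trans d'd; move: zj; rewrite mxE Normc.normcM; have /torusP -> := zT.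
      rewrite mul1r; have [y0 /andP[x0 x1]] := zD j.
      have -> : z 0 j = (complex.Re (z 0 j))%:C by case: (z 0 j) y0 => x y /= ->.
      rewrite -(rmorphB (real_complex R) 1) !normc_real.
      by rewrite (ger0_norm x0) gtr0_norm ?subr_gt0// => zj; lra.
    by move: h; rewrite Gz// sub0r normcN => /ltW.
  congr (_ +i* _); congr fine; apply: ae_eq_integral => //.
  - apply/measurable_EFinP.
    exact: (continuous_measurable_vec (Re_continuous cA) mrad).
  - by apply: filterS A0 => z Az zD; rewrite Az.
  - apply/measurable_EFinP.
    exact: (continuous_measurable_vec (Im_continuous cA) mrad).
  - by apply: filterS A0 => z Az zD; rewrite Az.
have ae_j j := Rintegral_eq0_ae thD (cPhi j) (fun z _ => Phi0 j z) (PhiE j).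
have ae_all : {ae theta, forall z, forall j, polydisc z -> Phi j z = 0}.
  exact: filter_forall.
apply: filterS ae_all => z Pz [zD zK]; rewrite gG// ltNge; apply/negP => eG.
(* Outside the compact set some [|z_j|] exceeds [1 - d']; a value of modulus at least [e] there
   would make [Phi j] positive. *)
apply: zK => j; rewrite leNgt; apply/negP => zj.
have := Pz j zD; rewrite /Phi !mul1r => /eqP; rewrite mulf_eq0 => /orP[]/eqP.
  by rewrite max_r; lra.
by rewrite max_r; lra.
Qed.

End BoundaryValues.

Theorem theorem4p3 (R : realType) (n : nat) (n_ge2 : (2 <= n)%N)
    (mu_ : 'I_n -> probability R R)
    (mu_radial : forall j, radial_probability (mu_ j))
    (mu : probability (n.-tuple R) R)
    (mu_product : is_product_measure mu_ mu)
    (sigma : probability 'rV[R[i]]_n R)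
    (sigma_haar : is_torus_haar sigma)
    (theta : probability 'rV[R[i]]_n R)
    (theta_polar : is_polar_measure mu sigma theta)
    (P : ('rV[R[i]]_n -> R[i]) -> 'rV[R[i]]_n -> R[i])
    (P_projection : is_bergman_projection theta P)
    (f : 'rV[R[i]]_n -> R[i])
    (f_continuous : {within closure polydisc, continuous f})
    (Hf_compact : compact_hankel theta P f) :
  exists h g : 'rV[R[i]]_n -> R[i],
    [/\ {within closure polydisc, continuous h},
        holomorphic_on polydisc h,
        (exists B : R, forall z, polydisc z -> Normc.normc (g z) <= B),
        vanishing_at_boundary theta g &
        {ae theta, forall z, polydisc z -> f z = h z + g z}].
Proof.
pose F z := f (clip z).
have fF z : polydisc z -> f z = F z.
  by move=> zD; rewrite /F clip_id//; exact: polydisc_sub.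
have cF : continuous F := continuous_clip_extension f_continuous.
have [h [ch hol hF]] := boundary_extension n_ge2 mu_product mu_radial sigma_haar
  theta_polar P_projection cF fF Hf_compact.
have cG := subc_continuous cF ch.
have [B B0 GB] := compact_normc_bounded (@compact_cpolydisc R n 1) cG.
exists h, (fun z => f z - h z); split.
- exact: (continuous_subspaceT ch).
- exact: hol.
- by exists B => z zD; rewrite fF//; exact/GB/polydisc_sub.
- apply: (vanishing_of_boundary mu_product mu_radial sigma_haar theta_polar cG).
    by move=> z zD; rewrite fF.
  move=> j; apply: filterS (hF j) => z hz zD zeta zT.
  by rewrite hz// subrr.
- by apply: aeW => z _; rewrite addrC subrK.
Qed.
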